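(* Let $F$ be a positive, increasing, locally integrable real function on $[1,\infty)$ satisfying $F(2x)\ll F(x)$. Suppose that either \[ \log x\ll F(x)\ll x^{\frac{1}{h-1}} \qquad\text{or}\qquad (\log x)^{2h^2}\ll F(x)\ll x^{h-1}. \] Then there exists $A\subseteq\mathbb{Z}_{\ge0}$ such that $|A\cap[1,x]|\asymp (xF(x))^{1/h}$ and $r_{A,h}(n)\asymp F(n)$.
   Context: Fix an integer $h\ge 2$ and positive integers $b_1,\dots,b_h$, not necessarily distinct, with $\gcd(b_1,\dots,b_h)=1$. For $A\subseteq\mathbb{Z}_{\ge 0}$, $1\le\ell\le h$ and an integer $n\ge 0$, let $r_{A,\ell}(n)$ be the number of $\ell$-tuples $(k_1,\dots,k_\ell)\in A^\ell$ with $b_1k_1+\cdots+b_\ell k_\ell=n$. Asymptotic notation: $X\ll Y$ means $|X|\le CY$ for some constant $C>0$ and all sufficiently large values of the variable. $X\asymp Y$ means $X\ll Y$ and $Y\ll X$. *)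

(* Defs.v *)
From mathcomp Require Import all_boot.
From Stdlib Require Import Reals.

Set Implicit Arguments.
Unset Strict Implicit.
Unset Printing Implicit Defensive.

(* Coefficients b_1,...,b_h are encoded as b 0, ..., b (h-1). *)

Definition gcd_coeffs (h : nat) (b : nat -> nat) : nat := \big[gcdn/0]_(i < h) b i.

(* r_{A,l}(n) = #{(k_1,...,k_l) in A^l : b_1 k_1 + ... + b_l k_l = n}.
   Since every b_i >= 1 (a standing hypothesis), each k_i <= n, so the tuples
   range over {0,...,n}^l without loss. *)
Definition r_A (b : nat -> nat) (A : nat -> bool) (l n : nat) : nat :=
  #|[set k : {ffun 'I_l -> 'I_n.+1} |
      [forall i, A (k i)] && (\sum_(i < l) b i * k i == n)]|.

Definition count_upto (A : nat -> bool) (N : nat) : nat :=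
  #|[set a : 'I_N.+1 | A a && (0 < a)]|.

Definition count_real (A : nat -> bool) (x : R) : nat :=
  count_upto A (Z.to_nat (Int_part x)).

Local Open Scope R_scope.

Definition bigO (f g : R -> R) : Prop :=
  exists C : R, 0 < C /\ exists X : R, forall x, X <= x -> Rabs (f x) <= C * g x.

Definition bigO_nat (f g : nat -> R) : Prop :=
  exists C : R, 0 < C /\ exists N : nat, forall n, (N <= n)%nat -> Rabs (f n) <= C * g n.

Definition asymp (f g : R -> R) : Prop := bigO f g /\ bigO g f.
Definition asymp_nat (f g : nat -> R) : Prop := bigO_nat f g /\ bigO_nat g f.

(* Main.v *)
Require Import Defs.
From Stdlib Require Import Reals.
From HB Require Import structures.

(** Let [f(n)^h = n F(n)] and put each [k] into [A] independently with probability
    [min(1, f(k)/k)]; then the expected number of representations of [n] has order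
    [F(n)], and the order of the counting function of [A] follows by summing
    [r_{A,h}] over an interval.

    Upper tail: the expected number of ordered [t]-tuples of pairwise disjoint
    representations is at most the [t]-th power of the expected number of
    representations, while greedily many representations force many such tuples
    unless some element lies in many of them, which is controlled by linear forms
    with fewer variables.  With [t] of order [log n] this settles every [n] with
    [F(n) >= c (log n)^{2h^2}].  For the other [n] (which occur only in the first growth
    regime) a bounded [t] already shows that forms with fewer variables represent a
    number boundedly often, apart from representations with one huge variable and
    the others at most a power of [log n], which are few.

    Lower tail: restrict all but one variable to a window of length of order [n].
    Given [A] on that window, the number of representations is a linear function of
    independent indicators with small coefficients, so Chernoff's bound applies; the
    sum of the coefficients is bounded below by counting [A] in residue classes.
    In the first regime [F] is first multiplied by a large constant.

    All exceptional events are encoded by nonnegative functions of [A] with summable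
    expectations, so only finite probability spaces and König's lemma are needed. *)

(** Origin of the threshold: each deletion or identification of variables costs a factor of order
    log n, so a form with j < h variables must be smaller than F(n) by about (log n)^(h-j). Its mean
    at m <= n is of order f(m)^j / m = F(m) / f(m)^(h-j). This has the required saving as soon as
    f(m) is at least of order (log n)^2, which holds for m >= (log n)^(2h). For smaller m there is
    only the bound m^(j-1), a power of log n with exponent below 2h^2.

    Enlarging F in the first regime must not be circular. Chernoff's bound needs the mean to exceed
    the largest coefficient by a factor C log n, so the constants in the mean and the bound on the
    coefficients must not depend on the multiplier of F. Two facts secure this. The window contains
    no small integers, so the bound for forms with h-1 variables inside it depends on h alone. And
    where F is small one has f(n) <= n, so truncating the probabilities at 1 costs no constant that
    involves the multiplier. *)

Module RandomSets.

From Stdlib Require Import ZArith Lra Lia Psatz FunctionalExtensionality Classical ClassicalEpsilon.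
From mathcomp Require Import all_boot zify.
Set Implicit Arguments.
Unset Strict Implicit.
Unset Printing Implicit Defensive.
Delimit Scope R_scope with R.
Open Scope R_scope.

(** * Expectations over random subsets and disjoint packings *)

HB.instance Definition _ := Monoid.isComLaw.Build R 0%R Rplus
  (fun x y z => esym (Rplus_assoc x y z)) Rplus_comm Rplus_0_l.
HB.instance Definition _ := Monoid.isComLaw.Build R 1%R Rmult
  (fun x y z => esym (Rmult_assoc x y z)) Rmult_comm Rmult_1_l.
HB.instance Definition _ := Monoid.isMulLaw.Build R 0%R Rmult Rmult_0_l Rmult_0_r.
HB.instance Definition _ := Monoid.isAddLaw.Build R Rmult Rplus
  Rmult_plus_distr_r Rmult_plus_distr_l.

Notation "\rsum_ ( i <- s ) F" := (\big[Rplus/0]_(i <- s) F)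
  (at level 41, F at level 41, i, s at level 50).
Notation "\rsum_ ( i <- s | P ) F" := (\big[Rplus/0]_(i <- s | P) F)
  (at level 41, F at level 41, i, s at level 50).
Notation "\rprod_ ( i <- s ) F" := (\big[Rmult/1]_(i <- s) F)
  (at level 36, F at level 36, i, s at level 50).

(** * Finite sums and products of real numbers *)

Section RealSums.
Variables (I : eqType).
Implicit Types (s : seq I) (P : pred I) (F G : I -> R).

Lemma rsum_le s P F G :
  (forall i, i \in s -> P i -> F i <= G i) ->
  \rsum_(i <- s | P i) F i <= \rsum_(i <- s | P i) G i.
Proof.
elim: s => [|a s IH] H; first by rewrite !big_nil; lra.
rewrite !big_cons; have IH' := IH (fun i hi => H i (mem_behead (s := a :: s) hi)).
case Pa: (P a) => //; have := H a (mem_head _ _) Pa; lra.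
Qed.

Lemma rsum_ge0 s P F :
  (forall i, i \in s -> P i -> 0 <= F i) -> 0 <= \rsum_(i <- s | P i) F i.
Proof.
move=> H; have := @rsum_le s P (fun=> 0) F H.
by rewrite big1.
Qed.

Lemma rprod_ge0 s F : (forall i, i \in s -> 0 <= F i) -> 0 <= \rprod_(i <- s) F i.
Proof.
elim: s => [|a s IH] H; first by rewrite big_nil; lra.
rewrite big_cons; apply: Rmult_le_pos; first exact: H (mem_head _ _).
by apply: IH => i hi; apply: H; rewrite inE hi orbT.
Qed.

Lemma rsum_const s (x : R) : \rsum_(i <- s) x = INR (size s) * x.
Proof.
elim: s => [|a s IH]; first by rewrite big_nil /=; lra.
rewrite big_cons IH -[size (a :: s)]/(size s).+1 S_INR; lra.
Qed.

Lemma rsum_filter_le s P F :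
  (forall i, i \in s -> 0 <= F i) -> \rsum_(i <- s | P i) F i <= \rsum_(i <- s) F i.
Proof.
move=> H; rewrite big_mkcond; apply: rsum_le => i hi _.
by case: (P i); [lra | exact: H].
Qed.

Lemma rsum_sub_uniq s s' F :
  uniq s -> {subset s <= s'} -> (forall i, i \in s' -> 0 <= F i) ->
  \rsum_(i <- s) F i <= \rsum_(i <- s') F i.
Proof.
elim: s s' => [|a s IH] s' /=.
  by move=> _ _ H; rewrite big_nil; apply: rsum_ge0 => i hi _; exact: H.
case/andP=> na us sub H.
have a' : a \in s' by apply: sub; rewrite inE eqxx.
rewrite big_cons (big_rem a a') /=; apply: Rplus_le_compat_l; apply: IH => //.
  move=> i hi; have := sub i; rewrite inE hi orbT => /(_ isT) hi'.
  have ne : i != a by apply: contraNneq na => <-.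
  by move: hi'; rewrite (perm_mem (perm_to_rem a')) inE (negPf ne).
by move=> i hi; apply: H; exact: (mem_rem hi).
Qed.

End RealSums.

Lemma term_le_rsum (I : eqType) (s : seq I) (P : pred I) (F : I -> R) i :
  i \in s -> P i -> (forall j, P j -> j \in s -> 0 <= F j) -> F i <= \rsum_(j <- s | P j) F j.
Proof.
move=> si Pi F0; rewrite (big_rem i si) /= Pi.
have : 0 <= \rsum_(j <- rem i s | P j) F j.
  by apply: rsum_ge0 => j js Pj; apply: F0 => //; exact: (mem_rem js).
lra.
Qed.

Lemma rsum_iotaS (F : nat -> R) x d :
  \rsum_(k <- iota x d.+1) F k = (\rsum_(k <- iota x d) F k) + F (x + d)%N.
Proof. by rewrite -addn1 iotaD big_cat /= big_cons big_nil; lra. Qed.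

Lemma INR_sum (I : Type) (s : seq I) (P : pred I) (F : I -> nat) :
  INR (\sum_(i <- s | P i) F i) = \rsum_(i <- s | P i) INR (F i).
Proof. by apply: (big_morph INR) => // x y; rewrite -plus_INR plusE. Qed.

Lemma leR_nat (m n : nat) : (m <= n)%N -> INR m <= INR n.
Proof. by move=> H; apply: le_INR; lia. Qed.

Lemma INR_expn (m n : nat) : INR (m ^ n)%N = INR m ^ n.
Proof. by elim: n => //= n IH; rewrite expnS -multE mult_INR IH. Qed.

Definition upd (A : nat -> bool) (n : nat) (v : bool) : nat -> bool :=
  fun k => if k == n then v else A k.

Section Expectation.
Variable p : nat -> R.
Hypothesis p01 : forall k, 0 <= p k <= 1.

(* The expectation of [X A] when [A] is the random subset of [0, N) containing
   each [k] independently with probability [p k]. *)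
Fixpoint Ex (N : nat) (X : (nat -> bool) -> R) : R :=
  if N is n.+1 then
    p n * Ex n (fun A => X (upd A n true)) + (1 - p n) * Ex n (fun A => X (upd A n false))
  else X (fun _ => false).

Lemma Ex_le N X Y : (forall A, X A <= Y A) -> Ex N X <= Ex N Y.
Proof.
elim: N X Y => [|N IH] X Y H /=; first exact: H.
have [p0 p1] := p01 N.
apply: Rplus_le_compat; apply: Rmult_le_compat_l; try lra; exact: IH.
Qed.

Lemma Ex_ext N X Y : (forall A, X A = Y A) -> Ex N X = Ex N Y.
Proof. by move=> H; congr Ex; apply: functional_extensionality. Qed.

Lemma Ex_const N (x : R) : Ex N (fun _ => x) = x.
Proof. by elim: N => //= N ->; lra. Qed.

Lemma Ex_add N X Y : Ex N (fun A => X A + Y A) = Ex N X + Ex N Y.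
Proof. by elim: N X Y => //= N IH X Y; rewrite !IH; lra. Qed.

Lemma Ex_scal N (x : R) X : Ex N (fun A => x * X A) = x * Ex N X.
Proof. by elim: N X => //= N IH X; rewrite !IH; lra. Qed.

Lemma Ex_sum N (I : Type) (s : seq I) (P : pred I) (X : I -> (nat -> bool) -> R) :
  Ex N (fun A => \rsum_(i <- s | P i) X i A) = \rsum_(i <- s | P i) Ex N (X i).
Proof.
elim: s => [|a s IH].
  by under Ex_ext => A do rewrite big_nil; rewrite Ex_const big_nil.
rewrite big_cons -IH; case Pa: (P a).
  by rewrite -Ex_add; apply: Ex_ext => A; rewrite big_cons Pa.
by apply: Ex_ext => A; rewrite big_cons Pa.
Qed.

Lemma Ex_attained N X : exists A, X A <= Ex N X.
Proof.
elim: N X => [|N IH] X /=; first by exists (fun _ => false); lra.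
have [A1 H1] := IH (fun A => X (upd A N true)).
have [A2 H2] := IH (fun A => X (upd A N false)).
have [p0 p1] := p01 N.
case: (Rle_dec (X (upd A1 N true)) (X (upd A2 N false))) => H.
  by exists (upd A1 N true); nra.
by exists (upd A2 N false); nra.
Qed.

(** Independence of distinct elements. Equality fails only if [S] reaches beyond [N]: such an
    element is never in the random set, which only lowers the left-hand side. *)
Lemma Ex_all N (S : seq nat) : uniq S -> Ex N (fun A => INR (all A S)) <= \rprod_(k <- S) p k.
Proof.
elim: N S => [|N IH] S uS /=.
  case: S uS => [|a S] _ /=; first by rewrite big_nil /=; lra.
  by apply: rprod_ge0 => k _; have := p01 k; lra.
case NS: (N \in S).
  have -> : (fun A : nat -> bool => INR (all (upd A N true) S)) = fun A => INR (all A (rem N S)).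
    apply: functional_extensionality => A; congr (INR (nat_of_bool _)).
    rewrite rem_filter //; apply/allP/allP => H k.
      by rewrite mem_filter => /andP [/= ne kS]; move: (H k kS); rewrite /upd (negPf ne).
    move=> kS; rewrite /upd; case: eqP => // /eqP ne; apply: H.
    by rewrite mem_filter /= ne.
  have -> : (fun A : nat -> bool => INR (all (upd A N false) S)) = fun A => 0.
    apply: functional_extensionality => A; suff -> : all (upd A N false) S = false by [].
    by apply/negP => /allP /(_ N NS); rewrite /upd eqxx.
  rewrite Ex_const (big_rem N NS) /=.
  rewrite Rmult_0_r Rplus_0_r; apply: Rmult_le_compat_l; first by have := p01 N; lra.
  exact: IH (rem_uniq N uS).
have E v : (fun A : nat -> bool => INR (all (upd A N v) S)) = fun A => INR (all A S).
  apply: functional_extensionality => A; congr (INR (nat_of_bool _)).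
  apply: eq_in_all => k kS; rewrite /upd; case: eqP => // kN.
  by rewrite -kN kS in NS.
rewrite !E; apply: Rle_trans (IH _ uS); right; ring.
Qed.

(* Number of ordered [t]-tuples of edges of the hypergraph [T] lying in [A],
   pairwise disjoint and disjoint from [S]. *)
Fixpoint packings (T : seq (seq nat)) (t : nat) (S : seq nat) (A : nat -> bool) : nat :=
  if t is t'.+1 then \sum_(e <- T | all A e && uniq (e ++ S)) packings T t' (e ++ S) A
  else 1%N.

(** An edge disjoint from everything chosen before is independent of it and contributes its own
    product of probabilities. The factor [all A S] remembers the vertices already used, so that
    choosing [e] just replaces [S] by [e ++ S]; dropping the disjointness condition from the sum
    then yields a full factor [W]. *)
Lemma Ex_packings_cond N T t S : uniq S ->
  Ex N (fun A => INR (all A S) * INR (packings T t S A)) <=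
  \rprod_(k <- S) p k * (\rsum_(e <- T) \rprod_(k <- e) p k) ^ t.
Proof.
set W := \rsum_(e <- T) _.
have W0 : 0 <= W.
  by apply: rsum_ge0 => e _ _; apply: rprod_ge0 => k _; have := p01 k; lra.
have pr0 (s : seq nat) : 0 <= \rprod_(k <- s) p k.
  by apply: rprod_ge0 => k _; have := p01 k; lra.
elim: t S => [|t IH] S uS.
  rewrite /= Rmult_1_r; under Ex_ext => A do rewrite Rmult_1_r.
  exact: Ex_all.
have -> : Ex N (fun A => INR (all A S) * INR (packings T t.+1 S A)) =
    \rsum_(e <- T | uniq (e ++ S))
       Ex N (fun A => INR (all A (e ++ S)) * INR (packings T t (e ++ S) A)).
  rewrite -Ex_sum; apply: Ex_ext => A /=.
  rewrite INR_sum big_distrr /= big_mkcond [RHS]big_mkcond /=.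
  apply: eq_bigr => e _; rewrite all_cat.
  by case: (all A e) => /=; case: (uniq _) => //=; rewrite Rmult_0_l.
apply: Rle_trans (_ : \rsum_(e <- T | uniq (e ++ S))
     (\rprod_(k <- S) p k * W ^ t * \rprod_(k <- e) p k) <= _).
  apply: rsum_le => e _ ue; have := IH _ ue; rewrite big_cat /=.
  move=> H; apply: Rle_trans H _; right; ring.
apply: Rle_trans (rsum_filter_le _ _) _.
  move=> e _; apply: Rmult_le_pos; last exact: pr0.
  apply: Rmult_le_pos; [exact: pr0 | exact: pow_le].
rewrite -big_distrr /= -/W; right; ring.
Qed.

Lemma Ex_packings N T t :
  Ex N (fun A => INR (packings T t [::] A)) <= (\rsum_(e <- T) \rprod_(k <- e) p k) ^ t.
Proof.
have := @Ex_packings_cond N T t [::] isT; rewrite big_nil Rmult_1_l.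
by under Ex_ext => A do rewrite /= Rmult_1_l.
Qed.

End Expectation.

Lemma packings_sub_set T t S (A A' : nat -> bool) :
  (forall k, A k -> A' k) -> (packings T t S A <= packings T t S A')%N.
Proof.
move=> sub; elim: t S => //= t IH S.
rewrite big_mkcond [X in (_ <= X)%N]big_mkcond; apply: leq_sum => e _.
case: (boolP (all A e)) => //= Ae.
by rewrite (sub_all sub Ae) /=; case: (uniq _).
Qed.

Lemma packings_filter T t S A (P : pred (seq nat)) :
  (packings [seq e <- T | P e] t S A <= packings T t S A)%N.
Proof.
elim: t S => //= t IH S; rewrite big_filter_cond.
rewrite big_mkcond [X in (_ <= X)%N]big_mkcond; apply: leq_sum => e _.
by case: (P e) => //=; case: (_ && _).
Qed.

Definition edges_in (T : seq (seq nat)) (A : nat -> bool) :=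
  [seq e <- T | all A e && uniq e].

(** The vertices used so far meet at most [d] edges each, so at every step all but a bounded number
    of edges are still available. The subtraction is truncated, which makes the bound void when
    there are few edges. *)
Lemma packings_greedy T A j d t S :
  uniq S -> (forall e, e \in T -> (size e <= j)%N) ->
  (forall v, (count (fun e => v \in e) (edges_in T A) <= d)%N) ->
  ((size (edges_in T A) - (size S + j * t) * d) ^ t <= packings T t S A)%N.
Proof.
move=> + Hj Hd; elim: t S => [|t IH] S uS; first by rewrite expn0.
rewrite expnS /=.
(* The subtracted term already pays for all the edges still to be chosen, so the same [X] bounds the
   number of choices at each later step. *)
set X := (_ - _)%N.
have cnt : (X <= count (fun e => all A e && uniq (e ++ S)) T)%N.
  have touch : (count (fun e => has (mem S) e) (edges_in T A) <= size S * d)%N.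
    elim: (S) => [|a s IHs] /=; first by rewrite (eq_count (a2 := pred0)) ?count_pred0 // => e; rewrite has_pred0.
    rewrite mulSn; apply: leq_trans (leq_add (Hd a) IHs).
    apply: leq_trans (_ : (count (predU (fun e => a \in e) (fun e => has (mem s) e)) (edges_in T A) <= _)%N).
      apply: sub_count => e /hasP [x xe]; rewrite !inE /= => /orP [/eqP <-|xs]; first by rewrite xe.
      by apply/orP; right; apply/hasP; exists x.
    by rewrite -count_predUI leq_addr.
  have split : size (edges_in T A) = (count (fun e => has (mem S) e) (edges_in T A) +
      count (fun e => all A e && uniq (e ++ S)) T)%N.
    rewrite -(count_predC (fun e => has (mem S) e)); congr addn.
    rewrite /edges_in count_filter; apply: eq_count => e /=.
    rewrite cat_uniq uS andbT has_sym; case: (all A e) => //=; last by rewrite andbF.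
    by rewrite andbC.
  rewrite /X leq_subLR split leq_add2r; apply: leq_trans touch _.
  by rewrite leq_mul2r leq_addr orbT.
apply: leq_trans (_ : (\sum_(e <- T | all A e && uniq (e ++ S)) X ^ t <= _)%N).
  by rewrite big_const_seq iter_addn_0 mulnC leq_mul2l cnt orbT.
rewrite big_seq_cond [X in (_ <= X)%N]big_seq_cond; apply: leq_sum => e /and3P [eT _ ue].
apply: leq_trans (IH _ ue).
case: (posnP t) => [->|t0]; first by rewrite !expn0.
rewrite leq_exp2r //; apply: leq_sub2l; rewrite leq_mul2r size_cat; apply/orP; right.
by rewrite mulnS addnA leq_add2r addnC leq_add2l Hj.
Qed.

Lemma edges_in_le T A j d t (Z : R) :
  (0 < t)%N -> 0 <= Z -> (forall e, e \in T -> (size e <= j)%N) ->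
  (forall v, (count (fun e => v \in e) (edges_in T A) <= d)%N) ->
  INR (packings T t [::] A) < Z ^ t ->
  INR (size (edges_in T A)) <= Z + INR (j * t * d).
Proof.
move=> t0 Z0 Hj Hd HZ; have := @packings_greedy T A j d t [::] isT Hj Hd.
rewrite add0n; set X := (_ - _)%N => HX.
have XZ : INR X <= Z.
  apply: Rnot_lt_le => ZX; apply: (Rlt_irrefl (Z ^ t)); apply: Rle_lt_trans HZ.
  apply: Rle_trans (leR_nat HX); rewrite INR_expn; apply: pow_incr; lra.
have : (size (edges_in T A) <= X + j * t * d)%N by rewrite /X addnC -leq_subLR.
by move/leR_nat; rewrite -plusE plus_INR; lra.
Qed.

(** * Concentration and compactness *)

Definition local (T : Type) (x : nat) (X : (nat -> bool) -> T) :=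
  forall A B, (forall k, (k < x)%N -> A k = B k) -> X A = X B.

Lemma local_upd (T : Type) x (X : (nat -> bool) -> T) A n v :
  local x X -> (x <= n)%N -> X (upd A n v) = X A.
Proof.
move=> H xn; apply: H => k kx; rewrite /upd; case: eqP => // kn.
by move: kx; rewrite kn ltnNge xn.
Qed.

Lemma exp_neg_le y : 0 <= y <= 1 -> exp (- y) <= 1 - y / 2.
Proof.
move=> [y0 y1]; rewrite exp_Ropp.
have H := exp_ineq1_le y.
apply: Rle_trans (_ : / (1 + y) <= _).
  by apply: Rinv_le_contravar => //; lra.
apply: (Rmult_le_reg_l (1 + y)); first lra.
rewrite Rinv_r; last lra.
nra.
Qed.

Section Concentration.
Variable p : nat -> R.
Hypothesis p01 : forall k, 0 <= p k <= 1.

(** The Laplace transform behind Chernoff's bound, conditionally on the part of [A] below [x], which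
    determines the weights. [G] serves as an indicator of good conditions: the weights need to lie
    in [0,1] only where it does not vanish. *)
Lemma Ex_exp_linear x d (G : (nat -> bool) -> R) (w : (nat -> bool) -> nat -> R) :
  (forall A, 0 <= G A) -> local x G -> (forall k, local x (fun A => w A k)) ->
  (forall A k, G A <> 0 -> 0 <= w A k <= 1) ->
  Ex p (x + d) (fun A => G A * exp (- \rsum_(k <- iota x d) INR (A k) * w A k)) <=
  Ex p (x + d) (fun A => G A * exp (- \rsum_(k <- iota x d) p k * w A k / 2)).
Proof.
elim: d G => [|d IH] G G0 lG lw Hw.
  by apply: Ex_le => // A; rewrite !big_nil; lra.
have [pl pu] := p01 (x + d).
have notin k : k \in iota x d -> (k == x + d)%N = false by rewrite mem_iota; lia.
(* Factor left after averaging over the last element [x + d]. It depends only on [A] below [x], so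
   it can be absorbed into [G] for the induction. *)
pose g A := 1 - p (x + d) + p (x + d) * exp (- w A (x + d)%N).
have xd : (x <= x + d)%N by rewrite leq_addr.
have left : Ex p (x + d.+1)%N (fun A => G A * exp (- \rsum_(k <- iota x d.+1) INR (A k) * w A k)) =
    Ex p (x + d) (fun A => G A * g A * exp (- \rsum_(k <- iota x d) INR (A k) * w A k)).
  rewrite addnS /= -!Ex_scal -Ex_add; apply: Ex_ext => A.
  rewrite !(local_upd _ _ lG) // !rsum_iotaS !(local_upd _ _ (lw _)) //.
  have E v : \rsum_(k <- iota x d) (INR (upd A (x + d) v k) * w (upd A (x + d) v) k) =
             \rsum_(k <- iota x d) (INR (A k) * w A k).
    rewrite big_seq [RHS]big_seq; apply: eq_bigr => k kd.
    by rewrite (local_upd _ _ (lw _)) // /upd notin.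
  rewrite !E /upd eqxx /= !Ropp_plus_distr !exp_plus Rmult_0_l Ropp_0 exp_0 Rmult_1_l.
  by rewrite /g; ring.
have right : Ex p (x + d.+1)%N (fun A => G A * exp (- \rsum_(k <- iota x d.+1) p k * w A k / 2)) =
    Ex p (x + d) (fun A => G A * exp (- (p (x + d) * w A (x + d)%N / 2)) *
       exp (- \rsum_(k <- iota x d) p k * w A k / 2)).
  rewrite addnS /= -!Ex_scal -Ex_add; apply: Ex_ext => A.
  rewrite !(local_upd _ _ lG) // !rsum_iotaS !(local_upd _ _ (lw _)) //.
  have E v : \rsum_(k <- iota x d) (p k * w (upd A (x + d) v) k / 2) =
             \rsum_(k <- iota x d) (p k * w A k / 2).
    by apply: eq_bigr => k _; rewrite (local_upd _ _ (lw _)).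
  by rewrite !E !Ropp_plus_distr !exp_plus; ring.
have g0 A : 0 <= g A by rewrite /g; have := exp_pos (- w A (x + d)%N); nra.
rewrite left right; apply: Rle_trans (IH (fun A => G A * g A) _ _ lw _) _.
- by move=> A; apply: Rmult_le_pos.
- by move=> A B AB; rewrite /g (lG _ _ AB) (lw _ _ _ AB).
- by move=> A k H; apply: Hw => H'; apply: H; rewrite H' Rmult_0_l.
apply: Ex_le => // A; apply: Rmult_le_compat_r; first by left; exact: exp_pos.
case: (Req_dec (G A) 0) => [->|GA]; first by rewrite !Rmult_0_l; lra.
apply: Rmult_le_compat_l; first exact: G0.
have [w0 w1] := Hw A (x + d)%N GA.
have := exp_neg_le (conj w0 w1); have := exp_ineq1_le (- (p (x + d) * w A (x + d)%N / 2)).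
rewrite /g; nra.
Qed.

End Concentration.

(* König's lemma for the tree of finite prefixes. *)
Lemma compactness (Good : nat -> (nat -> bool) -> Prop) :
  (forall n, local n.+1 (Good n)) ->
  (forall N, exists A, forall n, (n < N)%N -> Good n A) ->
  exists A, forall n, Good n A.
Proof.
move=> loc fin.
(* The prefix of length [L] survives if for every [N] it extends to a set that is good up to [N];
   [pre] adds the next integer whenever the longer prefix survives. *)
pose Ext L A := forall N, exists B : nat -> bool,
  (forall k, (k < L)%N -> B k = A k) /\ (forall n, (n < N)%N -> Good n B).
pose pre := fix pre L : nat -> bool := if L is l.+1 then
   upd (pre l) l (if excluded_middle_informative (Ext l.+1 (upd (pre l) l true)) then true else false)
  else fun _ => false.
have Hpre L : Ext L (pre L).
  elim: L => [|L IH] /=.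
    by move=> N; have [A HA] := fin N; exists A.
  (* If putting [L] into the set fails at [N1], then an extension good up to [maxn N N1] must omit
     [L], so the other branch survives. *)
  case: excluded_middle_informative => // nT.
  move=> N; have [N1 HN1] := not_all_ex_not _ _ nT.
  have [B [BA BG]] := IH (maxn N N1).
  case BL: (B L).
    exfalso; apply: HN1; exists B; split=> [k kL|n nN]; last by apply: BG; lia.
    by rewrite /upd; case: eqP => [->|] // ne; apply: BA; lia.
  exists B; split=> [k kL|n nN]; last by apply: BG; lia.
  by rewrite /upd; case: eqP => [->|] // ne; apply: BA; lia.
have stable L k : (k < L)%N -> pre L k = pre k.+1 k.
  elim: L => // L IH; rewrite ltnS leq_eqVlt => /orP [/eqP -> //|kL].
  by rewrite -IH //= /upd; case: eqP => // kL'; lia.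
exists (fun k => pre k.+1 k) => n.
have [B [BA BG]] := Hpre n.+1 n.+1.
rewrite (loc n _ B); first by apply: BG.
by move=> k kn; rewrite BA // stable.
Qed.

Lemma Ex_local p N n X : local n X -> (n <= N)%N -> Ex p N X = Ex p n X.
Proof.
move=> loc; elim: N => [|N IH]; first by rewrite leqn0 => /eqP ->.
rewrite leq_eqVlt => /orP [/eqP -> //|nN]; rewrite -(IH nN) /=.
have E v : (fun A => X (upd A N v)) = X.
  by apply: functional_extensionality => A; rewrite (local_upd _ _ loc).
by rewrite !E; ring.
Qed.

Lemma packings_local n (T : seq (seq nat)) t S : (forall e k, e \in T -> k \in e -> (k < n)%N) ->
  local n (packings T t S).
Proof.
move=> H A B AB; elim: t S => //= t IH S.
rewrite big_seq_cond [RHS]big_seq_cond; apply: eq_big => [e|e _]; last exact: IH.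
case: (boolP (e \in T)) => //= eT; congr andb; apply: eq_in_all => k ke.
exact: AB (H _ _ eT ke).
Qed.

Lemma sum_inv_sq N1 d : (1 < N1)%N ->
  \rsum_(n <- iota N1 d) (/ INR n ^ 2) <= / (INR N1 - 1) - / (INR (N1 + d) - 1).
Proof.
move=> N1gt; have N1R : 2 <= INR N1 by apply: (leR_nat N1gt).
elim: d => [|d IH]; first by rewrite big_nil addn0; lra.
rewrite rsum_iotaS addnS S_INR.
set y := INR (N1 + d) in IH *.
have y2 : 2 <= y by apply: Rle_trans N1R (leR_nat _); rewrite leq_addr.
have : / y ^ 2 <= / (y - 1) - / (y + 1 - 1).
  have -> : / (y - 1) - / (y + 1 - 1) = / ((y - 1) * y) by field; lra.
  by apply: Rinv_le_contravar; nra.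
lra.
Qed.

(** From [N1] on, the total expectation stays below 1 whatever the cut-off [N]. A set not exceeding
    the mean keeps every nonnegative term below 1, and compactness removes the cut-off; this
    replaces the Borel-Cantelli lemma. *)
Lemma exists_good_set (p : nat -> R) (p01 : forall k, 0 <= p k <= 1)
  (Phi : nat -> (nat -> bool) -> R) (C : R) (N0 : nat) :
  (forall n A, 0 <= Phi n A) -> (forall n, local n.+1 (Phi n)) ->
  (forall n, (N0 <= n)%N -> Ex p n.+1 (Phi n) <= C / INR n ^ 2) ->
  exists A N1, forall n, (N1 <= n)%N -> Phi n A < 1.
Proof.
move=> Phi0 loc HE.
have [N1 [N1a [N1b N1c]]] : exists N1, (N0 <= N1)%N /\ (1 < N1)%N /\ C < INR N1 - 1.
  have [k Hk] := INR_unbounded (Rmax C 0 + 1).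
  have := Rmax_l C 0; have := Rmax_r C 0 => m0 m1.
  exists (maxn N0 (maxn 2 k)); split; first by lia.
  split; first by lia.
  have := @leR_nat k (maxn N0 (maxn 2 k)); have -> : (k <= maxn N0 (maxn 2 k))%N by lia.
  by move/(_ isT); lra.
suff [A HA] : exists A, forall n, (N1 <= n)%N -> Phi n A < 1 by exists A, N1.
apply: (@compactness (fun n A => (N1 <= n)%N -> Phi n A < 1)).
  by move=> n A B AB; rewrite (loc n _ _ AB).
move=> N.
have [A HA] := @Ex_attained p p01 N (fun A => \rsum_(n <- iota N1 (N - N1)) Phi n A).
exists A => n nN N1n.
apply: Rle_lt_trans (_ : \rsum_(n <- iota N1 (N - N1)) Phi n A < _).
  have nI : n \in iota N1 (N - N1) by rewrite mem_iota; lia.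
  have -> : Phi n A = \rsum_(i <- [:: n]) Phi i A by rewrite big_cons big_nil; lra.
  by apply: rsum_sub_uniq => // i; rewrite inE => /eqP ->.
apply: Rle_lt_trans HA _; rewrite Ex_sum.
apply: Rle_lt_trans (_ : \rsum_(n <- iota N1 (N - N1)) (Rmax C 0 * / INR n ^ 2) < _).
  apply: rsum_le => i; rewrite mem_iota => /andP [i1 i2] _.
  rewrite (Ex_local _ (loc i)); last by lia.
  apply: Rle_trans (HE _ _) _; first by lia.
  apply: Rmult_le_compat_r; last exact: Rmax_l.
  by left; apply: Rinv_0_lt_compat; apply: pow_lt; apply: lt_0_INR; lia.
rewrite -big_distrr /=.
have S := @sum_inv_sq N1 (N - N1) N1b.
have N1R : 2 <= INR N1 by apply: (leR_nat N1b).
have : 0 < / (INR (N1 + (N - N1)) - 1).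
  apply: Rinv_0_lt_compat; have := @leR_nat N1 (N1 + (N - N1)); rewrite leq_addr => /(_ isT); lra.
move=> i0.
have S' : \rsum_(n <- iota N1 (N - N1)) (/ INR n ^ 2) <= / (INR N1 - 1) by lra.
apply: Rle_lt_trans (Rmult_le_compat_l _ _ _ (Rmax_r C 0) S') _.
apply: (Rmult_lt_reg_r (INR N1 - 1)); first lra.
rewrite Rmult_assoc Rinv_l; last lra.
by rewrite Rmult_1_r Rmult_1_l; apply: Rmax_lub_lt; lra.
Qed.

(** * Representations by linear forms *)

Fixpoint dot (c t : seq nat) : nat :=
  match c, t with
  | c0 :: c', k :: t' => c0 * k + dot c' t'
  | _, _ => 0
  end%N.

(** Only tuples with positive entries are listed, since the inclusion probability f(k)/k concerns
    positive k; the element 0 is dealt with when returning to [r_A]. *)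
Fixpoint sol (c : seq nat) (m : nat) : seq (seq nat) :=
  if c is c0 :: c' then
    flatten [seq [seq k :: t | t <- sol c' (m - c0 * k)] |
             k <- [seq k <- iota 1 m | (c0 * k <= m)%N]]
  else if m == 0%N then [:: [::]] else [::].

Lemma mem_sol c m t : all (ltn 0%N) c ->
  (t \in sol c m) = [&& size t == size c, all (ltn 0%N) t & dot c t == m].
Proof.
elim: c m t => [|c0 c IH] m t /=.
  by move=> _; case: t => [|a t]; rewrite eq_sym; case: (0%N =P m).
case/andP=> c00 cpos.
apply/flatten_mapP/idP => [[k kI /mapP [s sS ->]]|].
  move: kI sS; rewrite mem_filter mem_iota => /andP [km kI].
  rewrite IH // => /and3P [/eqP ss sp /eqP sd] /=.
  rewrite ss eqxx sp sd /= andbT; lia.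
case: t => [|k s] //= /and3P [ss /andP [k0 sp] /eqP sd].
have km : (c0 * k <= m)%N by lia.
exists k; last by apply/mapP; exists s => //; rewrite IH // -eqSS ss sp; lia.
by rewrite mem_filter mem_iota km; nia.
Qed.

Lemma sol_uniq c m : uniq (sol c m).
Proof.
elim: c m => [|c0 c IH] m /=; first by case: eqP.
set L := [seq k <- _ | _].
have : uniq L by rewrite filter_uniq ?iota_uniq.
elim: L => //= k L IHL /andP [kL uL].
rewrite cat_uniq map_inj_uniq ?IH ?IHL //=; last by move=> x y [].
rewrite andbT; apply/hasPn => t /flatten_mapP [k' k'L /mapP [s _ ->]].
by apply/negP => /mapP [s' _ [kk' _]]; rewrite -kk' k'L in kL.
Qed.

Definition reps (A : nat -> bool) c m := [seq t <- sol c m | all A t].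
Definition rep A c m := size (reps A c m).

Lemma reps_uniq A c m : uniq (reps A c m).
Proof. by rewrite filter_uniq ?sol_uniq. Qed.

Lemma mem_reps A c m t : all (ltn 0%N) c ->
  (t \in reps A c m) = [&& all A t, size t == size c, all (ltn 0%N) t & dot c t == m].
Proof. by move=> cp; rewrite mem_filter mem_sol. Qed.

Lemma rep_nil A m : rep A [::] m = (m == 0)%N.
Proof. by rewrite /rep /reps /=; case: (m == 0)%N. Qed.

Lemma rep_cons A c0 c m : rep A (c0 :: c) m =
  (\sum_(k <- iota 1 m | (c0 * k <= m)%N) A k * rep A c (m - c0 * k))%N.
Proof.
rewrite /rep /reps size_filter /= count_flatten sumnE big_map big_map big_filter.
apply: eq_bigr => k _; rewrite count_map size_filter.
case Ak: (A k) => /=; rewrite ?mul1n ?mul0n.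
  by apply: eq_count => t /=; rewrite Ak.
by rewrite (eq_count (a2 := pred0)) ?count_pred0 // => t /=; rewrite Ak.
Qed.

Lemma rep_m0 A c : all (ltn 0%N) c -> (0 < size c)%N -> rep A c 0 = 0%N.
Proof.
move=> cp sc; rewrite /rep /reps; case: c cp sc => //= c0 c _ _.
Qed.

Lemma eq_rep (A A' : nat -> bool) c m : all (ltn 0%N) c ->
  (forall k, (0 < k <= m)%N -> A k = A' k) -> rep A c m = rep A' c m.
Proof.
elim: c m => [|c0 c IH] m cp H; first by rewrite !rep_nil.
move: cp => /= /andP [c00 cp].
rewrite !rep_cons big_seq_cond [RHS]big_seq_cond; apply: eq_bigr => k.
rewrite mem_iota => /andP [/andP [k1 k2] k3]; rewrite H; last lia.
by congr muln; apply: IH => // k' Hk'; apply: H; lia.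
Qed.

Lemma rep_le_set (A A' : nat -> bool) c m :
  (forall k, A k -> A' k) -> (rep A c m <= rep A' c m)%N.
Proof.
move=> H; rewrite /rep /reps !size_filter; apply: sub_count => t; exact: sub_all.
Qed.

(** * Deleting and identifying variables *)

Definition del (i : nat) (s : seq nat) := take i s ++ drop i.+1 s.
Definition ins (i v : nat) (s : seq nat) := take i s ++ v :: drop i s.

Lemma size_del i s : (i < size s)%N -> size (del i s) = (size s).-1.
Proof. by move=> H; rewrite size_cat size_takel ?size_drop; lia. Qed.

Lemma all_del (a : pred nat) i s : all a s -> all a (del i s).
Proof.
by move=> /allP H; apply/allP => x; rewrite mem_cat => /orP [/mem_take|/mem_drop] /H.
Qed.

Lemma ins_del i s : (i < size s)%N -> ins i (nth 0%N s i) (del i s) = s.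
Proof.
move=> H; rewrite /ins /del take_size_cat ?drop_size_cat ?size_takel 1?ltnW //.
by rewrite -drop_nth // cat_take_drop.
Qed.

Lemma nth_del i i' s : (i < i')%N -> (i' < size s)%N -> nth 0%N (del i' s) i = nth 0%N s i.
Proof. by move=> H H'; rewrite /del nth_cat size_takel ?H ?nth_take // ltnW. Qed.

Lemma dot_del i c t : size c = size t -> (i < size c)%N ->
  dot c t = (nth 0%N c i * nth 0%N t i + dot (del i c) (del i t))%N.
Proof.
elim: i c t => [|i IH] [|c0 c] [|k t] //= [sz] H; first by rewrite /del /= !drop0.
by rewrite (IH _ _ sz) // /del /=; lia.
Qed.

Lemma sumn_del i c : (i < size c)%N -> sumn c = (nth 0%N c i + sumn (del i c))%N.
Proof.
move=> H; rewrite /del sumn_cat -{1}(cat_take_drop i c) sumn_cat (drop_nth 0%N H) /=; lia.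
Qed.

(** The form after the substitution x_i' = x_i, with the merged variable moved to the front. For i <
    i' the larger index is deleted first, so that i keeps its meaning. *)
Definition merge_at i i' c :=
  (nth 0%N c i + nth 0%N c i')%N :: del i (del i' c).

Lemma count_sum (T : Type) (P : pred T) s : count P s = (\sum_(x <- s) P x)%N.
Proof. by elim: s => [|a s IH] /=; rewrite ?big_nil // big_cons IH. Qed.

Section Counting.
Variables (A : nat -> bool) (c : seq nat) (m : nat).
Hypothesis cpos : all (ltn 0%N) c.

Lemma count_nth_le i v : (i < size c)%N ->
  (count (fun t => nth 0%N t i == v) (reps A c m) <= rep A (del i c) (m - nth 0%N c i * v))%N.
Proof.
move=> ic; rewrite -size_filter -(size_map (del i)); apply: uniq_leq_size.
  rewrite map_inj_in_uniq ?(filter_uniq _ (reps_uniq A c m)) // => s s'.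
  rewrite !mem_filter !mem_sol // => /andP [/eqP sv /and4P [_ /eqP ss _ _]].
  move=> /andP [/eqP sv' /and4P [_ /eqP ss' _ _]] E.
  by rewrite -(ins_del (i := i) (s := s)) ?ss // E sv -sv' ins_del ?ss'.
move=> t' /mapP [t]; rewrite mem_filter mem_reps // => /andP [/eqP tv /and4P [tA /eqP ts tp /eqP td]] ->.
rewrite mem_reps ?all_del // !size_del ?ts // eqxx /=.
by rewrite (dot_del (i := i)) // tv in td; rewrite -td; lia.
Qed.

Lemma count_nth_gt i v : (i < size c)%N -> (m < nth 0%N c i * v)%N ->
  count (fun t => nth 0%N t i == v) (reps A c m) = 0%N.
Proof.
move=> ic H; apply/eqP; rewrite -leqn0 leqNgt -has_count; apply/negP => /hasP [t].
rewrite mem_reps // => /and4P [_ /eqP ts _ /eqP td] /eqP tv.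
by rewrite (dot_del (i := i)) // tv in td; lia.
Qed.

Lemma count_eq_le i i' : (i < i')%N -> (i' < size c)%N ->
  (count (fun t => nth 0%N t i == nth 0%N t i') (reps A c m) <= rep A (merge_at i i' c) m)%N.
Proof.
move=> ii' ic; pose phi t := nth 0%N t i :: del i (del i' t).
rewrite -size_filter -(size_map phi); apply: uniq_leq_size.
  rewrite map_inj_in_uniq ?(filter_uniq _ (reps_uniq A c m)) // => s s'.
  rewrite !mem_filter !mem_sol // => /andP [/eqP sv /and4P [_ /eqP ss _ _]].
  move=> /andP [/eqP sv' /and4P [_ /eqP ss' _ _]] [E1 E2].
  have E : del i' s = del i' s'.
    have D1 : ins i (nth 0%N (del i' s) i) (del i (del i' s)) = del i' s.
      by apply: ins_del; rewrite size_del ss //; lia.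
    have D2 : ins i (nth 0%N (del i' s') i) (del i (del i' s')) = del i' s'.
      by apply: ins_del; rewrite size_del ss' //; lia.
    rewrite nth_del ?ss // in D1; rewrite nth_del ?ss' // in D2.
    by rewrite -D1 -D2 E1 E2.
  by rewrite -(ins_del (i := i') (s := s)) ?ss // E -sv E1 sv' ins_del ?ss'.
move=> t' /mapP [t]; rewrite mem_filter mem_reps // => /andP [/eqP tv /and4P [tA /eqP ts tp /eqP td]] ->.
have ti : (i < size t)%N by lia.
have Hd : (i < size (del i' c))%N by rewrite size_del; lia.
rewrite mem_reps; last first.
  rewrite /= !all_del // andbT; have := allP cpos _ (mem_nth 0%N ic); rewrite /=; lia.
rewrite /= !all_del // !size_del ?ts //; try lia.
have tp' : (0 < nth 0%N t i)%N := allP tp _ (mem_nth 0%N ti).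
rewrite eqxx (allP tA _ (mem_nth 0%N ti)) tp' /=.
move: td; rewrite (dot_del (i := i')) // (dot_del (i := i) (c := del i' c)) //; last first.
  by rewrite !size_del // ts.
by rewrite !nth_del ?ts // -tv => <-; lia.
Qed.

Lemma count_nonuniq_le R' :
  (forall i i', (i < i')%N -> (i' < size c)%N -> (rep A (merge_at i i' c) m <= R')%N) ->
  (count (fun t => ~~ uniq t) (reps A c m) <= size c * size c * R')%N.
Proof.
move=> H; pose I := iota 0 (size c).
apply: leq_trans (_ : (\sum_(i <- I) \sum_(i' <- I | (i < i')%N)
    count (fun t => nth 0%N t i == nth 0%N t i') (reps A c m) <= _)%N); last first.
  apply: leq_trans (_ : (\sum_(i <- I) \sum_(i' <- I) R' <= _)%N).
    apply: leq_sum => i _; rewrite big_mkcond big_seq [X in (_ <= X)%N]big_seq.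
    apply: leq_sum => i'; rewrite mem_iota => /andP [_ i's]; case: ltnP => // ii'.
    exact: leq_trans (count_eq_le ii' i's) (H _ _ ii' i's).
  by rewrite !big_const_seq !count_predT !size_iota !iter_addn_0 mulnC (mulnC R') mulnA leqnn.
under [X in (_ <= X)%N]eq_bigr => i _.
  under eq_bigr => i' _ do rewrite count_sum.
  rewrite exchange_big /=; over.
rewrite exchange_big /= count_sum big_seq [X in (_ <= X)%N]big_seq; apply: leq_sum => t.
rewrite mem_reps // => /and4P [_ /eqP ts _ _].
case: (boolP (uniq t)) => //= /(uniqPn 0%N) [i [i' [ii' it tt]]].
have iI : i \in I by rewrite mem_iota /=; lia.
have iI' : i' \in I by rewrite mem_iota /=; lia.
by rewrite (big_rem i iI) /= (big_rem i' iI') /= ii' tt eqxx.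
Qed.

(** A vertex of an edge occupies one of [size c] positions, so its degree is at most [size c * R'],
    and the greedy bound applies. The predicate [P] allows a degree bound that holds only for part
    of the solutions. *)
Lemma count_uniq_le (P : pred (seq nat)) t Z R' :
  (0 < t)%N -> 0 <= Z ->
  (forall i v, (i < size c)%N ->
     (count (fun t => (nth 0%N t i == v) && P t) (reps A c m) <= R')%N) ->
  INR (packings (sol c m) t [::] A) < Z ^ t ->
  INR (count (fun t => uniq t && P t) (reps A c m)) <=
    Z + INR (size c * t * (size c * R'))%N.
Proof.
move=> t0 Z0 HP HZ; pose T := [seq e <- sol c m | P e].
have -> : count (fun t => uniq t && P t) (reps A c m) = size (edges_in T A).
  rewrite /edges_in /T -filter_predI size_filter /reps count_filter; apply: eq_count => e /=.
  by rewrite andbC andbA [X in X && _]andbC; case: (P e); rewrite ?andbT ?andbF.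
have HT e : e \in T -> size e = size c by rewrite mem_filter mem_sol // => /andP [_ /and3P [/eqP -> _ _]].
apply: (edges_in_le t0 Z0); first by move=> e /HT ->.
  move=> v; apply: leq_trans (_ : (\sum_(i <- iota 0 (size c))
      count (fun t => (nth 0%N t i == v) && P t) (reps A c m) <= _)%N); last first.
    apply: leq_trans (_ : (\sum_(i <- iota 0 (size c)) R' <= _)%N); last first.
      by rewrite big_const_seq count_predT size_iota iter_addn_0 mulnC.
    rewrite big_seq [X in (_ <= X)%N]big_seq; apply: leq_sum => i.
    by rewrite mem_iota => /andP [_ ic]; exact: HP.
  rewrite /edges_in /T -filter_predI count_filter count_sum.
  under [X in (_ <= X)%N]eq_bigr => i _ do rewrite /reps count_filter count_sum.
  rewrite exchange_big /= big_seq [X in (_ <= X)%N]big_seq; apply: leq_sum => e eS.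
  case: (boolP [&& _, _ && _ & _]) => // /and3P [ve /andP [Ae ue] Pe].
  have es : size e = size c by move: eS; rewrite mem_sol // => /and3P [/eqP].
  have iv : index v e \in iota 0 (size c) by rewrite mem_iota /= add0n -es index_mem.
  by rewrite (big_rem _ iv) /= nth_index // eqxx Pe Ae.
apply: Rle_lt_trans HZ; apply: leR_nat; exact: packings_filter.
Qed.

(** The induction step on the number of variables: fixing a variable at [v] leaves the form with it
    deleted, and a repeated entry leaves a form with two variables merged, so both the degrees and
    the non-injective solutions are controlled by forms with one variable fewer. The latter account
    for the extra 1 in [t.+1]. *)
Lemma rep_le_step t Z R' :
  (0 < t)%N -> 0 <= Z ->
  (forall i v, (i < size c)%N -> A v -> (0 < v)%N -> (nth 0%N c i * v <= m)%N ->
     (rep A (del i c) (m - nth 0%N c i * v) <= R')%N) ->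
  (forall i i', (i < i')%N -> (i' < size c)%N -> (rep A (merge_at i i' c) m <= R')%N) ->
  INR (packings (sol c m) t [::] A) < Z ^ t ->
  INR (rep A c m) <= Z + INR (size c * size c * t.+1 * R')%N.
Proof.
move=> t0 Z0 Hd Hm HZ.
have H1 := count_nonuniq_le Hm.
have := @count_uniq_le predT t Z R' t0 Z0 _ HZ.
have E : rep A c m = (count (fun t => uniq t && predT t) (reps A c m) +
    count (fun t => ~~ uniq t) (reps A c m))%N.
  rewrite /rep -(count_predC uniq); congr addn; by apply: eq_count => e /=; rewrite andbT.
have Hdeg i v : (i < size c)%N ->
    (count (fun t => (nth 0%N t i == v) && predT t) (reps A c m) <= R')%N.
  move=> ic; rewrite (eq_count (a2 := fun t => nth 0%N t i == v)); last by move=> e; rewrite /= andbT.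
  case: (leqP (nth 0%N c i * v)%N m) => cv; last by rewrite count_nth_gt.
  case: (posnP (count (fun t => nth 0%N t i == v) (reps A c m))) => [-> //|].
  rewrite -has_count => /hasP [t1]; rewrite mem_reps // => /and4P [tA /eqP ts tp _] /eqP tv.
  have it : (i < size t1)%N by rewrite ts.
  apply: leq_trans (count_nth_le _ ic) _; apply: Hd => //.
    by rewrite -tv; exact: (allP tA _ (mem_nth 0%N it)).
  by rewrite -tv; exact: (allP tp _ (mem_nth 0%N it)).
move/(_ Hdeg) => H2; rewrite E -plusE plus_INR.
have := leR_nat H1 => H3.
have : INR (size c * size c * t.+1 * R') =
   INR (size c * t * (size c * R')) + INR (size c * size c * R').
  by rewrite -plus_INR; congr INR; rewrite plusE; nia.
move=> ->; apply: Rle_trans (Rplus_le_compat _ _ _ _ H2 H3) _.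
by rewrite Rplus_assoc; apply: Rle_refl.
Qed.

End Counting.

(** * Expected number of representations *)

Lemma pow_diff_le n a b : 0 <= a <= b -> b ^ n.+1 - a ^ n.+1 <= INR n.+1 * b ^ n * (b - a).
Proof.
move=> [a0 ab]; elim: n => [|n IH]; first by rewrite /=; lra.
have -> : b ^ n.+2 - a ^ n.+2 = b * (b ^ n.+1 - a ^ n.+1) + a ^ n.+1 * (b - a) by rewrite /=; ring.
have H1 : a ^ n.+1 <= b ^ n.+1 by apply: pow_incr.
have -> : INR n.+2 * b ^ n.+1 * (b - a) = b * (INR n.+1 * b ^ n * (b - a)) + b ^ n.+1 * (b - a).
  by rewrite (S_INR n.+1) /= -/(INR n.+1); ring.
apply: Rplus_le_compat; first by apply: Rmult_le_compat_l; lra.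
by apply: Rmult_le_compat_r; lra.
Qed.

Lemma pow_le_inv n a b : (0 < n)%N -> 0 <= b -> a ^ n <= b ^ n -> a <= b.
Proof.
move=> n0 b0 H; apply: Rnot_lt_le => ba.
suff : b ^ n < a ^ n by lra.
case: n n0 {H} => // n _; elim: n => [|n IH]; first by rewrite /=; lra.
have := pow_le _ n.+1 b0; rewrite -[b ^ n.+2]/(b * b ^ n.+1) -[a ^ n.+2]/(a * a ^ n.+1); nra.
Qed.

Lemma Rdiv_ge0 a b : 0 <= a -> 0 < b -> 0 <= a / b.
Proof. by move=> a0 b0; apply: Rmult_le_pos => //; left; apply: Rinv_0_lt_compat. Qed.

Section PWeight.
Variable p : nat -> R.
Hypothesis p0 : forall k, 0 <= p k.

(** For inclusion probabilities this is the base of the power in [Ex_packings]; for the indicator of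
    a set it is [rep]. The two mass inequalities below thus serve the probabilistic part and the
    counting function alike. *)
Definition pweight c m := \rsum_(t <- sol c m) \rprod_(k <- t) p k.

Lemma pweight_ge0 c m : 0 <= pweight c m.
Proof. by apply: rsum_ge0 => t _ _; apply: rprod_ge0. Qed.

Lemma pweight_nil m : pweight [::] m = INR (m == 0%N).
Proof. by rewrite /pweight /=; case: eqP => _; rewrite ?big_seq1 !big_nil. Qed.

Lemma pweight_cons c0 c m : pweight (c0 :: c) m =
  \rsum_(k <- iota 1 m | (c0 * k <= m)%N) (p k * pweight c (m - c0 * k)).
Proof.
rewrite /pweight /= big_flatten big_map big_filter; apply: eq_bigr => k _.
by rewrite big_map big_distrr; apply: eq_bigr => t _; rewrite big_cons.
Qed.

Lemma rsum_progression (g : nat -> R) c0 m (P : pred nat) : (0 < c0)%N -> (forall k, 0 <= g k) ->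
  \rsum_(k <- iota 1 m | (c0 * k <= m)%N && P k) g (m - c0 * k)%N <= \rsum_(k <- iota 0 m.+1) g k.
Proof.
move=> c00 g0; rewrite -big_filter -(big_map (fun k => m - c0 * k)%N predT g).
apply: rsum_sub_uniq => //.
  rewrite map_inj_in_uniq ?filter_uniq ?iota_uniq // => x y.
  rewrite !mem_filter => /andP [/andP [a _] _] /andP [/andP [b _] _] E.
  have : (c0 * x == c0 * y)%N by lia.
  by rewrite eqn_mul2l; case: (c0) c00 => //= _ _ /eqP.
by move=> x /mapP [k _ ->]; rewrite mem_iota; lia.
Qed.

(** All entries of a solution with value at most [m] are themselves at most [m], so each such
    solution is a term of the expanded power. *)
Lemma pweight_mass c m : all (ltn 0%N) c ->
  \rsum_(i <- iota 0 m.+1) pweight c i <= (\rsum_(k <- iota 1 m) p k) ^ size c.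
Proof.
pose J := iota 0 m.+1; rewrite -/J.
elim: c => [_|c0 c IH /= /andP [c00 cp]].
  rewrite /J /= big_cons big1_seq; first by rewrite pweight_nil /=; lra.
  by move=> i /andP [_]; rewrite mem_iota => H; rewrite pweight_nil; case: i H.
set P := \rsum_(k <- iota 1 m) p k in IH *.
apply: Rle_trans (_ : \rsum_(i <- J) \rsum_(k <- iota 1 m)
    p k * (if (c0 * k <= i)%N then pweight c (i - c0 * k)%N else 0) <= _).
  apply: rsum_le => i; rewrite /J mem_iota => /andP [_ im] _.
  rewrite pweight_cons big_mkcond /=.
  have -> : \rsum_(k <- iota 1 i) (if (c0 * k <= i)%N then p k * pweight c (i - c0 * k) else 0) =
    \rsum_(k <- iota 1 i) (p k * (if (c0 * k <= i)%N then pweight c (i - c0 * k) else 0)).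
    by apply: eq_bigr => k _; case: ifP => // _; lra.
  apply: rsum_sub_uniq; first exact: iota_uniq.
    by move=> k; rewrite !mem_iota; lia.
  by move=> k _; apply: Rmult_le_pos => //; case: ifP => _; [exact: pweight_ge0 | lra].
rewrite exchange_big /=.
apply: Rle_trans (_ : \rsum_(k <- iota 1 m) (p k * P ^ size c) <= _); last first.
  by rewrite -big_distrl /= -/P; lra.
apply: rsum_le => k _ _; rewrite -big_distrr /=; apply: Rmult_le_compat_l => //.
apply: Rle_trans (IH cp).
rewrite -big_mkcond -big_filter -(big_map (fun i => i - c0 * k)%N predT (pweight c)).
apply: rsum_sub_uniq; last by move=> *; exact: pweight_ge0.
  rewrite map_inj_in_uniq ?filter_uniq ?iota_uniq // => x y.
  rewrite !mem_filter => /andP [a _] /andP [b _]; lia.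
by move=> x /mapP [i]; rewrite mem_filter /J !mem_iota => /andP [a b] ->; lia.
Qed.

(** Conversely, entries up to [m] produce values up to [sumn c * m]. *)
Lemma pweight_mass_ge c m : all (ltn 0%N) c ->
  (\rsum_(k <- iota 1 m) p k) ^ size c <= \rsum_(i <- iota 0 (sumn c * m).+1) pweight c i.
Proof.
elim: c => [_|c0 c IH ccp].
  rewrite mul0n /= big_seq1 pweight_nil /=; lra.
have /andP [c00 cp] : (0 < c0)%N && all (ltn 0%N) c by exact: ccp.
pose J := iota 0 (sumn (c0 :: c) * m).+1; rewrite -/J.
set P := \rsum_(k <- iota 1 m) p k in IH *.
rewrite -[P ^ size _]/(P * P ^ size c).
apply: Rle_trans (_ : \rsum_(i <- J) \rsum_(k <- iota 1 m)
    p k * (if (c0 * k <= i)%N then pweight c (i - c0 * k)%N else 0) <= _); last first.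
  apply: rsum_le => i _ _; rewrite pweight_cons.
  apply: Rle_trans (_ : \rsum_(k <- iota 1 m | (c0 * k <= i)%N) p k * pweight c (i - c0 * k)%N <= _).
    rewrite [X in _ <= X]big_mkcond; apply: rsum_le => k _ _; case: ifP => _; first lra.
    by rewrite Rmult_0_r; lra.
  rewrite -big_filter -[X in _ <= X]big_filter; apply: rsum_sub_uniq.
  - by rewrite filter_uniq ?iota_uniq.
  - by move=> k; rewrite !mem_filter !mem_iota; nia.
  by move=> k _; apply: Rmult_le_pos => //; exact: pweight_ge0.
rewrite exchange_big /=.
apply: Rle_trans (_ : \rsum_(k <- iota 1 m) (p k * P ^ size c) <= _).
  by rewrite -big_distrl /= -/P; lra.
apply: rsum_le => k; rewrite mem_iota => km _; rewrite -big_distrr /=; apply: Rmult_le_compat_l => //.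
apply: Rle_trans (IH cp) _.
rewrite -big_mkcond -[X in _ <= X]big_filter -(big_map (fun i => i - c0 * k)%N predT (pweight c)).
apply: rsum_sub_uniq; first exact: iota_uniq.
  move=> i; rewrite mem_iota => /andP [_ im].
  apply/mapP; exists (i + c0 * k)%N; last by lia.
  by rewrite mem_filter /J mem_iota /=; nia.
by move=> *; exact: pweight_ge0.
Qed.

End PWeight.

Section Weights.
Variables (h : nat) (G f : nat -> R).
Hypothesis h2 : (2 <= h)%N.
Hypothesis Gpos : forall n, (0 < n)%N -> 0 < G n.
Hypothesis Gmono : forall m n, (0 < m)%N -> (m <= n)%N -> G m <= G n.
Hypothesis f0 : forall n, 0 <= f n.
Hypothesis fh : forall n, f n ^ h = INR n * G n.

Lemma f_pos n : (0 < n)%N -> 0 < f n.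
Proof.
move=> n0; case: (Rle_lt_or_eq_dec _ _ (f0 n)) => // E.
have := fh n; rewrite -E pow_i; last by lia.
have := Gpos n0; have : 0 < INR n by apply: lt_0_INR; lia.
by move=> a b c; have := Rmult_lt_0_compat _ _ a b; lra.
Qed.

Lemma f_zero : f 0 = 0.
Proof.
case: (Rle_lt_or_eq_dec _ _ (f0 0)) => // E; have := pow_lt _ h E; rewrite fh /=; lra.
Qed.

Lemma f_mono m n : (m <= n)%N -> f m <= f n.
Proof.
move=> mn; case: (posnP m) => [->|m0]; first by rewrite f_zero.
apply: (@pow_le_inv h) => //; first by lia.
rewrite !fh; apply: Rmult_le_compat; [exact: pos_INR | left; exact: Gpos | exact: leR_nat | exact: Gmono].
Qed.

(** A discrete derivative bound: monotonicity of [G] gives f(m+1)^h - f(m)^h >= G(m+1), and the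
    difference of powers is at most h f(m+1)^(h-1) times the increment. The sum of f(k)/k therefore
    telescopes, without comparison to an integral. *)
Lemma f_increment m : f m.+1 / INR m.+1 <= INR h * (f m.+1 - f m).
Proof.
have fp := @f_pos m.+1 isT.
have mp : 0 < INR m.+1 by apply: lt_0_INR; lia.
have E : h = h.-1.+1 by lia.
have hp : 0 < f m.+1 ^ h.-1 by exact: pow_lt.
apply: (Rmult_le_reg_l (f m.+1 ^ h.-1)) => //.
have D := @pow_diff_le h.-1 (f m) (f m.+1) (conj (f0 _) (f_mono (leqnSn m))).
rewrite -E !fh in D.
have L : G m.+1 <= INR m.+1 * G m.+1 - INR m * G m.
  rewrite S_INR; case: (posnP m) => [->|m0]; first by rewrite /=; lra.
  have := @Gmono m m.+1 m0 (leqnSn m); have := pos_INR m; nra.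
have -> : f m.+1 ^ h.-1 * (f m.+1 / INR m.+1) = G m.+1.
  have -> : f m.+1 ^ h.-1 * (f m.+1 / INR m.+1) = f m.+1 ^ h.-1.+1 / INR m.+1.
    by rewrite -[f m.+1 ^ h.-1.+1]/(f m.+1 * f m.+1 ^ h.-1); field; lra.
  by rewrite -E fh; field; lra.
by apply: Rle_trans L (Rle_trans _ _ _ D _); right; ring.
Qed.

Definition prob k := Rmin 1 (f k / INR k).

Lemma prob_le k : prob k <= f k / INR k.
Proof. exact: Rmin_r. Qed.

Lemma prob01 k : 0 <= prob k <= 1.
Proof.
split; last exact: Rmin_l.
apply: Rmin_glb; first lra.
case: k => [|k]; first by rewrite f_zero; lra.
by apply: Rdiv_ge0; [exact: f0 | apply: lt_0_INR; lia].
Qed.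

Lemma prob_sum_le m : \rsum_(k <- iota 1 m) prob k <= INR h * f m.
Proof.
elim: m => [|m IH]; first by rewrite big_nil f_zero; lra.
rewrite rsum_iotaS add1n; have := prob_le m.+1; have := f_increment m; lra.
Qed.

Definition weight c m := pweight prob c m.

Lemma weight_ge0 c m : 0 <= weight c m.
Proof. by apply: pweight_ge0 => k; have := prob01 k; lra. Qed.

Fixpoint weight_const (B : nat) (j : nat) : R :=
  if j is i.+1 then 2 * INR h * weight_const B i + 2 * INR B * INR h ^ i else 0.

Lemma weight_const_ge0 B j : 0 <= weight_const B j.
Proof.
elim: j => [|j IH] /=; first lra.
have := pos_INR h; have := pos_INR B; have := pow_le _ j (pos_INR h); nra.
Qed.

(** Induction on the variables, splitting on the contribution [c0 * k] of the first one. If it is at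
    most half of [m], the rest is at least m/2 and the induction hypothesis loses a factor 2.
    Otherwise [k] has order [m], its probability is at most 2B f(m)/m, and the other variables are
    bounded by their total mass. These two cases are the two terms of [weight_const]. *)
Lemma weight_le B c m : all (ltn 0%N) c -> (sumn c <= B)%N -> (0 < m)%N ->
  weight c m <= weight_const B (size c) * (f m ^ size c / INR m).
Proof.
have p0 k : 0 <= prob k by have := prob01 k; lra.
elim: c m => [m _ _ m0 |c0 c IH m /= /andP [c00 cp] sB m0].
  by rewrite /weight pweight_nil; case: m m0 => //= m _; lra.
have mp : 0 < INR m by apply: lt_0_INR; lia.
have fp := f_pos m0.
set j := size c.
have fj : 0 < f m ^ j by exact: pow_lt.
rewrite /weight pweight_cons (bigID (fun k => (2 * (c0 * k) <= m)%N)) /=.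
have -> : (2 * INR h * weight_const B j + 2 * INR B * INR h ^ j) * (f m * f m ^ j / INR m) =
   weight_const B j * (f m ^ j * 2 / INR m) * (INR h * f m) +
   (f m * (2 * INR B) / INR m) * (INR h * f m) ^ j.
  by rewrite Rpow_mult_distr; field; lra.
have C0 := weight_const_ge0 B j.
apply: Rplus_le_compat.
  apply: Rle_trans (_ : \rsum_(k <- iota 1 m | (c0 * k <= m)%N && (2 * (c0 * k) <= m)%N)
      (weight_const B j * (f m ^ j * 2 / INR m) * prob k) <= _).
    apply: rsum_le => k kI /andP [lower_const ck2].
    rewrite Rmult_comm; apply: Rmult_le_compat_r => //.
    have m'0 : (0 < m - c0 * k)%N by lia.
    apply: Rle_trans (IH _ cp _ m'0) _; first by lia.
    apply: Rmult_le_compat_l => //; rewrite -/j.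
    have : f (m - c0 * k) ^ j <= f m ^ j.
      by apply: pow_incr; split; [exact: f0 | apply: f_mono; lia].
    have H2 : INR m <= 2 * INR (m - c0 * k).
      by rewrite -[2]/(INR 2) -mult_INR multE; apply: leR_nat; lia.
    move=> H1; apply: Rle_trans (_ : f m ^ j / INR (m - c0 * k) <= _).
      by apply: Rmult_le_compat_r => //; left; apply: Rinv_0_lt_compat; lra.
    rewrite /Rdiv Rmult_assoc; apply: Rmult_le_compat_l; first lra.
    apply: (Rmult_le_reg_r (INR (m - c0 * k))); first lra.
    rewrite Rinv_l; last lra.
    apply: (Rmult_le_reg_r (INR m)) => //.
    have -> : 2 * / INR m * INR (m - c0 * k) * INR m = 2 * INR (m - c0 * k) by field; lra.
    lra.
  rewrite -big_distrr /=; apply: Rmult_le_compat_l.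
    by apply: Rmult_le_pos => //; apply: Rdiv_ge0; nra.
  by apply: Rle_trans (rsum_filter_le _ _) (prob_sum_le m).
apply: Rle_trans (_ : \rsum_(k <- iota 1 m | (c0 * k <= m)%N && ~~ (2 * (c0 * k) <= m)%N)
   (f m * (2 * INR B) / INR m * weight c (m - c0 * k)%N) <= _).
  apply: rsum_le => k; rewrite mem_iota => /andP [k1 _] /andP [lower_const ck2].
  apply: Rmult_le_compat_r; first exact: weight_ge0.
  apply: Rle_trans (prob_le k) _.
  have kp : 0 < INR k by apply: lt_0_INR; lia.
  have fk : f k <= f m by apply: f_mono; nia.
  have H2 : INR m <= 2 * INR B * INR k.
    rewrite -[2]/(INR 2) -!mult_INR !multE; apply: leR_nat; nia.
  apply: (Rmult_le_reg_r (INR k * INR m)); first by apply: Rmult_lt_0_compat.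
  have -> : f k / INR k * (INR k * INR m) = f k * INR m by field; lra.
  have -> : f m * (2 * INR B) / INR m * (INR k * INR m) = f m * (2 * INR B * INR k) by field; lra.
  apply: Rmult_le_compat => //; lra.
rewrite -big_distrr /=; apply: Rmult_le_compat_l.
  by apply: Rdiv_ge0 => //; have := pos_INR B; nra.
apply: Rle_trans (rsum_progression _ _ c00 (weight_ge0 c)) _.
apply: Rle_trans (pweight_mass p0 m cp) _; apply: pow_incr; split; last exact: prob_sum_le.
by apply: rsum_ge0.
Qed.

End Weights.

(** * Logarithms and finite families of forms *)

(** The successor keeps [lg] positive everywhere and gives n < 2^(lg n) <= 2n for positive n. *)
Definition lg (n : nat) : nat := (trunc_log 2 n).+1.

Lemma lg_gt0 n : (0 < lg n)%N. Proof. by []. Qed.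

Lemma ltn_exp_lg n : (n < 2 ^ lg n)%N.
Proof. exact: trunc_log_ltn. Qed.

Lemma exp_lg_le n : (0 < n)%N -> (2 ^ lg n <= 2 * n)%N.
Proof. by move=> n0; rewrite expnS leq_mul2l /=; apply: trunc_logP. Qed.

Lemma exp_dominates K l : (0 < K)%N -> (l ^ K <= K ^ K * 2 ^ l)%N.
Proof.
move=> K0; have H : (l <= K * 2 ^ (l %/ K))%N.
  apply: leq_trans (_ : (K * (l %/ K).+1 <= _)%N).
    by rewrite mulnC; exact: ltnW (ltn_ceil _ K0).
  by rewrite leq_mul2l ltn_expl // orbT.
apply: leq_trans (_ : ((K * 2 ^ (l %/ K)) ^ K <= _)%N).
  by rewrite leq_exp2r.
by rewrite expnMn leq_mul2l -expnM leq_exp2l // leq_trunc_div orbT.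
Qed.

Lemma lg_pow_le K : exists C, forall n, (0 < n)%N -> (lg n ^ K <= C * n)%N.
Proof.
exists (K.+1 ^ K.+1 * 2)%N => n n0.
apply: leq_trans (_ : (lg n ^ K.+1 <= _)%N); first by rewrite expnS leq_pmull.
apply: leq_trans (exp_dominates _ (ltn0Sn K)) _.
by rewrite -mulnA leq_mul2l exp_lg_le ?orbT.
Qed.

Lemma lg_unbounded (M : R) : exists N, forall n, (N <= n)%N -> M <= INR (lg n).
Proof.
have [k Hk] := INR_unbounded M.
exists (2 ^ k)%N => n Hn; apply: Rle_trans (_ : INR k <= _); first lra.
apply: leR_nat; apply: leqW; apply: leq_trans (leq_trunc_log 2 Hn); rewrite trunc_expnK //.
Qed.

Lemma lg_pow_small K (M : R) : exists N, forall n, (N <= n)%N -> M * INR (lg n) ^ K <= INR n.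
Proof.
have [C HC] := lg_pow_le K.+1.
have [N HN] := lg_unbounded (Rmax M 0 * INR C).
exists N.+1 => n Hn; have n0 : (0 < n)%N by lia.
have H1 : INR (lg n) ^ K.+1 <= INR C * INR n.
  by rewrite -INR_expn -mult_INR multE; apply: leR_nat; exact: HC.
have H2 := HN n (ltnW Hn).
have l0 : 0 < INR (lg n) by apply: lt_0_INR; rewrite /lg; lia.
have lK : 0 < INR (lg n) ^ K by apply: pow_lt.
have H3 : M * INR (lg n) ^ K <= Rmax M 0 * INR (lg n) ^ K.
  by apply: Rmult_le_compat_r; [lra | exact: Rmax_l].
apply: Rle_trans H3 _.
case: (posnP C) => [C0|C0].
  by move: H1; rewrite C0 [INR 0]/= Rmult_0_l; have := pow_lt _ K.+1 l0; lra.
have Cp : 0 < INR C by apply: lt_0_INR; lia.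
apply: (Rmult_le_reg_l (INR C)) => //.
apply: Rle_trans H1; rewrite -[INR (lg n) ^ K.+1]/(INR (lg n) * INR (lg n) ^ K); nra.
Qed.

Lemma lt_exp_lgR n : INR n < 2 ^ lg n.
Proof. by have := ltn_exp_lg n => /ltP /lt_INR; rewrite INR_expn. Qed.

Fixpoint words (B j : nat) : seq (seq nat) :=
  if j is i.+1 then [seq x :: s | x <- iota 1 B, s <- words B i] else [:: [::]].

(* The linear forms obtained from [b] by deleting and identifying variables
   are among these finitely many. *)
Definition forms (B h : nat) := flatten [seq words B j | j <- iota 0 h.+1].

Lemma mem_forms B h c : all (ltn 0%N) c -> (sumn c <= B)%N -> (size c <= h)%N -> c \in forms B h.
Proof.
move=> cp cB ch; apply/flatten_mapP; exists (size c); first by rewrite mem_iota; lia.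
elim: c cp cB {ch} => //= c0 c IH /andP [c00 cp] cB.
by apply/allpairsP; exists (c0, c); split=> //=; [rewrite mem_iota; lia | apply: IH => //; lia].
Qed.

Lemma mem_sol_le c m t k : all (ltn 0%N) c -> t \in sol c m -> k \in t -> (k <= m)%N.
Proof.
move=> cp; rewrite mem_sol // => /and3P [/eqP sz _ /eqP <-].
elim: c t cp sz => [|c0 c IH] [|a t] //= /andP [c00 cp] [sz].
rewrite inE => /orP [/eqP ->|kt]; first by nia.
by have := IH _ cp sz kt; lia.
Qed.

Lemma rsum_indicator n (s : seq nat) (g : nat -> R) :
  uniq s -> (forall k, k \in s -> (k <= n)%N) ->
  \rsum_(k <- iota 0 n.+1) (g k * INR (k \in s)) = \rsum_(k <- s) g k.
Proof.
move=> us H.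
have -> : \rsum_(k <- iota 0 n.+1) (g k * INR (k \in s)) = \rsum_(k <- iota 0 n.+1 | k \in s) g k.
  by rewrite [RHS]big_mkcond; apply: eq_bigr => k _; case: (k \in s) => /=; lra.
rewrite -big_filter; apply: perm_big; apply: uniq_perm => //; first by rewrite filter_uniq ?iota_uniq.
move=> k; rewrite mem_filter mem_iota; case ks: (k \in s) => //=.
by rewrite add0n ltnS H.
Qed.

Lemma INR_count (A : nat -> bool) (s : seq nat) :
  INR (count A s) = \rsum_(k <- s) INR (A k).
Proof. by rewrite count_sum INR_sum. Qed.

(** * A set avoiding all exceptional events *)

Definition Rif (P : Prop) (x : R) : R := if excluded_middle_informative P then x else 0.

Lemma Rif_true (P : Prop) x : P -> Rif P x = x.
Proof. by rewrite /Rif; case: excluded_middle_informative. Qed.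

Lemma Rif_false (P : Prop) x : ~ P -> Rif P x = 0.
Proof. by rewrite /Rif; case: excluded_middle_informative. Qed.

Lemma Rif_ge0 P x : 0 <= x -> 0 <= Rif P x.
Proof. by rewrite /Rif; case: excluded_middle_informative => //= _ _; lra. Qed.

(* Windows are the integers [b0 * q + s] with [s < b0] and [n %/ Q < q <= 2 * (n %/ Q)]. *)
Definition window_quot (Q n : nat) := (n %/ Q)%N.
Definition window_end (Q b0 n : nat) := (b0 * (2 * window_quot Q n).+1)%N.
Definition residue_block (Q b0 n s : nat) := [seq (b0 * q + s)%N | q <- iota (window_quot Q n).+1 (window_quot Q n)].
Definition window Q b0 n (A : nat -> bool) : nat -> bool :=
  fun k => [&& (b0 * (window_quot Q n).+1 <= k)%N, (k < window_end Q b0 n)%N & A k].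
(** Coefficient of the indicator of [k] in the linear function to which Chernoff's bound is
    applied. *)
Definition window_rep Q b0 (bs : seq nat) n A k : nat :=
  if (b0 * k <= n)%N then rep (window Q b0 n A) bs (n - b0 * k) else 0%N.
(** Values of a variable with coefficient [b] that leave less than [L n] for all the others. *)
Definition near (L : nat -> nat) n b :=
  [seq v <- iota 1 n | (b * v <= n)%N && (n < b * v + L n)%N].

Lemma residue_block_uniq Q b0 n s : (0 < b0)%N -> uniq (residue_block Q b0 n s).
Proof.
move=> b00; rewrite map_inj_uniq ?iota_uniq // => x y /addIn /eqP.
by rewrite eqn_mul2l; case: (b0) b00 => //= _ _ /eqP.
Qed.

Lemma mem_residue_block Q b0 n s k : (s < b0)%N -> k \in residue_block Q b0 n s ->
  (b0 * (window_quot Q n).+1 <= k < window_end Q b0 n)%N.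
Proof.
move=> sb /mapP [q]; rewrite mem_iota /window_end => /andP [q1 q2] ->.
have := leq_mul (leqnn b0) q1; have : (b0 * q <= b0 * (2 * window_quot Q n))%N by rewrite leq_mul2l; lia.
lia.
Qed.

Section Existence.
Variables (h B b0 Q t0 : nat) (bs : seq nat) (G f : nat -> R).
Hypothesis h2 : (2 <= h)%N.
Hypothesis Gpos : forall n, (0 < n)%N -> 0 < G n.
Hypothesis Gmono : forall m n, (0 < m)%N -> (m <= n)%N -> G m <= G n.
Hypothesis f0 : forall n, 0 <= f n.
Hypothesis fh : forall n, f n ^ h = INR n * G n.
Variables (L : nat -> nat) (Dl V pm : nat -> R).

Local Notation p := (prob f).
Let p01 := prob01 h2 f0 fh.

(** The summand 1 makes this bound on the mean positive also for the empty form, where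
    [weight_const] vanishes, so that one can divide by it. *)
Definition scale (c : seq nat) m := (weight_const h B (size c) + 1) * (f m ^ size c / INR m).

Lemma scale_gt0 c m : (0 < m)%N -> 0 < scale c m.
Proof.
move=> m0; have := weight_const_ge0 h B (size c) => H.
apply: Rmult_lt_0_compat; first lra.
apply: Rdiv_lt_0_compat; first by apply: pow_lt; exact: (f_pos h2 Gpos f0 fh).
by apply: lt_0_INR; lia.
Qed.

Lemma weight_scale c m : all (ltn 0%N) c -> (sumn c <= B)%N -> (0 < m)%N ->
  weight f c m <= scale c m.
Proof.
move=> cp cB m0; apply: Rle_trans (weight_le h2 Gpos Gmono f0 fh cp cB m0) _.
apply: Rmult_le_compat_r; last lra.
by apply: Rdiv_ge0; [exact: pow_le | apply: lt_0_INR; lia].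
Qed.

Definition admissible c := all (ltn 0%N) c && (sumn c <= B)%N.

(* Each penalty has small expectation, and a set on which it is below 1 avoids the
   corresponding exceptional events; the guards [Rif] drop the events whose
   probability is not small enough. *)
Definition pen_log n A := \rsum_(c <- forms B h | admissible c) \rsum_(m <- iota 1 n)
  (INR (packings (sol c m) (3 * lg n) [::] A) / (2 * scale c m) ^ (3 * lg n)).

Definition pen_const n A := \rsum_(c <- forms B h | admissible c)
  Rif (scale c n ^ t0 <= / INR n ^ 2) (INR (packings (sol c n) t0 [::] A)).

Definition pen_near n A := \rsum_(b <- iota 1 B)
  Rif ((\rsum_(v <- near L n b) p v) ^ t0 <= / INR n ^ 2)
      (INR (packings [seq [:: v] | v <- near L n b] t0 [::] A)).

(** A quarter of the mean: exp(-count) has expectation at most exp(-mean/2), hence exp(theta -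
    count) at most exp(-theta), while a value below 1 of the latter function forces the count above
    [theta]. *)
Definition theta n s := (\rsum_(k <- residue_block Q b0 n s) p k) / 4.

Definition pen_residue n A := \rsum_(s <- iota 0 b0)
  Rif ((window_end Q b0 n <= n)%N /\ exp (- theta n s) <= / INR n ^ 2)
      (exp (theta n s - INR (count A (residue_block Q b0 n s)))).

Definition range n := iota (window_end Q b0 n) (n.+1 - window_end Q b0 n).

Definition window_cond n := [/\ (window_end Q b0 n <= n)%N, 0 < Dl n, 0 <= pm n,
  (forall k, k \in range n -> pm n <= p k) & exp (- (pm n * V n / (4 * Dl n))) <= / INR n ^ 2].

Definition typical n A := (forall k, k \in range n -> INR (window_rep Q b0 bs n A k) <= Dl n) /\
  V n <= \rsum_(k <- range n) INR (window_rep Q b0 bs n A k).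

(** For a typical [A] the rescaled linear function has conditional mean at least
    [pm n * V n / Dl n], four times the exponent in front; half the mean against a quarter of it
    leaves a negative exponent, as for [theta]. The guard on [k] is needed because [typical] bounds
    coefficients on [range n] only, while [Ex_exp_linear] wants a bound at every [k]. *)
Definition pen_window n A := Rif (window_cond n) (Rif (typical n A) (exp (pm n * V n / (4 * Dl n))) *
   exp (- \rsum_(k <- range n) INR (A k) * (Rif (k \in range n) (INR (window_rep Q b0 bs n A k)) / Dl n))).

(** Origin of the packing length [3 * lg n]: one power of n pays for the union over all m <= n, two
    make the result summable. *)
Lemma inv_sq_pow2 n : (0 < n)%N -> INR n * / 2 ^ (3 * lg n) <= / INR n ^ 2.
Proof.
move=> n0; have np : 0 < INR n by apply: lt_0_INR; lia.
have H := lt_exp_lgR n.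
rewrite mulnC -multE pow_mult.
have H3 : INR n ^ 3 <= (2 ^ lg n) ^ 3 by apply: pow_incr; lra.
have : / (2 ^ lg n) ^ 3 <= / INR n ^ 3 by apply: Rinv_le_contravar => //; apply: pow_lt.
move=> H4; apply: Rle_trans (Rmult_le_compat_l _ _ _ (Rlt_le _ _ np) H4) _.
by right; field; lra.
Qed.

Lemma Ex_pen_log n : (0 < n)%N -> Ex p n.+1 (pen_log n) <= INR (size (forms B h)) * / INR n ^ 2.
Proof.
move=> n0; rewrite Ex_sum -rsum_const.
have inv0 : 0 <= / INR n ^ 2.
  by left; apply: Rinv_0_lt_compat; apply: pow_lt; apply: lt_0_INR; lia.
apply: Rle_trans (_ : \rsum_(c <- forms B h | admissible c) / INR n ^ 2 <= _); last first.
  exact: rsum_filter_le.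
apply: rsum_le => c _ /andP [cp cB]; rewrite Ex_sum.
apply: Rle_trans (inv_sq_pow2 n0).
have -> : INR n * / 2 ^ (3 * lg n) = \rsum_(m <- iota 1 n) / 2 ^ (3 * lg n).
  by rewrite rsum_const size_iota.
apply: rsum_le => m; rewrite mem_iota => /andP [m1 m2] _.
set t := (3 * lg n)%N; have S0 := scale_gt0 c m1.
have -> : Ex p n.+1 (fun A => INR (packings (sol c m) t [::] A) / (2 * scale c m) ^ t) =
    / (2 * scale c m) ^ t * Ex p n.+1 (fun A => INR (packings (sol c m) t [::] A)).
  by rewrite -Ex_scal; apply: Ex_ext => A; rewrite /Rdiv Rmult_comm.
have P2 : 0 < (2 * scale c m) ^ t by apply: pow_lt; lra.
apply: Rle_trans (_ : / (2 * scale c m) ^ t * scale c m ^ t <= _).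
  apply: Rmult_le_compat_l; first by left; apply: Rinv_0_lt_compat.
  apply: Rle_trans (Ex_packings p01 _ _ _) _; apply: pow_incr; split; first exact: (weight_ge0 h2 f0 fh).
  exact: weight_scale.
have S1 : 0 < scale c m ^ t by apply: pow_lt.
have S2 : 0 < 2 ^ t by apply: pow_lt; lra.
by rewrite Rpow_mult_distr; right; field; lra.
Qed.

Lemma Ex_Rif N (P : Prop) X : Ex p N (fun A => Rif P (X A)) = Rif P (Ex p N X).
Proof.
by rewrite /Rif; case: excluded_middle_informative => H; rewrite ?Ex_const.
Qed.

Lemma Rif_le (P : Prop) x y : 0 <= y -> (P -> x <= y) -> Rif P x <= y.
Proof. by rewrite /Rif; case: excluded_middle_informative => [H|H] y0 Hx; [exact: Hx|]. Qed.

Let inv0 n : (0 < n)%N -> 0 <= / INR n ^ 2.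
Proof. by move=> n0; left; apply: Rinv_0_lt_compat; apply: pow_lt; apply: lt_0_INR; lia. Qed.

Lemma Ex_pen_const n : (0 < n)%N -> Ex p n.+1 (pen_const n) <= INR (size (forms B h)) * / INR n ^ 2.
Proof.
move=> n0; rewrite Ex_sum -rsum_const.
apply: Rle_trans (_ : \rsum_(c <- forms B h | admissible c) / INR n ^ 2 <= _); last first.
  by apply: rsum_filter_le => *; exact: inv0.
apply: rsum_le => c _ /andP [cp cB]; rewrite Ex_Rif; apply: Rif_le; first exact: inv0.
apply: Rle_trans; apply: Rle_trans (Ex_packings p01 _ _ _) _; apply: pow_incr.
by split; [exact: (weight_ge0 h2 f0 fh) | exact: weight_scale].
Qed.

Lemma Ex_pen_near n : (0 < n)%N -> Ex p n.+1 (pen_near n) <= INR B * / INR n ^ 2.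
Proof.
move=> n0; rewrite Ex_sum.
have -> : INR B * / INR n ^ 2 = \rsum_(b <- iota 1 B) / INR n ^ 2 by rewrite rsum_const size_iota.
apply: rsum_le => b _ _; rewrite Ex_Rif; apply: Rif_le; first exact: inv0.
apply: Rle_trans; apply: Rle_trans (Ex_packings p01 _ _ _) _; right; congr pow.
by rewrite big_map; apply: eq_bigr => v _; rewrite big_seq1.
Qed.

Hypothesis b00 : (0 < b0)%N.

Lemma block_le n s k : (s < b0)%N -> (window_end Q b0 n <= n)%N -> k \in residue_block Q b0 n s -> (k <= n)%N.
Proof. by move=> sb xn /(mem_residue_block sb); lia. Qed.

Lemma Ex_pen_residue n : (0 < n)%N -> Ex p n.+1 (pen_residue n) <= INR b0 * / INR n ^ 2.
Proof.
move=> n0; rewrite Ex_sum.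
have -> : INR b0 * / INR n ^ 2 = \rsum_(b <- iota 0 b0) / INR n ^ 2 by rewrite rsum_const size_iota.
apply: rsum_le => s; rewrite mem_iota => /andP [_ sb] _; rewrite Ex_Rif; apply: Rif_le; first exact: inv0.
case=> xn; apply: Rle_trans; set th := theta n s; set bl := residue_block Q b0 n s.
have ubl : uniq bl by exact: residue_block_uniq.
have lebl k : k \in bl -> (k <= n)%N by exact: block_le.
have := @Ex_exp_linear p p01 0 n.+1 (fun=> exp th) (fun _ k => INR (k \in bl)).
rewrite add0n => H.
apply: Rle_trans (_ : Ex p n.+1 (fun A => exp th * exp (- \rsum_(k <- iota 0 n.+1) INR (A k) * INR (k \in bl))) <= _).
  by right; apply: Ex_ext => A; rewrite rsum_indicator // -INR_count -exp_plus.
apply: Rle_trans (H _ _ _ _) _ => //.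
- by move=> _; left; exact: exp_pos.
- by move=> _ k _; case: (k \in bl) => /=; lra.
have -> : (fun _ : nat -> bool => exp th * exp (- \rsum_(k <- iota 0 n.+1) (p k * INR (k \in bl) / 2))) =
    (fun _ => exp (- th)).
  apply: functional_extensionality => _; rewrite -exp_plus; congr exp.
  have -> : \rsum_(k <- iota 0 n.+1) (p k * INR (k \in bl) / 2) = (\rsum_(k <- iota 0 n.+1) (p k * INR (k \in bl))) * / 2.
    by rewrite big_distrl.
  by rewrite rsum_indicator // /th /theta -/bl; lra.
by rewrite Ex_const; lra.
Qed.

Lemma window_rep_local n k : local (window_end Q b0 n) (fun A => window_rep Q b0 bs n A k).
Proof.
move=> A A' AA; rewrite /window_rep; case: ifP => // _; congr rep.
apply: functional_extensionality => i; rewrite /window; congr andb.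
by case: (ltnP i (window_end Q b0 n)) => //= iw; rewrite AA.
Qed.

Lemma typical_local n : local (window_end Q b0 n) (typical n).
Proof.
move=> A A' AA.
have E : window_rep Q b0 bs n A = window_rep Q b0 bs n A'.
  by apply: functional_extensionality => k; exact: (window_rep_local k AA).
by rewrite /typical E.
Qed.

Lemma Ex_pen_window n : (0 < n)%N -> Ex p n.+1 (pen_window n) <= / INR n ^ 2.
Proof.
move=> n0; rewrite Ex_Rif; apply: Rif_le; first exact: inv0.
case=> xn D0 pm0 Hpm; apply: Rle_trans; set th := pm n * V n / (4 * Dl n).
have En : n.+1 = (window_end Q b0 n + (n.+1 - window_end Q b0 n))%N by lia.
have := @Ex_exp_linear p p01 (window_end Q b0 n) (n.+1 - window_end Q b0 n) (fun A => Rif (typical n A) (exp th))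
   (fun A k => Rif (k \in range n) (INR (window_rep Q b0 bs n A k)) / Dl n).
rewrite -En -/(range n) => H; apply: Rle_trans (H _ _ _ _) _.
- by move=> A; apply: Rif_ge0; left; exact: exp_pos.
- by move=> A A' AA; rewrite (typical_local AA).
- by move=> k A A' AA; rewrite (window_rep_local k AA).
- move=> A k; case: (classic (typical n A)) => [[T1 T2] _|T]; last by rewrite Rif_false.
  case: (classic (k \in range n)) => kr; last by rewrite Rif_false //; split; rewrite /Rdiv Rmult_0_l; lra.
  rewrite Rif_true //; split; first by apply: Rdiv_ge0 => //; exact: pos_INR.
  apply: (Rmult_le_reg_r (Dl n)) => //; rewrite /Rdiv Rmult_assoc Rinv_l; last lra.
  by have := T1 k kr; lra.
apply: Rle_trans (_ : Ex p n.+1 (fun _ => exp (- th)) <= _); last by rewrite Ex_const; lra.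
apply: Ex_le => // A; case: (classic (typical n A)) => [[T1 T2]|T]; last first.
  by rewrite Rif_false // Rmult_0_l; left; exact: exp_pos.
rewrite Rif_true // -exp_plus.
suff : 2 * th <= \rsum_(k <- range n) (p k * (Rif (k \in range n) (INR (window_rep Q b0 bs n A k)) / Dl n) / 2).
  move=> H2; case: (Rle_lt_or_eq_dec (th + - \rsum_(k <- range n) (p k * (Rif (k \in range n) (INR (window_rep Q b0 bs n A k)) / Dl n) / 2)) (- th)); first lra.
    by move=> H3; left; apply: exp_increasing.
  by move=> ->; lra.
apply: Rle_trans (_ : \rsum_(k <- range n) (pm n / Dl n / 2 * INR (window_rep Q b0 bs n A k)) <= _).
  rewrite -big_distrr /=.
  apply: Rle_trans (Rmult_le_compat_l _ _ _ _ T2).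
    by rewrite /th; right; field; lra.
  by apply: Rdiv_ge0; [apply: Rdiv_ge0 | lra].
apply: rsum_le => k kr _; rewrite Rif_true //.
have -> : p k * (INR (window_rep Q b0 bs n A k) / Dl n) / 2 = p k / Dl n / 2 * INR (window_rep Q b0 bs n A k) by field; lra.
apply: Rmult_le_compat_r; first exact: pos_INR.
apply: Rmult_le_compat_r; first lra.
apply: Rmult_le_compat_r; first by left; apply: Rinv_0_lt_compat.
exact: Hpm.
Qed.

Lemma pen_ge0 n A : [/\ 0 <= pen_log n A, 0 <= pen_const n A, 0 <= pen_near n A, 0 <= pen_residue n A & 0 <= pen_window n A].
Proof.
split.
- apply: rsum_ge0 => c _ _; apply: rsum_ge0 => m; rewrite mem_iota => /andP [m0 _] _.
  apply: Rdiv_ge0; first exact: pos_INR.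
  by apply: pow_lt; have := scale_gt0 c m0; lra.
- by apply: rsum_ge0 => c _ _; apply: Rif_ge0; exact: pos_INR.
- by apply: rsum_ge0 => c _ _; apply: Rif_ge0; exact: pos_INR.
- by apply: rsum_ge0 => c _ _; apply: Rif_ge0; left; exact: exp_pos.
apply: Rif_ge0; apply: Rmult_le_pos; last by left; exact: exp_pos.
by apply: Rif_ge0; left; exact: exp_pos.
Qed.

Lemma local_le (T : Type) m n (X : (nat -> bool) -> T) : (m <= n)%N -> local m X -> local n X.
Proof. by move=> mn H A A' AA; apply: H => k km; apply: AA; lia. Qed.

Lemma pen_local n : local n.+1 (fun A => pen_log n A + pen_const n A + pen_near n A + pen_residue n A + pen_window n A).
Proof.
move=> A A' AA.
have lsol c m t S : all (ltn 0%N) c -> (m <= n)%N -> packings (sol c m) t S A = packings (sol c m) t S A'.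
  move=> cp mn; apply: (@packings_local n.+1) => // e k eS ke.
  by have := mem_sol_le cp eS ke; lia.
congr (_ + _ + _ + _ + _).
- apply: eq_bigr => c /andP [cp _]; rewrite big_seq [RHS]big_seq; apply: eq_bigr => m.
  by rewrite mem_iota => mn; rewrite lsol //; lia.
- by apply: eq_bigr => c /andP [cp _]; rewrite lsol.
- apply: eq_bigr => b _; congr (Rif _ (INR _)); apply: (@packings_local n.+1) => // e k /mapP [v vn ->].
  by rewrite inE => /eqP ->; move: vn; rewrite mem_filter mem_iota; lia.
- rewrite /pen_residue big_seq [RHS]big_seq; apply: eq_bigr => s; rewrite mem_iota => /andP [_ sb].
  case: (classic (window_end Q b0 n <= n)%N) => xn; last first.
    have nP (P : Prop) : ~ ((window_end Q b0 n <= n)%N /\ P) by case.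
    by rewrite !(Rif_false _ (nP _)).
  congr (Rif _ (exp (_ - INR _))); apply: eq_in_count => k kb; apply: AA.
  by have := block_le sb xn kb; lia.
rewrite /pen_window; case: (classic (window_cond n)) => [C|C]; last by rewrite !Rif_false.
have xn : (window_end Q b0 n <= n.+1)%N by case: C; lia.
rewrite !(Rif_true _ C) (local_le xn (@typical_local n) AA); congr (_ * exp (- _)).
rewrite big_seq [RHS]big_seq; apply: eq_bigr => k kr.
rewrite (local_le xn (@window_rep_local n k) AA) AA //.
by move: kr; rewrite mem_iota; lia.
Qed.

(** The five clauses read off a total penalty below 1: as all terms are nonnegative, each single one
    is below 1. *)
Theorem exists_typical_set : exists A N1, forall n, (N1 <= n)%N ->
  [/\ forall c m, admissible c -> (size c <= h)%N -> (0 < m <= n)%N ->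
        INR (packings (sol c m) (3 * lg n) [::] A) < (2 * scale c m) ^ (3 * lg n),
      forall c, admissible c -> (size c <= h)%N -> scale c n ^ t0 <= / INR n ^ 2 ->
        INR (packings (sol c n) t0 [::] A) < 1,
      forall b, (0 < b <= B)%N -> (\rsum_(v <- near L n b) p v) ^ t0 <= / INR n ^ 2 ->
        INR (packings [seq [:: v] | v <- near L n b] t0 [::] A) < 1,
      forall s, (s < b0)%N -> (window_end Q b0 n <= n)%N -> exp (- theta n s) <= / INR n ^ 2 ->
        theta n s < INR (count A (residue_block Q b0 n s)) &
      window_cond n -> typical n A ->
        pm n * V n / 4 < \rsum_(k <- range n) (INR (A k) * INR (window_rep Q b0 bs n A k))].
Proof.
have [A [N1 HA]] := @exists_good_set p p01 (fun n A => pen_log n A + pen_const n A + pen_near n A + pen_residue n A + pen_window n A)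
  (INR (size (forms B h)) + INR (size (forms B h)) + INR B + INR b0 + 1) 1
  (fun n A => ltac:(have [? ? ? ? ?] := pen_ge0 n A; lra)) pen_local
  (fun n n1 => ltac:(rewrite !Ex_add; have := Ex_pen_log n1; have := Ex_pen_const n1; have := Ex_pen_near n1;
    have := Ex_pen_residue n1; have := Ex_pen_window n1; rewrite /Rdiv; lra)).
exists A, (maxn 1 N1) => n; rewrite geq_max => /andP [n0 N1n].
have := HA n N1n; have [pa pb pc pd pe] := pen_ge0 n A => Hsum.
split.
- move=> c m gc ch /andP [m0 mn]; have S0 := scale_gt0 c m0; have /andP [cp cB] := gc.
  set t := (3 * lg n)%N; have P0 : 0 < (2 * scale c m) ^ t by apply: pow_lt; lra.
  have Hin k : k \in iota 1 n -> 0 <= INR (packings (sol c k) t [::] A) / (2 * scale c k) ^ t.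
    rewrite mem_iota => /andP [k0 _]; apply: Rdiv_ge0; first exact: pos_INR.
    by apply: pow_lt; have := scale_gt0 c k0; lra.
  have H1 : INR (packings (sol c m) t [::] A) / (2 * scale c m) ^ t <= pen_log n A.
    apply: Rle_trans (_ : \rsum_(m <- iota 1 n) (INR (packings (sol c m) t [::] A) / (2 * scale c m) ^ t) <= _).
      apply: (@term_le_rsum _ (iota 1 n) predT (fun m => INR (packings (sol c m) t [::] A) / (2 * scale c m) ^ t)) => //.
        by rewrite mem_iota; lia.
      by move=> k _; exact: Hin.
    rewrite /pen_log -/t.
    apply: (@term_le_rsum _ (forms B h) admissible (fun c => \rsum_(m <- iota 1 n) (INR (packings (sol c m) t [::] A) / (2 * scale c m) ^ t))) => //.
      exact: mem_forms.
    move=> c' _ _; apply: rsum_ge0 => m'; rewrite mem_iota => /andP [k0 _] _.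
    apply: Rdiv_ge0; first exact: pos_INR.
    by apply: pow_lt; have := scale_gt0 c' k0; lra.
  have H2 : INR (packings (sol c m) t [::] A) / (2 * scale c m) ^ t < 1 by lra.
  have := Rmult_lt_compat_r _ _ _ P0 H2.
  by rewrite /Rdiv Rmult_assoc Rinv_l ?Rmult_1_r ?Rmult_1_l //; lra.
- move=> c gc ch Hc; have /andP [cp cB] := gc.
  have := @term_le_rsum _ (forms B h) admissible (fun c => Rif (scale c n ^ t0 <= / INR n ^ 2) (INR (packings (sol c n) t0 [::] A))) c
    (mem_forms cp cB ch) gc (fun _ _ _ => Rif_ge0 _ (pos_INR _)).
  by rewrite Rif_true // -/(pen_const n A); lra.
- move=> b bB Hb.
  have bI : b \in iota 1 B by rewrite mem_iota; lia.
  have := @term_le_rsum _ (iota 1 B) predT (fun b => Rif ((\rsum_(v <- near L n b) p v) ^ t0 <= / INR n ^ 2)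
      (INR (packings [seq [:: v] | v <- near L n b] t0 [::] A))) b bI isT (fun _ _ _ => Rif_ge0 _ (pos_INR _)).
  by rewrite Rif_true // -/(pen_near n A); lra.
- move=> s sb xn Hs.
  have sI : s \in iota 0 b0 by rewrite mem_iota; lia.
  have := @term_le_rsum _ (iota 0 b0) predT (fun s => Rif ((window_end Q b0 n <= n)%N /\ exp (- theta n s) <= / INR n ^ 2)
      (exp (theta n s - INR (count A (residue_block Q b0 n s))))) s sI isT (fun _ _ _ => Rif_ge0 _ (Rlt_le _ _ (exp_pos _))).
  rewrite Rif_true // -/(pen_residue n A) => H; have : exp (theta n s - INR (count A (residue_block Q b0 n s))) < exp 0.
    by rewrite exp_0; lra.
  by move/exp_lt_inv; lra.
move=> C T; have : pen_window n A < 1 by lra.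
rewrite /pen_window !Rif_true // -exp_plus -{1}exp_0 => /exp_lt_inv H.
have [_ D0 _ _ _] := C.
have E : \rsum_(k <- range n) (INR (A k) * (Rif (k \in range n) (INR (window_rep Q b0 bs n A k)) / Dl n)) =
   (\rsum_(k <- range n) (INR (A k) * INR (window_rep Q b0 bs n A k))) * / Dl n.
  rewrite big_distrl /= big_seq [RHS]big_seq; apply: eq_bigr => k kr; rewrite Rif_true //.
  by rewrite /Rdiv Rmult_assoc.
rewrite E in H; apply: (Rmult_lt_reg_r (/ Dl n)); first exact: Rinv_0_lt_compat.
have -> : pm n * V n / 4 * / Dl n = pm n * V n / (4 * Dl n) by field; lra.
lra.
Qed.

End Existence.

(** * Solutions with all but one variable in a window *)

(** Needed so that, after the window variables are chosen in suitable residue classes, the remainder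
    is divisible by [b0] and the last variable exists. The induction splits off one coefficient at a
    time, solving modulo the gcd of the remaining ones with [b0]. *)
Lemma residues_exist b0 bs : (0 < b0)%N -> foldr gcdn b0 bs = 1%N ->
  forall M, exists s, [/\ size s = size bs, all (fun x => x < b0)%N s &
    dot bs s = M %[mod b0]].
Proof.
move=> b00 H1 M.
suff : forall M, (foldr gcdn b0 bs %| M)%N -> exists s, [/\ size s = size bs,
   all (fun x => x < b0)%N s & dot bs s = M %[mod b0]] by apply; rewrite H1 dvd1n.
move=> {H1 M}; elim: bs => [|c cs IH] M /=.
  by move=> dM; exists [::]; split=> //=; rewrite mod0n; apply/esym/eqP.
set d := foldr gcdn b0 cs in IH *.
have db : (d %| b0)%N.
  rewrite /d; elim: (cs) => //= a l; exact: dvdn_trans (dvdn_gcdr _ _).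
have d0 : (0 < d)%N by exact: dvdn_gt0 db.
case/dvdnP=> q EM.
have [a _ Ha] := @Bezoutl d c d0.
(* Bezout gives [gcdn d c] congruent to [- a * c] modulo [d]; the factor [d.-1] stands for -1 modulo
   [d], and reducing modulo [b0] is harmless because [d] divides [b0]. *)
pose k := ((d.-1 * q * a) %% b0)%N.
have ckM : (c * k = M %[mod d])%N.
  apply/eqP; rewrite -(eqn_modDr (q * a * c)); apply/eqP.
  have -> : (M + q * a * c = 0 %[mod d])%N.
    rewrite mod0n; apply/eqP; rewrite EM gcdnC -mulnA -mulnDr; exact: dvdn_mull.
  rewrite mod0n -modnDml -modnMmr /k modn_dvdm // modnMmr modnDml.
  have -> : (c * (d.-1 * q * a) + q * a * c = d * (q * a * c))%N.
    by case: (d) d0 => //= d1 _; lia.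
  by rewrite modnMr.
have kM : (d %| M + b0.-1 * (c * k))%N.
  rewrite /dvdn -modnDml -ckM modnDml.
  have -> : (c * k + b0.-1 * (c * k) = b0 * (c * k))%N by case: (b0) b00 => //= b1 _; lia.
  exact: dvdn_mulr.
have [s [ss sb sd]] := IH _ kM.
exists (k :: s); split=> /=; first by rewrite ss.
  by rewrite sb ltn_mod b00.
rewrite -modnDmr sd modnDmr.
have -> : (c * k + (M + b0.-1 * (c * k)) = M + c * k * b0)%N by case: (b0) b00 => //= b1 _; lia.
by rewrite addnC modnMDl.
Qed.

Section WindowMass.
Variables (A : nat -> bool) (b0 x v : nat) (T : nat -> seq nat).
Hypothesis b00 : (0 < b0)%N.
Hypothesis Tuniq : forall s, uniq (T s).
Hypothesis Trange : forall s k, k \in T s -> (0 < k < x)%N.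
Hypothesis Tmod : forall s k, (s < b0)%N -> k \in T s -> (k %% b0)%N = s.
Hypothesis Tcount : forall s, (s < b0)%N -> (v <= count A (T s))%N.

(** Each variable of [bs] has at least [v] choices in its residue class, and the congruence then
    determines an integral last variable [k]. Since all chosen entries are below [x], the size
    condition on [M] forces k >= x, outside the window, so the indicator of [k] is independent of
    the coefficient. *)
Lemma window_mass bs s M : all (ltn 0%N) bs -> size s = size bs -> all (fun i => i < b0)%N s ->
  dot bs s = M %[mod b0] -> ((b0 + sumn bs) * x <= M)%N ->
  INR v ^ size bs <= \rsum_(k <- iota x (M.+1 - x) | (b0 * k <= M)%N) INR (rep A bs (M - b0 * k)).
Proof.
elim: bs s M => [|c cs IH] [|i s] M //=.
  move=> _ _ _ + H; rewrite mod0n => /esym/eqP /dvdnP [q Eq]; rewrite addn0 in H.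
  have qI : q \in iota x (M.+1 - x).
    by rewrite mem_iota; apply/andP; split; nia.
  have Eq' : M = (b0 * q)%N by rewrite mulnC.
  have := @term_le_rsum _ (iota x (M.+1 - x)) (fun k => b0 * k <= M)%N
    (fun k => INR (rep A [::] (M - b0 * k))) q qI _ (fun _ _ _ => pos_INR _).
  by rewrite {2}Eq' subnn rep_nil /=; apply; rewrite Eq'.
move=> /andP [c0 cp] [ss] /andP [ib sb] sM HM.
apply: Rle_trans (_ : \rsum_(k1 <- T i | A k1) INR v ^ size cs <= _).
  rewrite -big_filter rsum_const size_filter; apply: Rmult_le_compat_r.
    by apply: pow_le; exact: pos_INR.
  by apply: leR_nat; exact: Tcount.
apply: Rle_trans (_ : \rsum_(k1 <- T i | A k1) \rsum_(k <- iota x (M.+1 - x) | (b0 * k <= M)%N && (c * k1 <= M - b0 * k)%N)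
   INR (rep A cs (M - b0 * k - c * k1)) <= _).
  apply: rsum_le => k1 k1T Ak1; have /andP [k10 k1x] := Trange k1T.
  have k1i := Tmod ib k1T.
  have ck1 : (c * k1 <= M)%N by nia.
  apply: Rle_trans (IH s (M - c * k1)%N cp ss sb _ _) _.
  - apply/eqP; rewrite -(eqn_modDl (c * k1)) subnKC //; apply/eqP; rewrite -sM.
    rewrite -modnDml -[in RHS]modnDml; congr ((_ + _) %% _)%N.
    by rewrite -modnMmr k1i.
  - by rewrite leq_subRL //; nia.
  rewrite -big_filter -[X in _ <= X]big_filter.
  have -> : \rsum_(k <- [seq k <- iota x ((M - c * k1).+1 - x) | (b0 * k <= M - c * k1)%N]) INR (rep A cs (M - c * k1 - b0 * k)) =
     \rsum_(k <- [seq k <- iota x ((M - c * k1).+1 - x) | (b0 * k <= M - c * k1)%N]) INR (rep A cs (M - b0 * k - c * k1)).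
    by apply: eq_bigr => k _; rewrite subnAC.
  apply: rsum_sub_uniq => [| |k _]; last exact: pos_INR.
    by rewrite filter_uniq ?iota_uniq.
  by move=> k; rewrite !mem_filter !mem_iota; lia.
rewrite (exchange_big_dep (fun k => b0 * k <= M)%N) /=; last by move=> k1 k _ /andP [].
apply: rsum_le => k _ bk; rewrite rep_cons INR_sum.
have -> : \rsum_(k1 <- iota 1 (M - b0 * k) | (c * k1 <= M - b0 * k)%N) INR (A k1 * rep A cs (M - b0 * k - c * k1)) =
  \rsum_(k1 <- iota 1 (M - b0 * k) | (c * k1 <= M - b0 * k)%N && A k1) INR (rep A cs (M - b0 * k - c * k1)).
  rewrite big_mkcondr; apply: eq_bigr => k1 _.
  by case: (A k1) => /=; rewrite ?mul1n ?mul0n.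
rewrite -big_filter -[X in _ <= X]big_filter.
apply: rsum_sub_uniq => [| |k1 _]; last exact: pos_INR.
  by rewrite filter_uniq.
move=> k1; rewrite !mem_filter mem_iota bk /= => /andP [/andP [Ak1 ck1] k1T].
by have := Trange k1T; rewrite ck1 Ak1 /=; nia.
Qed.
End WindowMass.

Lemma rep_ge_window Q b0 bs n (A : nat -> bool) : (0 < b0)%N ->
  \rsum_(k <- range b0 Q n) (INR (A k) * INR (window_rep Q b0 bs n A k)) <= INR (rep A (b0 :: bs) n).
Proof.
move=> b00; rewrite rep_cons INR_sum.
apply: Rle_trans (_ : \rsum_(k <- range b0 Q n | (b0 * k <= n)%N) INR (A k * rep A bs (n - b0 * k)) <= _).
  rewrite [X in _ <= X]big_mkcond; apply: rsum_le => k _ _; rewrite /window_rep; case: ifP => _; last by rewrite /=; lra.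
  rewrite -mult_INR multE; apply: leR_nat; rewrite leq_mul2l; apply/orP; right.
  by apply: rep_le_set => i /and3P [].
rewrite -big_filter -[X in _ <= X]big_filter; apply: rsum_sub_uniq => [| |k _]; last exact: pos_INR.
  by rewrite filter_uniq ?iota_uniq.
by move=> k; rewrite !mem_filter !mem_iota /window_end; nia.
Qed.

(** * Upper bounds where F is large *)

Definition eventually (P : nat -> Prop) := exists N, forall n, (N <= n)%N -> P n.

Lemma ev_and P Q : eventually P -> eventually Q -> eventually (fun n => P n /\ Q n).
Proof. by move=> [N HN] [M HM]; exists (maxn N M) => n H; split; [apply: HN | apply: HM]; lia. Qed.

Lemma ev_ge (N : nat) : eventually (fun n => N <= n)%N.
Proof. by exists N. Qed.

Lemma ev_lg_pow K (M : R) : eventually (fun n => M * INR (lg n) ^ K <= INR n).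
Proof. exact: lg_pow_small. Qed.

Lemma ev_lg (M : R) : eventually (fun n => M <= INR (lg n)).
Proof. exact: lg_unbounded. Qed.

Lemma nat_floor (x : R) : 0 <= x -> exists k, INR k <= x /\ forall n, INR n <= x -> (n <= k)%N.
Proof.
move=> x0; have [a1 a2] := archimed x.
have up0 : (0 < up x)%Z by apply: lt_IZR; lra.
exists (Z.to_nat (up x - 1)); split.
  by rewrite INR_IZR_INZ Z2Nat.id ?minus_IZR; lra || lia.
move=> n nx; apply/leP; apply: INR_le; rewrite !INR_IZR_INZ Z2Nat.id; last lia.
apply: IZR_le; suff : (Z.of_nat n < up x)%Z by lia.
by apply: lt_IZR; rewrite -INR_IZR_INZ; lra.
Qed.

Lemma nat_ceil (x : R) : exists k, x <= INR k /\ forall n, x <= INR n -> (k <= n)%N.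
Proof.
have [k0 Hk0] := INR_unbounded x.
have ex : exists k, (fun k => if Rle_dec x (INR k) then true else false) k.
  by exists k0; case: Rle_dec => // H; lra.
exists (ex_minn ex); case: ex_minnP => k; case: Rle_dec => // H _ Hmin; split=> // n Hn.
by apply: Hmin; case: Rle_dec.
Qed.

Lemma pow_muln x a b : x ^ (a * b)%N = (x ^ a) ^ b.
Proof. exact: pow_mult. Qed.

Lemma pow_addn x a b : x ^ (a + b)%N = x ^ a * x ^ b.
Proof. exact: pow_add. Qed.

Lemma pow_ge1 x n : 1 <= x -> 1 <= x ^ n.
Proof. exact: pow_R1_Rle. Qed.

Lemma pow_mono x m n : 1 <= x -> (m <= n)%N -> x ^ m <= x ^ n.
Proof. by move=> x1 mn; apply: Rle_pow => //; lia. Qed.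

Lemma pow_anti x m n : 0 <= x <= 1 -> (m <= n)%N -> x ^ n <= x ^ m.
Proof.
move=> [x0 x1] mn; have -> : n = (m + (n - m))%N by lia.
rewrite pow_add; have := pow_le _ m x0; have : x ^ (n - m) <= 1 ^ (n - m) by apply: pow_incr.
by rewrite pow1; have := pow_le _ (n - m) x0; nra.
Qed.

Lemma rep_le_stepR (A : nat -> bool) c m t Z rho : all (ltn 0%N) c ->
  (0 < t)%N -> 0 <= Z -> 0 <= rho ->
  (forall i v, (i < size c)%N -> A v -> (0 < v)%N -> (nth 0%N c i * v <= m)%N ->
     INR (rep A (del i c) (m - nth 0%N c i * v)) <= rho) ->
  (forall i i', (i < i')%N -> (i' < size c)%N -> INR (rep A (merge_at i i' c) m) <= rho) ->
  INR (packings (sol c m) t [::] A) < Z ^ t ->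
  INR (rep A c m) <= Z + INR (size c * size c * t.+1) * rho.
Proof.
move=> cp t0 Z0 r0 Hd Hm HZ; have [R' [R1 R2]] := nat_floor r0.
have := @rep_le_step A c m cp t Z R' t0 Z0 _ _ HZ.
rewrite -multE mult_INR => H; apply: Rle_trans (H _ _) _.
- by move=> i v *; apply: R2; exact: Hd.
- by move=> i i' *; apply: R2; exact: Hm.
by apply: Rplus_le_compat_l; apply: Rmult_le_compat_l => //; exact: pos_INR.
Qed.

Lemma admissible_del B c i : admissible B c -> (i < size c)%N -> admissible B (del i c).
Proof. by move=> /andP [cp cB] ic; rewrite /admissible all_del //=; have := sumn_del ic; lia. Qed.

Lemma size_merge c i i' : (i < i')%N -> (i' < size c)%N -> size (merge_at i i' c) = (size c).-1.
Proof. by move=> ii ic; rewrite /= !size_del //; lia. Qed.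

Lemma admissible_merge B c i i' : admissible B c -> (i < i')%N -> (i' < size c)%N -> admissible B (merge_at i i' c).
Proof.
move=> /andP [cp cB] ii ic; rewrite /admissible /= !all_del //.
have Hd : (i < size (del i' c))%N by rewrite size_del; lia.
have ci : (0 < nth 0%N c i)%N by exact: (allP cp _ (mem_nth 0%N (ltn_trans ii ic))).
have E1 := sumn_del ic; have E2 := sumn_del Hd; rewrite nth_del // in E2.
by rewrite andbT; apply/andP; split; [lia | rewrite -addnA; lia].
Qed.

Section Core.
Variables (h B : nat) (G f : nat -> R).
Hypothesis h2 : (2 <= h)%N.
Hypothesis Gpos : forall n, (0 < n)%N -> 0 < G n.
Hypothesis Gmono : forall m n, (0 < m)%N -> (m <= n)%N -> G m <= G n.
Hypothesis f0 : forall n, 0 <= f n.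
Hypothesis fh : forall n, f n ^ h = INR n * G n.
Variables (A : nat -> bool) (N1 : nat).
Hypothesis Ha : forall n, (N1 <= n)%N -> forall c m, admissible B c -> (size c <= h)%N -> (0 < m <= n)%N ->
  INR (packings (sol c m) (3 * lg n) [::] A) < (2 * scale h B f c m) ^ (3 * lg n).

Lemma lg_ge1 n : 1 <= INR (lg n).
Proof. exact: (@leR_nat 1). Qed.

Lemma rep_nilR m : INR (rep A [::] m) <= 1.
Proof. by rewrite rep_nil; case: (m == 0)%N => /=; lra. Qed.

Lemma level_step n c m rho : (N1 <= n)%N -> admissible B c -> (0 < size c <= h)%N -> (0 < m <= n)%N -> 0 <= rho ->
  (forall c' m', admissible B c' -> size c' = (size c).-1 -> (m' <= n)%N -> INR (rep A c' m') <= rho) ->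
  INR (rep A c m) <= 2 * scale h B f c m + INR (4 * h * h) * INR (lg n) * rho.
Proof.
move=> nN gc /andP [c0 ch] /andP [m0 mn] r0 IH.
have /andP [cp cB] := gc.
have S0 := scale_gt0 B h2 Gpos f0 fh c m0.
apply: Rle_trans (@rep_le_stepR A c m (3 * lg n) (2 * scale h B f c m) rho cp _ _ r0 _ _ _) _ => //.
- lra.
- by move=> i v ic _ _ _; apply: IH; [exact: admissible_del | rewrite size_del | lia].
- by move=> i i' ii ic; apply: IH; [exact: admissible_merge | rewrite size_merge | lia].
- by apply: Ha => //; rewrite m0.
apply: Rplus_le_compat_l; apply: Rmult_le_compat_r => //.
rewrite -mult_INR multE; apply: leR_nat.
apply: leq_trans (_ : (h * h * (3 * lg n).+1 <= _)%N); first by rewrite !leq_mul.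
by rewrite /lg; nia.
Qed.

Variables (c0 Cf : R).
Hypothesis c00 : 0 < c0 <= 1.
Hypothesis Cf1 : 1 <= Cf.
Hypothesis fC : forall n, f n <= Cf * INR n.
Definition high n := c0 * INR (lg n) ^ (2 * h * h) <= G n.

(** A lower bound for [G], capped at 1 so that its powers decrease and [G1_cap ^ h] may replace any
    lower power. *)
Definition G1_cap := Rmin 1 (G 1).
Lemma G1_cap_pos : 0 < G1_cap <= 1.
Proof. by split; [apply: Rmin_glb_lt; [lra | exact: Gpos] | exact: Rmin_l]. Qed.

(** Write l for [lg n] and j for [size c]. If m >= l^(2h), then f(m) is at least of order l^2 and
    f(m)^j / m = G(m) / f(m)^(h-j) saves l^(2(h-j)), enough because j < h. If m < l^(2h), the bound
    f(m) <= Cf m leaves at most l^(2h(j-1)), and [high n] absorbs this since 2h(j-1) + (h-j+1) <=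
    2h^2. *)
Lemma scale_high n c m : high n -> (0 < size c < h)%N -> (0 < m <= n)%N ->
  scale h B f c m <= (weight_const h B (size c) + 1) * (Cf ^ h / c0 + / G1_cap ^ h) * (G n / INR (lg n) ^ (h - size c + 1)).
Proof.
move=> Hn /andP [j0 jh] /andP [m0 mn]; rewrite /scale Rmult_assoc; set j := size c in j0 jh *.
have := weight_const_ge0 h B j => cw0; apply: Rmult_le_compat_l; first lra.
set l := INR (lg n); have l1 : 1 <= l := lg_ge1 n.
have mp : 0 < INR m by apply: lt_0_INR; lia.
have mp1 : 1 <= INR m by apply: (@leR_nat 1).
have fp := f_pos h2 Gpos f0 fh m0.
have [g10 g11] := G1_cap_pos.
have le_pos e : 0 < l ^ e by apply: pow_lt; lra.
have Gn := Gpos (leq_trans m0 mn).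
have Cp : 0 < Cf ^ h by apply: pow_lt; lra.
have g1h : 0 < G1_cap ^ h by exact: pow_lt.
have t1 : 0 <= Cf ^ h / c0 * (G n / l ^ (h - j + 1)).
  by apply: Rmult_le_pos; apply: Rdiv_ge0 => //; lra.
have t2 : 0 <= / G1_cap ^ h * (G n / l ^ (h - j + 1)).
  by apply: Rmult_le_pos; [left; exact: Rinv_0_lt_compat | apply: Rdiv_ge0 => //; lra].
rewrite Rmult_plus_distr_r.
case: (Rle_dec (l ^ (2 * h)) (INR m)) => Hm.
- suff : f m ^ j / INR m <= / G1_cap ^ h * (G n / l ^ (h - j + 1)) by lra.
  have fl : G1_cap * l ^ 2 <= f m.
    apply: (@pow_le_inv h) => //; first lia.
    rewrite Rpow_mult_distr fh -pow_muln.
    have H1 : G1_cap ^ h <= G m.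
      apply: Rle_trans (_ : G1_cap ^ 1 <= _); first by apply: pow_anti; [lra | lia].
      rewrite pow_1; apply: Rle_trans (Rmin_r _ _) _; exact: Gmono.
    have := le_pos (2 * h)%N; have := Gpos m0; nra.
  have -> : f m ^ j / INR m = G m / f m ^ (h - j).
    have fj : 0 < f m ^ (h - j) by exact: pow_lt.
    apply: (Rmult_eq_reg_r (INR m * f m ^ (h - j))); last by nra.
    have -> : f m ^ j / INR m * (INR m * f m ^ (h - j)) = f m ^ j * f m ^ (h - j) by field; lra.
    have -> : G m / f m ^ (h - j) * (INR m * f m ^ (h - j)) = INR m * G m by field; lra.
    by rewrite -pow_addn -fh; congr pow; lia.
  have H2 : G1_cap ^ h * l ^ (h - j + 1) <= f m ^ (h - j).
    apply: Rle_trans (_ : (G1_cap * l ^ 2) ^ (h - j) <= _); last by apply: pow_incr; split => //; have := le_pos 2%N; nra.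
    rewrite Rpow_mult_distr -pow_muln; apply: Rmult_le_compat; [by left | by left | |].
      by apply: pow_anti; [lra | lia].
    by apply: pow_mono => //; lia.
  have -> : / G1_cap ^ h * (G n / l ^ (h - j + 1)) = G n / (G1_cap ^ h * l ^ (h - j + 1)).
    by field; split; apply: Rgt_not_eq => //; apply: Rlt_gt.
  apply: Rmult_le_compat; [left; exact: Gpos | left; apply: Rinv_0_lt_compat; exact: pow_lt | exact: Gmono |].
  by apply: Rinv_le_contravar => //; apply: Rmult_lt_0_compat.
suff : f m ^ j / INR m <= Cf ^ h / c0 * (G n / l ^ (h - j + 1)) by lra.
have H1 : f m ^ j <= Cf ^ j * (INR m * INR m ^ (j - 1)).
  rewrite -[_ * INR m ^ _]/(INR m ^ (j - 1).+1); have -> : (j - 1).+1 = j by lia.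
  by rewrite -Rpow_mult_distr; apply: pow_incr.
have H2 : INR m ^ (j - 1) <= l ^ (2 * h * (j - 1)).
  by rewrite pow_muln; apply: pow_incr; lra.
have H3 : Cf ^ j <= Cf ^ h by apply: pow_mono => //; lia.
have Hj : 0 <= INR m ^ (j - 1) by apply: pow_le; lra.
apply: (Rmult_le_reg_r (INR m)) => //.
have -> : f m ^ j / INR m * INR m = f m ^ j by field; lra.
apply: Rle_trans H1 _.
have -> : Cf ^ j * (INR m * INR m ^ (j - 1)) = Cf ^ j * INR m ^ (j - 1) * INR m by ring.
apply: Rmult_le_compat_r; first lra.
apply: Rle_trans (_ : Cf ^ h * l ^ (2 * h * (j - 1)) <= _).
  by apply: Rmult_le_compat => //; apply: pow_le; lra.
have -> : Cf ^ h / c0 * (G n / l ^ (h - j + 1)) = Cf ^ h * (G n / (c0 * l ^ (h - j + 1))).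
  by field; split; have := le_pos (h - j + 1)%N; lra.
apply: Rmult_le_compat_l; first lra.
have lp := le_pos (h - j + 1)%N.
apply: (Rmult_le_reg_r (c0 * l ^ (h - j + 1))); first by apply: Rmult_lt_0_compat; lra.
have -> : G n / (c0 * l ^ (h - j + 1)) * (c0 * l ^ (h - j + 1)) = G n by field; lra.
apply: Rle_trans Hn.
have -> : l ^ (2 * h * (j - 1)) * (c0 * l ^ (h - j + 1)) = c0 * l ^ (2 * h * (j - 1) + (h - j + 1)).
  by rewrite (pow_addn l (2 * h * (j - 1))); ring.
apply: Rmult_le_compat_l; first lra.
by apply: pow_mono => //; nia.
Qed.

(** One more variable costs one factor [lg n], the packing length, so the exponent of [lg n] drops
    by one. At j = h-1 the exponent is 2: one factor is spent in passing to h variables, and the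
    spare one makes the coefficients in Chernoff's bound small against G(n) / lg n. *)
Lemma high_levels j : (j < h)%N -> exists K, 0 <= K /\ forall n, (N1 <= n)%N -> (0 < n)%N -> high n ->
  forall c m, admissible B c -> size c = j -> (m <= n)%N ->
  INR (rep A c m) <= K * (G n / INR (lg n) ^ (h - j + 1)).
Proof.
have lp n e : 0 < INR (lg n) ^ e by apply: pow_lt; have := lg_ge1 n; lra.
elim: j => [_|j IH jh].
  exists (/ c0); split; first by left; apply: Rinv_0_lt_compat; lra.
  move=> n nN n0 Hn c m gc /size0nil -> mn; apply: Rle_trans (rep_nilR m) _.
  have l0 := lp n (h - 0 + 1)%N.
  apply: (Rmult_le_reg_l (c0 * INR (lg n) ^ (h - 0 + 1))); first by apply: Rmult_lt_0_compat; lra.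
  have -> : c0 * INR (lg n) ^ (h - 0 + 1) * (/ c0 * (G n / INR (lg n) ^ (h - 0 + 1))) = G n by field; lra.
  rewrite Rmult_1_r; apply: Rle_trans Hn; apply: Rmult_le_compat_l; first lra.
  by apply: pow_mono; [exact: lg_ge1 | nia].
have [K [K0 HK]] := IH (ltnW jh).
pose K' := 2 * ((weight_const h B j.+1 + 1) * (Cf ^ h / c0 + / G1_cap ^ h)) + INR (4 * h * h) * K.
have [g10 g11] := G1_cap_pos.
have E0 : 0 <= (weight_const h B j.+1 + 1) * (Cf ^ h / c0 + / G1_cap ^ h).
  apply: Rmult_le_pos; first by have := weight_const_ge0 h B j.+1; lra.
  apply: Rplus_le_le_0_compat; first by apply: Rdiv_ge0; [apply: pow_le; lra | lra].
  by left; apply: Rinv_0_lt_compat; apply: pow_lt.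
have K'0 : 0 <= K'.
  by apply: Rplus_le_le_0_compat; [lra | apply: Rmult_le_pos => //; exact: pos_INR].
exists K'; split => // n nN n0 Hn c m gc sc mn.
have Gn := Gpos n0.
have X0 e : 0 <= G n / INR (lg n) ^ e by apply: Rdiv_ge0 => //; lra.
case: (posnP m) => m0.
  by have /andP [cp _] := gc; rewrite m0 rep_m0 ?sc //=; exact: Rmult_le_pos.
have mn' : (0 < m <= n)%N by rewrite m0.
apply: Rle_trans (@level_step n c m (K * (G n / INR (lg n) ^ (h - j + 1))) nN gc _ mn' _ _) _.
- by rewrite sc; lia.
- exact: Rmult_le_pos.
- by move=> c' m' gc' sc' mn''; apply: (HK n nN n0 Hn) => //; rewrite sc' sc.
have := @scale_high n c m Hn; rewrite sc => /(_ jh mn') SH.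
have E : INR (lg n) * (G n / INR (lg n) ^ (h - j + 1)) = G n / INR (lg n) ^ (h - j.+1 + 1).
  have -> : (h - j + 1 = (h - j.+1 + 1).+1)%N by lia.
  rewrite -[INR (lg n) ^ _.+1]/(INR (lg n) * INR (lg n) ^ (h - j.+1 + 1)).
  by field; have := lp n (h - j.+1 + 1)%N; have := lg_ge1 n; lra.
rewrite /K' Rmult_plus_distr_r; apply: Rplus_le_compat; first lra.
by rewrite -E; right; ring.
Qed.

Lemma high_upper : exists K, 0 <= K /\ forall n, (N1 <= n)%N -> (0 < n)%N -> high n ->
  forall c, admissible B c -> size c = h -> INR (rep A c n) <= K * G n.
Proof.
have h1 : (h.-1 < h)%N by lia.
have [K [K0 HK]] := high_levels h1.
exists (2 * (weight_const h B h + 1) + INR (4 * h * h) * K); split.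
  apply: Rplus_le_le_0_compat; first by have := weight_const_ge0 h B h; lra.
  by apply: Rmult_le_pos => //; exact: pos_INR.
move=> n nN n0 Hn c gc sc; have Gn := Gpos n0; have l1 := lg_ge1 n.
have E : (h - h.-1 + 1 = 2)%N by lia.
rewrite E in HK.
have X0 : 0 <= G n / INR (lg n) ^ 2 by apply: Rdiv_ge0; [lra | apply: pow_lt; lra].
have n0' : (0 < n <= n)%N by rewrite n0 leqnn.
apply: Rle_trans (@level_step n c n (K * (G n / INR (lg n) ^ 2)) nN gc _ n0' _ _) _.
- by rewrite sc; lia.
- exact: Rmult_le_pos.
- by move=> c' m' gc' sc' mn'; apply: (HK n nN n0 Hn) => //; rewrite sc' sc.
have -> : scale h B f c n = (weight_const h B h + 1) * G n.
  by rewrite /scale sc fh; field; apply: not_0_INR; lia.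
have H1 : INR (lg n) * (G n / INR (lg n) ^ 2) <= G n.
  have -> : INR (lg n) * (G n / INR (lg n) ^ 2) = G n / INR (lg n) by field; lra.
  apply: (Rmult_le_reg_r (INR (lg n))); first lra.
  by rewrite /Rdiv Rmult_assoc Rinv_l; nra.
rewrite [X in _ <= X]Rmult_plus_distr_r; apply: Rplus_le_compat; first lra.
have -> : INR (4 * h * h) * INR (lg n) * (K * (G n / INR (lg n) ^ 2)) =
  INR (4 * h * h) * K * (INR (lg n) * (G n / INR (lg n) ^ 2)) by ring.
by apply: Rmult_le_compat_l => //; apply: Rmult_le_pos => //; exact: pos_INR.
Qed.

End Core.

(** * Forms with boundedly many representations *)

Lemma pow_small x K n e : 0 <= x -> x <= K / INR n -> 1 <= K -> K ^ 2 <= INR n -> (4 <= e)%N ->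
  x ^ e <= / INR n ^ 2.
Proof.
move=> x0 xK K1 Kn e4; have np : 1 <= INR n by nra.
have x1 : x <= 1.
  apply: Rle_trans xK _; apply: (Rmult_le_reg_r (INR n)); first lra.
  by rewrite /Rdiv Rmult_assoc Rinv_l; nra.
apply: Rle_trans (@pow_anti x 4 e (conj x0 x1) e4) _.
apply: Rle_trans (_ : (K / INR n) ^ 4 <= _); first by apply: pow_incr.
have -> : (K / INR n) ^ 4 = (K ^ 2) ^ 2 / (INR n ^ 2) ^ 2 by field; lra.
have n2 : 0 < INR n ^ 2 by apply: pow_lt; lra.
apply: (Rmult_le_reg_r ((INR n ^ 2) ^ 2)); first by apply: pow_lt.
have -> : (K ^ 2) ^ 2 / (INR n ^ 2) ^ 2 * (INR n ^ 2) ^ 2 = (K ^ 2) ^ 2 by field; lra.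
have -> : / INR n ^ 2 * (INR n ^ 2) ^ 2 = INR n ^ 2 by field; lra.
by apply: pow_incr; split => //; apply: pow_le; lra.
Qed.

Lemma weight_const_mono h B i j : (0 < h)%N -> (i <= j)%N -> weight_const h B i <= weight_const h B j.
Proof.
move=> h0; elim: j => [|j IH]; first by rewrite leqn0 => /eqP ->; lra.
rewrite leq_eqVlt => /orP [/eqP ->|]; first lra.
rewrite ltnS => /IH H; apply: Rle_trans H _ => /=.
have := weight_const_ge0 h B j; have : 1 <= INR h by apply: (@leR_nat 1).
have := pow_le _ j (pos_INR h); have := pos_INR B => a b c d.
have : 0 <= INR B * INR h ^ j by apply: Rmult_le_pos.
nra.
Qed.

Lemma ev_geR (M : R) : eventually (fun n => M <= INR n).
Proof.
have [k Hk] := INR_unbounded M; exists k => n /leR_nat; lra.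
Qed.

Section LowRegime.
Variables (h B t0 : nat) (G f : nat -> R).
Hypothesis h2 : (2 <= h)%N.
Hypothesis Gpos : forall n, (0 < n)%N -> 0 < G n.
Hypothesis Gmono : forall m n, (0 < m)%N -> (m <= n)%N -> G m <= G n.
Hypothesis f0 : forall n, 0 <= f n.
Hypothesis fh : forall n, f n ^ h = INR n * G n.

Definition thin n := G n ^ (2 * h) <= INR n.

Lemma f_ge_G1_cap n : (0 < n)%N -> G1_cap G <= f n.
Proof.
move=> n0; have [g10 g11] := G1_cap_pos Gpos.
apply: (@pow_le_inv h) => //; first lia.
apply: Rle_trans (_ : G1_cap G ^ 1 <= _); first by apply: pow_anti; [lra | lia].
rewrite pow_1 fh; apply: Rle_trans (Rmin_r _ _) _.
have := Gmono (ltn0Sn 0) n0; have := Gpos (ltn0Sn 0); have : 1 <= INR n by apply: (@leR_nat 1).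
nra.
Qed.

(* Since [f] is bounded below, lower powers of [f] are dominated by higher ones. *)
Lemma f_pow_le i j n : (0 < n)%N -> (i <= j)%N -> (j <= h)%N -> f n ^ i <= / G1_cap G ^ h * f n ^ j.
Proof.
move=> n0 ij jh; have [g10 g11] := G1_cap_pos Gpos; have fg := f_ge_G1_cap n0.
have -> : j = (i + (j - i))%N by lia.
rewrite pow_addn; have fi : 0 <= f n ^ i by exact: pow_le.
have gh : 0 < G1_cap G ^ h by exact: pow_lt.
have H : G1_cap G ^ h <= f n ^ (j - i).
  apply: Rle_trans (_ : G1_cap G ^ (j - i) <= _); first by apply: pow_anti; [lra | lia].
  by apply: pow_incr; lra.
apply: (Rmult_le_reg_l (G1_cap G ^ h)) => //.
have -> : G1_cap G ^ h * (/ G1_cap G ^ h * (f n ^ i * f n ^ (j - i))) = f n ^ i * f n ^ (j - i) by field; lra.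
nra.
Qed.

Definition scale_const := (weight_const h B h + 1) * / G1_cap G ^ h.

Lemma scale_const_ge1 : 1 <= scale_const.
Proof.
have [g10 g11] := G1_cap_pos Gpos; have cw0 := weight_const_ge0 h B h.
have gh : 0 < G1_cap G ^ h by exact: pow_lt.
have gh1 : G1_cap G ^ h <= 1 by rewrite -(pow1 h); apply: pow_incr; lra.
have : 1 <= / G1_cap G ^ h.
  rewrite -{1}Rinv_1; exact: Rinv_le_contravar.
rewrite /scale_const; nra.
Qed.

Lemma scale_le_pow c n j : (0 < n)%N -> (size c <= j)%N -> (j <= h)%N ->
  scale h B f c n <= scale_const * (f n ^ j / INR n).
Proof.
move=> n0 cj jh; have np : 0 < INR n by apply: lt_0_INR; lia.
have [g10 g11] := G1_cap_pos Gpos; have gh : 0 < G1_cap G ^ h by exact: pow_lt.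
have := f_pow_le n0 cj jh => H.
have cwm : weight_const h B (size c) <= weight_const h B h by apply: weight_const_mono; lia.
have cw0 := weight_const_ge0 h B (size c).
rewrite /scale /scale_const Rmult_assoc; apply: Rmult_le_compat; [lra | | lra |].
  by apply: Rdiv_ge0 => //; exact: pow_le.
rewrite /Rdiv -Rmult_assoc; apply: Rmult_le_compat_r => //; left; exact: Rinv_0_lt_compat.
Qed.

Lemma scale_ge0 c n : (0 < n)%N -> 0 <= scale h B f c n.
Proof. by move=> n0; left; exact: (scale_gt0 B h2 Gpos f0 fh). Qed.

Hypothesis t0E : t0 = (8 * h * (h - 1))%N.
Variable C1 : R.
Hypothesis C11 : 1 <= C1.
Hypothesis fC1 : forall n, f n ^ (h - 1) <= C1 * INR n.

(** With f(n)^(h-1) <= C1 n, the power (f(n)^(h-2) / n)^(h-1) is at most a constant over n. The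
    exponent [t0] is a multiple of h-1 here and of 2h for thin n, with a cofactor of at least 4 in
    both cases, as [pow_small] requires. *)
Lemma scale_small_short : eventually (fun n => forall c, (size c + 2 <= h)%N ->
  scale h B f c n ^ t0 <= / INR n ^ 2).
Proof.
pose K := scale_const ^ (h - 1) * C1 ^ (h - 2).
have K1 : 1 <= K.
  have H1 := pow_ge1 (h - 1) scale_const_ge1; have H2 := pow_ge1 (h - 2) C11; rewrite /K; nra.
have [N HN] := ev_geR (K ^ 2); exists (maxn 1 N) => n; rewrite geq_max => /andP [n0 Nn] c ch.
have np : 0 < INR n by apply: lt_0_INR; lia.
have -> : t0 = ((h - 1) * (8 * h))%N by rewrite t0E; nia.
rewrite pow_muln; apply: (@pow_small _ K) => //; [| |exact: HN |nia].
  by apply: pow_le; exact: scale_ge0.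
have S := @scale_le_pow c n (h - 2) n0 _ _.
apply: Rle_trans (pow_incr _ _ (h - 1) (conj (scale_ge0 c n0) (S _ _))) _; [lia | lia |].
have -> : K / INR n = scale_const ^ (h - 1) * (C1 ^ (h - 2) / INR n) by rewrite /K /Rdiv Rmult_assoc.
rewrite Rpow_mult_distr; apply: Rmult_le_compat_l.
  by apply: pow_le; have := scale_const_ge1; lra.
have -> : (f n ^ (h - 2) / INR n) ^ (h - 1) = (f n ^ (h - 1)) ^ (h - 2) / INR n ^ (h - 1).
  rewrite /Rdiv Rpow_mult_distr pow_inv -!pow_muln; congr (_ ^ _ * _); lia.
apply: Rle_trans (_ : (C1 * INR n) ^ (h - 2) / INR n ^ (h - 1) <= _).
  apply: Rmult_le_compat_r; first by left; apply: Rinv_0_lt_compat; exact: pow_lt.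
  by apply: pow_incr; split; [exact: pow_le | exact: fC1].
rewrite Rpow_mult_distr; have -> : (h - 1 = (h - 2).+1)%N by lia.
rewrite -[INR n ^ _.+1]/(INR n * INR n ^ (h - 2)).
by have P := pow_lt _ (h - 2) np; right; field; split; lra.
Qed.

(** With h-1 variables the mean may be merely bounded under the growth hypothesis. Thinness makes it
    small: (f(n)^(h-1) / n)^(2h) = G(n)^(2(h-1)) / n^2, which is at most 1/n. *)
Lemma scale_small_thin : eventually (fun n => thin n -> forall c, (size c + 1 <= h)%N ->
  scale h B f c n ^ t0 <= / INR n ^ 2).
Proof.
pose K := scale_const ^ (2 * h).
have K1 : 1 <= K by exact: pow_ge1 scale_const_ge1.
have [N HN] := ev_geR (K ^ 2); exists (maxn 1 N) => n; rewrite geq_max => /andP [n0 Nn] thn c ch.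
have np : 1 <= INR n by exact: (@leR_nat 1).
have -> : t0 = (2 * h * (4 * (h - 1)))%N by rewrite t0E; nia.
rewrite pow_muln; apply: (@pow_small _ K) => //; [| |exact: HN |nia].
  by apply: pow_le; exact: scale_ge0.
have S := @scale_le_pow c n (h - 1) n0 _ _.
apply: Rle_trans (pow_incr _ _ (2 * h) (conj (scale_ge0 c n0) (S _ _))) _; [lia | lia |].
rewrite Rpow_mult_distr -/K; apply: Rmult_le_compat_l; first lra.
have -> : (f n ^ (h - 1) / INR n) ^ (2 * h) = G n ^ (2 * (h - 1)) / INR n ^ 2.
  rewrite /Rdiv Rpow_mult_distr pow_inv -pow_muln.
  have -> : ((h - 1) * (2 * h) = h * (2 * (h - 1)))%N by nia.
  rewrite pow_muln fh Rpow_mult_distr.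
  have -> : (2 * h = 2 * (h - 1) + 2)%N by lia.
  rewrite (pow_addn (INR n)).
  have P : 0 < INR n ^ (2 * (h - 1)) by apply: pow_lt; lra.
  by field; split; lra.
have Gn := Gpos n0.
apply: (Rmult_le_reg_r (INR n ^ 2)); first by apply: pow_lt; lra.
have -> : G n ^ (2 * (h - 1)) / INR n ^ 2 * INR n ^ 2 = G n ^ (2 * (h - 1)) by field; lra.
have -> : / INR n * INR n ^ 2 = INR n by field; lra.
case: (Rle_dec 1 (G n)) => G1.
  by apply: Rle_trans thn; apply: pow_mono => //; lia.
have : G n ^ (2 * (h - 1)) <= 1 ^ (2 * (h - 1)) by apply: pow_incr; lra.
by rewrite pow1; lra.
Qed.

Fixpoint bounded_const j : R := if j is i.+1 then 1 + INR (h * h * t0.+1) * bounded_const i else 1.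

Lemma bounded_const_ge1 j : 1 <= bounded_const j.
Proof.
elim: j => [|j IH] /=; first lra.
have := pos_INR (h * h * t0.+1); nra.
Qed.

Lemma bounded_const_step x j : (j <= h)%N -> 1 <= x -> 1 + INR (j * j * t0.+1) * (x * bounded_const j.-1) <= x * bounded_const j.
Proof.
move=> jh x1; case: j jh => [|j] jh; first by rewrite /=; lra.
rewrite -[bounded_const j.+1]/(1 + INR (h * h * t0.+1) * bounded_const j) -[j.+1.-1]/j.
rewrite Rmult_plus_distr_l Rmult_1_r; apply: Rplus_le_compat => //.
have H : INR (j.+1 * j.+1 * t0.+1) <= INR (h * h * t0.+1).
  by apply: leR_nat; rewrite !leq_mul.
have xK : 0 <= x * bounded_const j by have := bounded_const_ge1 j; nra.
by apply: Rle_trans (Rmult_le_compat_r _ _ _ xK H) _; right; ring.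
Qed.

Variables (A : nat -> bool) (N1 : nat).
Hypothesis Hb : forall n, (N1 <= n)%N -> forall c, admissible B c -> (size c <= h)%N ->
  scale h B f c n ^ t0 <= / INR n ^ 2 -> INR (packings (sol c n) t0 [::] A) < 1.

(* The constant [bounded_const] does not depend on the threshold [N2] when [A'] has no
   small elements, as one may then take [kappa = 1]. *)
Lemma bounded_forms : exists N2, (N1 <= N2)%N /\ forall (A' : nat -> bool) kappa,
  (forall k, A' k -> A k) -> 1 <= kappa ->
  (forall c m, admissible B c -> (size c <= h)%N -> (m < N2)%N -> INR (rep A' c m) <= kappa) ->
  (forall c m, admissible B c -> (size c + 2 <= h)%N -> INR (rep A' c m) <= kappa * bounded_const (size c)) /\
  (forall c m, admissible B c -> (size c + 1 <= h)%N -> (m < N2)%N \/ thin m -> INR (rep A' c m) <= kappa * bounded_const (size c)).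
Proof.
have [N HN] := ev_and scale_small_short scale_small_thin.
exists (maxn N N1); split; first by rewrite leq_maxr.
move=> A' kappa sub k1 small.
have t00 : (0 < t0)%N by rewrite t0E; nia.
have pk c n : (maxn N N1 <= n)%N -> admissible B c -> (size c <= h)%N -> scale h B f c n ^ t0 <= / INR n ^ 2 ->
    INR (packings (sol c n) t0 [::] A') < 1 ^ t0.
  move=> nN gc ch sc; rewrite pow1; apply: Rle_lt_trans (Hb _ gc ch sc); last by lia.
  by apply: leR_nat; exact: packings_sub_set.
have kK j : kappa <= kappa * bounded_const j by have := bounded_const_ge1 j; nra.
have step c m : admissible B c -> (0 < size c <= h)%N -> (maxn N N1 <= m)%N -> scale h B f c m ^ t0 <= / INR m ^ 2 ->
    (forall c' m', admissible B c' -> size c' = (size c).-1 -> INR (rep A' c' m') <= kappa * bounded_const (size c).-1) ->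
    INR (rep A' c m) <= kappa * bounded_const (size c).
  move=> gc /andP [c0 ch] mN sc IH; have /andP [cp cB] := gc.
  apply: Rle_trans (bounded_const_step ch k1).
  apply: (@rep_le_stepR A' c m t0 1) => //; first lra.
  - by have := bounded_const_ge1 (size c).-1; nra.
  - by move=> i v ic _ _ _; apply: IH; [exact: admissible_del | rewrite size_del].
  - by move=> i i' ii ic; apply: IH; [exact: admissible_merge | rewrite size_merge].
  exact: pk.
have short c m : admissible B c -> (size c + 2 <= h)%N -> INR (rep A' c m) <= kappa * bounded_const (size c).
  move En : (size c) => j; elim: j c m En => [|j IH] c m sc gc ch.
    move/size0nil: sc => ->; apply: Rle_trans (kK 0%N); apply: Rle_trans k1.
    by rewrite rep_nil; case: (m == 0)%N => /=; lra.
  case: (ltnP m (maxn N N1)) => mN.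
    apply: Rle_trans (kK _); apply: small => //; lia.
  rewrite -sc; apply: step => //; first by lia.
    by have [H _] := HN m (leq_trans (leq_maxl _ _) mN); apply: H; rewrite sc.
  move=> c' m' gc' sc'; rewrite sc /=; apply: IH => //; first by rewrite sc' sc.
  by lia.
split=> // c m gc ch [mN|thm].
  by apply: Rle_trans (kK _); apply: small => //; lia.
case: (ltnP m (maxn N N1)) => mN.
  by apply: Rle_trans (kK _); apply: small => //; lia.
case: (posnP (size c)) => [/size0nil ->|c0].
  apply: Rle_trans (kK 0%N); apply: Rle_trans k1.
  by rewrite rep_nil; case: (m == 0)%N => /=; lra.
apply: step => //; first by lia.
  by have [_ H] := HN m (leq_trans (leq_maxl _ _) mN); exact: H.
by move=> c' m' gc' sc'; rewrite -sc'; apply: short => //; rewrite sc'; lia.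
Qed.

End LowRegime.

(** * Upper bound where F is small *)

Section LowUpper.
Variables (h B t0 : nat) (G f : nat -> R).
Hypothesis h2 : (2 <= h)%N.
Hypothesis Gpos : forall n, (0 < n)%N -> 0 < G n.
Hypothesis Gmono : forall m n, (0 < m)%N -> (m <= n)%N -> G m <= G n.
Hypothesis f0 : forall n, 0 <= f n.
Hypothesis fh : forall n, f n ^ h = INR n * G n.
Hypothesis t0E : t0 = (8 * h * (h - 1))%N.
Variables (C1 c0 cG : R).
Hypothesis C11 : 1 <= C1.
Hypothesis fC1 : forall n, f n ^ (h - 1) <= C1 * INR n.
Hypothesis c00 : 0 < c0 <= 1.
Hypothesis cG0 : 0 < cG.
Hypothesis GcG : forall n, (0 < n)%N -> cG * INR (lg n) <= G n.

(** The 2h-th power of the bound (lg n)^(2h^2) for [G] at a low n, so that every m between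
    [special_len n] and n is thin. *)
Definition special_len n := (lg n ^ (2 * h * h * (2 * h)))%N.
Local Notation low n := (~ high h G c0 n).

Lemma low_G n : low n -> G n <= INR (lg n) ^ (2 * h * h).
Proof.
rewrite /high => H; have := pow_le _ (2 * h * h) (pos_INR (lg n)) => P; nra.
Qed.

Lemma low_thin n m : (0 < n)%N -> low n -> INR (special_len n) <= INR m -> (m <= n)%N -> thin h G m.
Proof.
move=> n0 ln Lm mn.
have L1 : (0 < special_len n)%N by rewrite expn_gt0.
have m0 : (0 < m)%N by have := leR_nat L1 => L1'; apply/ltP; apply: INR_lt; rewrite /= in L1' *; lra.
rewrite /thin; apply: Rle_trans Lm; rewrite INR_expn (pow_muln (INR (lg n))); apply: pow_incr.
split; first by left; exact: Gpos.
by apply: Rle_trans (Gmono m0 mn) _; exact: low_G.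
Qed.

(** There are at most [special_len n] candidates, all of order n, hence each of probability
    O(f(n)/n). As f(n)^h = n G(n) and [G n] is polylogarithmic, the h-th power of the sum is a power
    of [lg n] over n. *)
Lemma near_sum_small : eventually (fun n => low n -> forall b, (0 < b <= B)%N ->
  (\rsum_(v <- near special_len n b) prob f v) ^ t0 <= / INR n ^ 2).
Proof.
pose e := (2 * h * h * (2 * h))%N.
have [N HN] := ev_and (ev_lg_pow e 2) (ev_and (ev_lg_pow ((e * h + 2 * h * h) * 2) ((2 * INR B) ^ (2 * h))) (ev_ge 1)).
exists N => n /HN [E1 [E2 n0]] ln b /andP [b0 bB].
have np : 1 <= INR n by exact: (@leR_nat 1).
have Gn := Gpos n0; have fn := f_pos h2 Gpos f0 fh n0.
have L2 : (2 * special_len n <= n)%N.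
  apply/leP; apply: INR_le; rewrite -multE mult_INR INR_expn -/e; exact: E1.
have B1 : 1 <= INR B by apply: (@leR_nat 1); lia.
have p01 := prob01 h2 f0 fh.
set x := \rsum_(v <- _) _.
have x0 : 0 <= x by apply: rsum_ge0 => v _ _; have := p01 v; lra.
pose z := INR (lg n) ^ e * (2 * INR B * f n / INR n).
have z0 : 0 <= 2 * INR B * f n / INR n by apply: Rdiv_ge0; [nra | lra].
have xz : x <= z.
  apply: Rle_trans (_ : \rsum_(v <- near special_len n b) (2 * INR B * f n / INR n) <= _).
    apply: rsum_le => v; rewrite mem_filter mem_iota => /andP [/andP [v1 v2] /andP [v3 v4]] _.
    apply: Rle_trans (prob_le f v) _.
    have vp : 1 <= INR v by exact: (@leR_nat 1).
    have fv : f v <= f n by apply: (f_mono h2 Gpos Gmono f0 fh); nia.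
    have nv : INR n <= 2 * INR B * INR v.
      by rewrite -[2]/(INR 2) -!mult_INR !multE; apply: leR_nat; nia.
    apply: (Rmult_le_reg_r (INR v * INR n)); first by nra.
    have -> : f v / INR v * (INR v * INR n) = f v * INR n by field; lra.
    have -> : 2 * INR B * f n / INR n * (INR v * INR n) = f n * (2 * INR B * INR v) by field; lra.
    by apply: Rmult_le_compat => //; lra.
  rewrite rsum_const; apply: Rmult_le_compat_r => //; rewrite -INR_expn; apply: leR_nat.
  rewrite -(size_map (fun v => n - b * v)%N (near special_len n b)) -[X in (_ <= X)%N](size_iota 0); apply: uniq_leq_size.
    rewrite map_inj_in_uniq ?filter_uniq ?iota_uniq // => u v.
    rewrite !mem_filter => /andP [/andP [u1 _] _] /andP [/andP [v1 _] _] E.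
    have : (b * u == b * v)%N by lia.
    by rewrite eqn_mul2l; case: (b) b0 => //= _ _ /eqP.
  by move=> i /mapP [v]; rewrite mem_filter => /andP [/andP [v1 v2] _] ->; rewrite mem_iota -/(special_len n); lia.
have -> : t0 = (2 * h * (4 * (h - 1)))%N by rewrite t0E; nia.
rewrite pow_muln; apply: (@pow_small _ 1) => //; [exact: pow_le | | lra | lra | lia].
apply: Rle_trans (pow_incr _ _ (2 * h) (conj x0 xz)) _.
have zh : z ^ h <= (2 * INR B) ^ h * INR (lg n) ^ (e * h + 2 * h * h) / INR n.
  rewrite /z Rpow_mult_distr -pow_muln.
  have -> : (2 * INR B * f n / INR n) ^ h = (2 * INR B) ^ h * (INR n * G n) / INR n ^ h.
    by rewrite /Rdiv !Rpow_mult_distr pow_inv fh; ring.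
  rewrite (pow_addn _ (e * h)).
  have Ph : 0 < INR n ^ h by apply: pow_lt; lra.
  have Bh : 0 < (2 * INR B) ^ h by apply: pow_lt; lra.
  have le0 : 0 <= INR (lg n) ^ (e * h) by apply: pow_le; exact: pos_INR.
  have -> : INR (lg n) ^ (e * h) * ((2 * INR B) ^ h * (INR n * G n) / INR n ^ h) =
     ((2 * INR B) ^ h * INR (lg n) ^ (e * h)) * (INR n * G n / INR n ^ h) by field; lra.
  have -> : (2 * INR B) ^ h * (INR (lg n) ^ (e * h) * INR (lg n) ^ (2 * h * h)) / INR n =
     ((2 * INR B) ^ h * INR (lg n) ^ (e * h)) * (INR (lg n) ^ (2 * h * h) / INR n) by field; lra.
  apply: Rmult_le_compat_l; first by nra.
  apply: Rle_trans (_ : G n / INR n <= _); last first.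
    by apply: Rmult_le_compat_r; [left; apply: Rinv_0_lt_compat; lra | exact: low_G].
  apply: (Rmult_le_reg_r (INR n ^ h * INR n)); first by nra.
  have -> : INR n * G n / INR n ^ h * (INR n ^ h * INR n) = G n * INR n ^ 2 by field; lra.
  have -> : G n / INR n * (INR n ^ h * INR n) = G n * INR n ^ h by field; lra.
  by apply: Rmult_le_compat_l; [lra | apply: pow_mono].
have z0' : 0 <= z by apply: Rmult_le_pos => //; apply: pow_le; exact: pos_INR.
rewrite mulnC pow_muln; apply: Rle_trans (pow_incr _ _ 2 (conj (pow_le _ h z0') zh)) _.
have -> : ((2 * INR B) ^ h * INR (lg n) ^ (e * h + 2 * h * h) / INR n) ^ 2 =
   (2 * INR B) ^ (2 * h) * INR (lg n) ^ ((e * h + 2 * h * h) * 2) / INR n ^ 2.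
  by rewrite (pow_muln (INR (lg n))) [(2 * h)%N]mulnC (pow_muln (2 * INR B)); field; lra.
apply: (Rmult_le_reg_r (INR n ^ 2)); first by apply: pow_lt; lra.
set y := _ * _ in E2 *.
have -> : y / INR n ^ 2 * INR n ^ 2 = y by field; lra.
by have -> : 1 / INR n * INR n ^ 2 = INR n by field; lra.
Qed.

Variables (A : nat -> bool) (N1 : nat).
Hypothesis Ha : forall n, (N1 <= n)%N -> forall c m, admissible B c -> (size c <= h)%N -> (0 < m <= n)%N ->
  INR (packings (sol c m) (3 * lg n) [::] A) < (2 * scale h B f c m) ^ (3 * lg n).
Hypothesis Hb : forall n, (N1 <= n)%N -> forall c, admissible B c -> (size c <= h)%N ->
  scale h B f c n ^ t0 <= / INR n ^ 2 -> INR (packings (sol c n) t0 [::] A) < 1.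
Hypothesis Hc : forall n, (N1 <= n)%N -> forall b, (0 < b <= B)%N ->
  (\rsum_(v <- near special_len n b) prob f v) ^ t0 <= / INR n ^ 2 ->
  INR (packings [seq [:: v] | v <- near special_len n b] t0 [::] A) < 1.

(** In the first regime the means of forms with fewer than h variables are bounded, so only the
    packing length accumulates. The bound is applied at [special_len n], where the logarithm is an
    iterated one. *)
Lemma log_levels j : (j < h)%N -> exists K, 0 <= K /\ forall n, (N1 <= n)%N ->
  forall c m, admissible B c -> size c = j -> (m <= n)%N -> INR (rep A c m) <= K * INR (lg n) ^ j.
Proof.
elim: j => [_|j IH jh].
  exists 1; split=> [|n nN c m gc /size0nil -> mn]; first lra.
  by rewrite /= Rmult_1_r; exact: rep_nilR.
have [K [K0 HK]] := IH (ltnW jh).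
have KW : 1 <= scale_const h B G by exact: scale_const_ge1.
exists (2 * (scale_const h B G * C1) + INR (4 * h * h) * K); split.
  by apply: Rplus_le_le_0_compat; [nra | apply: Rmult_le_pos => //; exact: pos_INR].
move=> n nN c m gc sc mn; have l1 := lg_ge1 n.
have lj : 1 <= INR (lg n) ^ j by exact: pow_ge1.
have R0 : 0 <= (2 * (scale_const h B G * C1) + INR (4 * h * h) * K) * INR (lg n) ^ j.+1.
  apply: Rmult_le_pos; last by apply: pow_le; lra.
  by apply: Rplus_le_le_0_compat; [nra | apply: Rmult_le_pos => //; exact: pos_INR].
have /andP [cp _] := gc.
case: (posnP m) => [m0|m0]; first by rewrite m0 rep_m0 ?sc.
have mn' : (0 < m <= n)%N by rewrite m0.
apply: Rle_trans (@level_step h B G f h2 Gpos f0 fh A N1 Ha n c m (K * INR (lg n) ^ j) nN gc _ mn' _ _) _.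
- by rewrite sc; lia.
- by apply: Rmult_le_pos; lra.
- by move=> c' m' gc' sc' mn''; apply: HK => //; rewrite sc' sc.
have S : scale h B f c m <= scale_const h B G * C1.
    apply: Rle_trans (@scale_le_pow h B G f h2 Gpos Gmono f0 fh c m (h - 1) m0 _ _) _; [lia | lia |].
    apply: Rmult_le_compat_l; first lra.
    have mp : 0 < INR m by apply: lt_0_INR; lia.
    apply: (Rmult_le_reg_r (INR m)) => //; rewrite /Rdiv Rmult_assoc Rinv_l; last lra.
    by rewrite Rmult_1_r; exact: fC1.
  rewrite -[INR (lg n) ^ j.+1]/(INR (lg n) * INR (lg n) ^ j) Rmult_plus_distr_r.
  apply: Rplus_le_compat; last by right; ring.
  have P1 : 1 <= INR (lg n) * INR (lg n) ^ j by nra.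
  have P2 : 0 <= scale_const h B G * C1 by nra.
  apply: Rle_trans (_ : 2 * (scale_const h B G * C1) * 1 <= _); first lra.
  by apply: Rmult_le_compat_l; lra.
Qed.

(** A power of log log n is O(log n). Raising both sides to the exponent [e] of [special_len]
    reduces this to [lg_pow_le]. *)
Lemma lg_special_len : exists C, 0 <= C /\ forall n, INR (lg (special_len n)) ^ (h - 1) <= C * INR (lg n).
Proof.
pose e := (2 * h * h * (2 * h))%N; have e0 : (0 < e)%N by rewrite /e; nia.
have [C HC] := lg_pow_le ((h - 1) * e).
exists (INR C.+1); split; first exact: pos_INR.
move=> n; have := HC (special_len n); rewrite expn_gt0 lg_gt0 => /(_ isT) H.
have : ((lg (special_len n) ^ (h - 1)) ^ e <= (C.+1 * lg n) ^ e)%N.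
  rewrite -expnM; apply: leq_trans H _; rewrite expnMn leq_mul //.
  by apply: leq_trans (leqnSn C) _; case: (e) e0 => // e' _; rewrite expnS leq_pmulr // expn_gt0.
rewrite leq_exp2r // => /leR_nat; by rewrite INR_expn -multE mult_INR.
Qed.

Lemma count_near_le n b : (N1 <= n)%N -> (0 < b <= B)%N ->
  (\rsum_(v <- near special_len n b) prob f v) ^ t0 <= / INR n ^ 2 -> (count A (near special_len n b) <= t0.+1)%N.
Proof.
move=> nN bB Hs; have := Hc nN bB Hs; set T := [seq _ | v <- _] => H.
have t00 : (0 < t0)%N by rewrite t0E; nia.
have E : edges_in T A = [seq [:: v] | v <- near special_len n b & A v].
  rewrite /edges_in /T filter_map; congr map; apply: eq_filter => v /=; by rewrite !andbT.
have := @edges_in_le T A 1 1 t0 1 t00 ltac:(lra) _ _ _.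
rewrite pow1 mul1n muln1 E size_map size_filter => H'.
apply/leP; apply: INR_le; rewrite S_INR Rplus_comm; apply: H' => //.
- by move=> e /mapP [v _ ->].
- move=> v; rewrite count_map (eq_count (a2 := pred1 v)); last by move=> u; rewrite /= inE eq_sym.
  by rewrite count_uniq_mem ?leq_b1 // !filter_uniq ?iota_uniq.
Qed.

Lemma low_upper bl : admissible B bl -> size bl = h ->
  exists K N, 0 <= K /\ forall n, (N <= n)%N -> low n -> INR (rep A bl n) <= K * G n.
Proof.
move=> gb sb; have /andP [bp bB] := gb.
have [N2 [N12 BF]] := @bounded_forms h B t0 G f h2 Gpos Gmono f0 fh t0E C1 C11 fC1 A N1 Hb.
have [M [M0 HM]] : exists M, 1 <= M /\ forall c m, admissible B c -> (size c <= h)%N -> (m < N2)%N -> INR (rep A c m) <= M.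
  exists (1 + \rsum_(c <- forms B h) \rsum_(m <- iota 0 N2) INR (rep A c m)).
  have ge0 c : 0 <= \rsum_(m <- iota 0 N2) INR (rep A c m) by apply: rsum_ge0 => *; exact: pos_INR.
  split; first by have : 0 <= \rsum_(c <- forms B h) \rsum_(m <- iota 0 N2) INR (rep A c m); [exact: rsum_ge0 | lra].
  move=> c m /andP [cp cB] ch mN.
  have H1 := @term_le_rsum _ (forms B h) predT (fun c => \rsum_(m <- iota 0 N2) INR (rep A c m)) c
    (mem_forms cp cB ch) isT (fun _ _ _ => ge0 _).
  have mI : m \in iota 0 N2 by rewrite mem_iota.
  have H2 := @term_le_rsum _ (iota 0 N2) predT (fun m => INR (rep A c m)) m mI isT (fun _ _ _ => pos_INR _).
  by rewrite /= in H1 H2; lra.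
have [_ BT] := BF A M (fun _ => id) M0 HM.
have h1 : (h - 1 < h)%N by lia.
have [K1 [K10 HK1]] := log_levels h1.
have [C [C0 HC]] := lg_special_len.
have KB := bounded_const_ge1 h t0 (h - 1).
pose R0 := M * bounded_const h t0 (h - 1).
have R00 : 0 <= R0 by rewrite /R0; nra.
have BT' c m : admissible B c -> size c = (h - 1)%N -> thin h G m -> INR (rep A c m) <= R0.
  by move=> gc sc tm; rewrite /R0 -sc; apply: BT => //; [lia | right].
have [N HN] := ev_and near_sum_small (ev_and (ev_lg_pow (2 * h * h * (2 * h)) 1) (ev_and (ev_ge (maxn 1 N1)) (ev_lg (INR N1)))).
pose K := INR (h * h) * R0 / cG + (2 * (weight_const h B h + 1) + INR (h * 3 * h) * R0 / cG) + INR h * (INR t0.+1 * (K1 * C)) / cG.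
exists K, N; split.
  have cw0 := weight_const_ge0 h B h.
  have a1 : 0 <= INR (h * h) * R0 / cG.
    by apply: Rdiv_ge0 => //; apply: Rmult_le_pos => //; exact: pos_INR.
  have a2 : 0 <= INR (h * 3 * h) * R0 / cG.
    by apply: Rdiv_ge0 => //; apply: Rmult_le_pos => //; exact: pos_INR.
  have a3 : 0 <= INR h * (INR t0.+1 * (K1 * C)) / cG.
    apply: Rdiv_ge0 => //; apply: Rmult_le_pos; first exact: pos_INR.
    by apply: Rmult_le_pos; [exact: pos_INR | exact: Rmult_le_pos].
  by rewrite /K; lra.
move=> n /HN [nsum [En [nN lN]]] ln.
have {nN} [n0 nN] : (0 < n)%N /\ (N1 <= n)%N by lia.
have Gn := Gpos n0; have l1 := lg_ge1 n.
have lG : INR (lg n) <= G n / cG.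
  apply: (Rmult_le_reg_r cG) => //; rewrite /Rdiv Rmult_assoc Rinv_l; last lra.
  by have := GcG n0; lra.
have LN : (N1 <= special_len n)%N.
  apply: leq_trans (_ : (lg n <= _)%N); first by apply/leP; apply: INR_le; exact: lN.
  by rewrite -{1}(expn1 (lg n)) leq_pexp2l //; nia.
have Ln : INR (special_len n) <= INR n by rewrite INR_expn; move: En; rewrite Rmult_1_l.
have [R' [R'1 R'2]] := nat_floor R00.
(* Every variable leaves at least [special_len n] to the others, so the forms that bound the degrees
   of such solutions are evaluated at thin numbers and are at most [R0]. *)
pose nonsp (t : seq nat) := all (fun i => special_len n <= n - nth 0%N bl i * nth 0%N t i)%N (iota 0 h).
have split3 : (rep A bl n <= count (fun t => ~~ uniq t) (reps A bl n) +
    count (fun t => uniq t && nonsp t) (reps A bl n) + count (fun t => ~~ nonsp t) (reps A bl n))%N.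
  rewrite /rep; elim: (reps A bl n) => //= t s' IHs; case: (uniq t); case: (nonsp t) => /=; lia.
have H1 : INR (count (fun t => ~~ uniq t) (reps A bl n)) <= INR (h * h) * R0.
  apply: Rle_trans (leR_nat (@count_nonuniq_le A bl n bp R' _)) _.
    move=> i i' ii ib; apply: R'2; apply: BT'; [exact: admissible_merge | rewrite size_merge //; lia |].
    exact: (low_thin n0 ln Ln).
  by rewrite sb -multE mult_INR; apply: Rmult_le_compat_l => //; exact: pos_INR.
have H2 : INR (count (fun t => uniq t && nonsp t) (reps A bl n)) <=
    2 * ((weight_const h B h + 1) * G n) + INR (h * 3 * h) * R0 * INR (lg n).
  have scE : scale h B f bl n = (weight_const h B h + 1) * G n.
    by rewrite /scale sb fh; field; apply: not_0_INR; lia.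
  have := @count_uniq_le A bl n bp nonsp (3 * lg n) (2 * scale h B f bl n) R' isT _ _ _.
  rewrite scE => H; apply: Rle_trans (H _ _ _) _.
  - by have := weight_const_ge0 h B h; nra.
  - move=> i v ib.
    case: (posnP (count (fun t => (nth 0%N t i == v) && nonsp t) (reps A bl n))) => [-> //|].
    rewrite -has_count => /hasP [t _ /andP [/eqP tv /allP nst]].
    have iI : i \in iota 0 h by rewrite mem_iota -sb.
    have := nst i iI; rewrite tv => Lv.
    apply: leq_trans (_ : (count (fun t => nth 0%N t i == v) (reps A bl n) <= _)%N).
      by apply: sub_count => t' /andP [].
    apply: leq_trans (count_nth_le A n bp v ib) _; apply: R'2; apply: BT'.
    + exact: admissible_del.
    + by rewrite size_del // sb; lia.
    by apply: (low_thin n0 ln (leR_nat Lv)); lia.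
  - by rewrite -scE; apply: (Ha nN gb); [rewrite sb | rewrite n0 leqnn].
  apply: Rplus_le_compat_l; rewrite sb.
  have -> : (h * (3 * lg n) * (h * R') = h * 3 * h * R' * lg n)%N by nia.
  rewrite -!multE (mult_INR _ (lg n)) (mult_INR _ R') !multE.
  apply: Rmult_le_compat_r; first lra.
  by apply: Rmult_le_compat_l => //; exact: pos_INR.
(* Some variable takes a value in [near]; at most [t0.+1] such values lie in [A] for each position,
   and each is completed by a form evaluated below [special_len n], hence in O(lg n) ways. *)
have H3 : INR (count (fun t => ~~ nonsp t) (reps A bl n)) <= INR h * (INR t0.+1 * (K1 * C)) * INR (lg n).
  apply: Rle_trans (_ : \rsum_(i <- iota 0 h) \rsum_(v <- near special_len n (nth 0%N bl i) | A v)
      INR (count (fun t => nth 0%N t i == v) (reps A bl n)) <= _).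
    have -> : \rsum_(i <- iota 0 h) \rsum_(v <- near special_len n (nth 0%N bl i) | A v)
        INR (count (fun t => nth 0%N t i == v) (reps A bl n)) =
      INR (\sum_(i <- iota 0 h) \sum_(v <- near special_len n (nth 0%N bl i) | A v)
        count (fun t => nth 0%N t i == v) (reps A bl n)).
      by rewrite INR_sum; apply: eq_bigr => i _; rewrite INR_sum.
    apply: leR_nat.
    under [X in (_ <= X)%N]eq_bigr => i _.
      under eq_bigr => v _ do rewrite count_sum.
      rewrite exchange_big /=; over.
    rewrite exchange_big /= count_sum big_seq [X in (_ <= X)%N]big_seq; apply: leq_sum => t.
    rewrite mem_reps // => /and4P [tA /eqP ts tp /eqP td].
    case: (boolP (nonsp t)) => //= /allPn [i iI]; rewrite -ltnNge => iL.
    have ih : (i < h)%N by move: iI; rewrite mem_iota.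
    have it : (i < size t)%N by rewrite ts sb.
    have vn : nth 0%N t i \in near special_len n (nth 0%N bl i).
      have bi : (0 < nth 0%N bl i)%N by apply: (allP bp _ (mem_nth 0%N _)); rewrite sb.
      have ti : (0 < nth 0%N t i)%N := allP tp _ (mem_nth 0%N it).
      have := @dot_del i bl t; rewrite ts sb => /(_ erefl ih); rewrite td => E.
      by rewrite mem_filter mem_iota; apply/andP; split; [apply/andP; split; lia | nia].
    rewrite (big_rem i iI) /= (big_rem _ vn) /= (allP tA _ (mem_nth 0%N it)) eqxx; lia.
  apply: Rle_trans (_ : \rsum_(i <- iota 0 h) (INR t0.+1 * (K1 * C) * INR (lg n)) <= _); last first.
    by rewrite rsum_const size_iota; right; ring.
  apply: rsum_le => i; rewrite mem_iota => /andP [_ ih] _; rewrite add0n in ih.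
  have ib : (i < size bl)%N by rewrite sb.
  have bi : (0 < nth 0%N bl i <= B)%N.
    have : (0 < nth 0%N bl i)%N := allP bp _ (mem_nth 0%N ib).
    by have := sumn_del ib; lia.
  apply: Rle_trans (_ : \rsum_(v <- near special_len n (nth 0%N bl i) | A v) (K1 * C * INR (lg n)) <= _).
    apply: rsum_le => v; rewrite mem_filter => /andP [/andP [v1 v2] _] _.
    apply: Rle_trans (leR_nat (count_nth_le A n bp v ib)) _.
    apply: Rle_trans (HK1 (special_len n) LN _ _ (admissible_del gb ib) _ _) _.
    + by rewrite size_del // sb; lia.
    + lia.
    rewrite Rmult_assoc; apply: Rmult_le_compat_l => //; exact: HC.
  rewrite -big_filter rsum_const size_filter.
  have -> : INR t0.+1 * (K1 * C) * INR (lg n) = INR t0.+1 * (K1 * C * INR (lg n)) by ring.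
  apply: Rmult_le_compat_r; first by apply: Rmult_le_pos; [exact: Rmult_le_pos | lra].
  apply: leR_nat; apply: (count_near_le nN bi); exact: nsum.
apply: Rle_trans (leR_nat split3) _; rewrite -!plusE !plus_INR.
have S1 : INR (h * h) * R0 <= INR (h * h) * R0 / cG * G n.
  have -> : INR (h * h) * R0 / cG * G n = INR (h * h) * R0 * (G n / cG) by field; lra.
  rewrite -{1}(Rmult_1_r (INR (h * h) * R0)); apply: Rmult_le_compat_l; last lra.
  by apply: Rmult_le_pos => //; exact: pos_INR.
have S2 : INR (h * 3 * h) * R0 * INR (lg n) <= INR (h * 3 * h) * R0 / cG * G n.
  have -> : INR (h * 3 * h) * R0 / cG * G n = INR (h * 3 * h) * R0 * (G n / cG) by field; lra.
  by apply: Rmult_le_compat_l => //; apply: Rmult_le_pos => //; exact: pos_INR.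
have S3 : INR h * (INR t0.+1 * (K1 * C)) * INR (lg n) <= INR h * (INR t0.+1 * (K1 * C)) / cG * G n.
  have -> : INR h * (INR t0.+1 * (K1 * C)) / cG * G n = INR h * (INR t0.+1 * (K1 * C)) * (G n / cG) by field; lra.
  apply: Rmult_le_compat_l => //; apply: Rmult_le_pos; first exact: pos_INR.
  by apply: Rmult_le_pos; [exact: pos_INR | exact: Rmult_le_pos].
rewrite /K !Rmult_plus_distr_r; lra.
Qed.

End LowUpper.

(** * The lower bound *)

Lemma exp_neg_le_inv_sq n x : (0 < n)%N -> 2 * INR (lg n) <= x -> exp (- x) <= / INR n ^ 2.
Proof.
move=> n0 H; have np : 0 < INR n by apply: lt_0_INR; lia.
rewrite exp_Ropp; apply: Rinv_le_contravar; first exact: pow_lt.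
have e1 : 2 <= exp 1 by have := exp_ineq1_le 1; lra.
have H1 : INR n <= exp (INR (lg n)).
  apply: Rle_trans (Rlt_le _ _ (lt_exp_lgR n)) _.
  elim: (lg n) => [|k IH]; first by rewrite /= exp_0; lra.
  by rewrite S_INR exp_plus -[2 ^ k.+1]/(2 * 2 ^ k); have := exp_pos (INR k); nra.
apply: Rle_trans (_ : exp (INR (lg n)) ^ 2 <= _); first by apply: pow_incr; lra.
have -> : exp (INR (lg n)) ^ 2 = exp (2 * INR (lg n)).
  by rewrite /= Rmult_1_r -exp_plus; congr exp; ring.
by case: (Rle_lt_or_eq_dec _ _ H) => [H2|->]; [left; exact: exp_increasing | lra].
Qed.

Section CoreTheorem.
Variables (h b0 : nat) (bs : seq nat) (D : R).
Hypothesis h2 : (2 <= h)%N.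
Hypothesis b00 : (0 < b0)%N.
Hypothesis bsp : all (ltn 0%N) bs.
Hypothesis sbs : size bs = (h - 1)%N.
Hypothesis gcd1 : foldr gcdn b0 bs = 1%N.
Hypothesis D1 : 1 <= D.

Let B := (b0 + sumn bs)%N.
(** The factor 4 keeps [B * window_end Q b0 n] at most n for large n, which leaves room for the last
    variable beyond the window. *)
Let Q := (4 * B * b0)%N.
Let t0 := (8 * h * (h - 1))%N.

(** Loss in comparing f(n) with f(y) for n <= 2Qy: a factor 2Q from n/y, and at most 2Q doublings of
    [G]. *)
Definition Dfac := INR (2 * (4 * (b0 + sumn bs) * b0)) * D ^ (2 * (4 * (b0 + sumn bs) * b0)).
(** The constant for which [pmin n * vr n ^ (h - 1)] equals [lower_const (kap n) * G n]. *)
Definition lower_const kappa := kappa ^ h / INR (8 * (4 * (b0 + sumn bs) * b0)) ^ (h - 1).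
(** Chosen so that G(n) >= Cstar lg n makes the Chernoff exponent at least 2 lg n when the
    coefficients are bounded by [bounded_const]. It depends on h, the coefficients and [D] only, not
    on the size of [G]. *)
Definition Cstar := 8 * bounded_const h (8 * h * (h - 1)) (h - 1) / lower_const (/ Dfac).

Lemma Q_ge : (4 <= Q)%N.
Proof. rewrite /Q /B; nia. Qed.

Lemma Dfac_ge1 : 1 <= Dfac.
Proof.
rewrite /Dfac -/B -/Q; have Q4 := Q_ge.
have H : 1 <= INR (2 * Q) by apply: (@leR_nat 1); lia.
have := pow_ge1 (2 * Q) D1; nra.
Qed.

Lemma lower_const_pos kappa : 0 < kappa -> 0 < lower_const kappa.
Proof.
move=> k0; apply: Rdiv_lt_0_compat; first exact: pow_lt.
by apply: pow_lt; apply: lt_0_INR; have := Q_ge; rewrite /Q /B; lia.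
Qed.

Lemma ev_window N2 : eventually (fun n => [/\ (window_end Q b0 n <= n)%N, (B * window_end Q b0 n <= n)%N, (0 < window_quot Q n)%N,
  (n <= 2 * Q * window_quot Q n)%N & (N2 <= window_quot Q n)%N]).
Proof.
have Q4 := Q_ge.
exists (Q * N2.+1 + Q)%N => n nN.
have E1 : (window_quot Q n * Q <= n)%N by exact: leq_trunc_div.
have E2 : (n < (window_quot Q n).+1 * Q)%N by apply: ltn_ceil; lia.
have E3 : (N2 < window_quot Q n)%N by rewrite /window_quot leq_divRL; nia.
have B1 : (0 < B)%N by rewrite /B; lia.
have E4 : (B * window_end Q b0 n <= n)%N.
  have -> : (B * window_end Q b0 n = B * b0 * (2 * window_quot Q n) + B * b0)%N by rewrite /window_end mulnS; nia.
  have -> : (B * b0 * (2 * window_quot Q n) = 2 * (B * b0) * window_quot Q n)%N by nia.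
  move: E1 nN; rewrite /Q; nia.
split=> //; try nia.
Qed.

Variables (G f : nat -> R).
Hypothesis Gpos : forall n, (0 < n)%N -> 0 < G n.
Hypothesis Gmono : forall m n, (0 < m)%N -> (m <= n)%N -> G m <= G n.
Hypothesis f0 : forall n, 0 <= f n.
Hypothesis fh : forall n, f n ^ h = INR n * G n.
Hypothesis Gdoub : forall n, (0 < n)%N -> G (2 * n)%N <= D * G n.
Variables (c0 Cf : R).
Hypothesis c00 : 0 < c0 <= 1.
Hypothesis Cf1 : 1 <= Cf.
Hypothesis fC : forall n, f n <= Cf * INR n.
Local Notation high n := (high h G c0 n).
Hypothesis regime : (forall n, (0 < n)%N -> high n) \/
  ((exists C1, 1 <= C1 /\ forall n, f n ^ (h - 1) <= C1 * INR n) /\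
   (forall n, (0 < n)%N -> Cstar * INR (lg n) <= G n)).

Lemma Gdoub_iter a n : (0 < n)%N -> G (2 ^ a * n)%N <= D ^ a * G n.
Proof.
move=> n0; elim: a => [|a IH]; first by rewrite mul1n /=; lra.
rewrite expnS -mulnA; apply: Rle_trans (Gdoub _) _; first by rewrite muln_gt0 expn_gt0.
by rewrite -[D ^ a.+1]/(D * D ^ a) Rmult_assoc; apply: Rmult_le_compat_l => //; lra.
Qed.

Lemma f_le_window n y : (0 < y)%N -> (y <= n)%N -> (n <= 2 * Q * y)%N -> f n <= Dfac * f y.
Proof.
move=> y0 yn nQ; have D1' := Dfac_ge1.
apply: (@pow_le_inv h) => //; [lia | by apply: Rmult_le_pos; [lra | exact: f0] |].
rewrite Rpow_mult_distr !fh.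
have G1 : G n <= D ^ (2 * Q) * G y.
  apply: Rle_trans (Gdoub_iter (2 * Q) y0); apply: Gmono; first lia.
  by apply: leq_trans nQ _; rewrite leq_mul2r ltnW ?orbT // ltn_expl.
have n1 : INR n <= INR (2 * Q) * INR y by rewrite -mult_INR multE; apply: leR_nat.
have Gy := Gpos y0; have y1 := pos_INR y.
apply: Rle_trans (_ : Dfac * (INR y * G y) <= _).
  have -> : Dfac * (INR y * G y) = INR (2 * Q) * INR y * (D ^ (2 * Q) * G y) by rewrite /Dfac -/B -/Q; ring.
  by apply: Rmult_le_compat => //; [exact: pos_INR | left; apply: Gpos; lia].
apply: Rmult_le_compat_r; first by nra.
by rewrite -{1}(pow_1 Dfac); apply: pow_mono => //; lia.
Qed.

(** Ratio in the lower bound for [prob f k] with k of order n. Truncation at 1 costs the factor [Cf]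
    only for high n; for low n one has f(n) <= n. The distinction matters because [Cf] changes when
    [G] is multiplied by a constant, and [Cstar] must not. *)
Definition kap n := if excluded_middle_informative (high n) then / (Dfac * Cf) else / Dfac.
Definition pmin n := kap n * (f n / INR n).
(** Lower bound for [theta]: at least n/(2Q) elements in a residue block, each of probability at
    least [pmin n], divided by 4. *)
Definition vr n := kap n * f n / INR (8 * Q).
(** For high n this is the largest coefficient bound for which the failure probability is at most
    n^(-2); the true coefficients are smaller by another factor of order [lg n]. For low n it is the
    bound from [bounded_forms] with [kappa] equal to 1. *)
Definition Dl n := if excluded_middle_informative (high n) then lower_const (kap n) * G n / (8 * INR (lg n))
  else bounded_const h t0 (h - 1).

Lemma kap_bounds n : / (Dfac * Cf) <= kap n /\ 0 < / (Dfac * Cf).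
Proof.
have D1' := Dfac_ge1; split; last by apply: Rinv_0_lt_compat; nra.
rewrite /kap; case: excluded_middle_informative => Hn; first exact: Rle_refl.
by apply: Rinv_le_contravar; nra.
Qed.

Lemma low_f_small : eventually (fun n => ~ high n -> f n <= INR n).
Proof.
have [N HN] := ev_lg_pow (2 * h * h) 1; exists (maxn 1 N) => n; rewrite geq_max => /andP [n0 /HN H] ln.
apply: (@pow_le_inv h); [lia | exact: pos_INR |].
rewrite fh; have n1 : 1 <= INR n by exact: (@leR_nat 1).
have H1 := @low_G h G c0 c00 n ln.
apply: Rle_trans (_ : INR n ^ 2 <= _); last by apply: pow_mono.
by rewrite /= Rmult_1_r; apply: Rmult_le_compat_l; lra.
Qed.

Lemma prob_ge_pmin : eventually (fun n => forall y k, (0 < y <= k)%N -> (k <= n)%N -> (n <= 2 * Q * y)%N ->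
  pmin n <= prob f k).
Proof.
have [N HN] := low_f_small; exists (maxn 1 N) => n; rewrite geq_max => /andP [n0 /HN H] y k /andP [y0 yk] kn nQ.
have D1' := Dfac_ge1; have fn := f_pos h2 Gpos f0 fh n0.
have np : 0 < INR n by apply: lt_0_INR; lia.
have kp : 0 < INR k by apply: lt_0_INR; lia.
pose z := / Dfac * (f n / INR n).
have z0 : 0 <= f n / INR n by apply: Rdiv_ge0; lra.
have zk : z <= f k / INR k.
  have H1 := @f_le_window n y y0 (leq_trans yk kn) nQ.
  have H2 := f_mono h2 Gpos Gmono f0 fh yk.
  have H3 := leR_nat kn.
  apply: (Rmult_le_reg_r (Dfac * INR n * INR k)); first by apply: Rmult_lt_0_compat => //; apply: Rmult_lt_0_compat => //; lra.
  have -> : z * (Dfac * INR n * INR k) = f n * INR k by rewrite /z; field; lra.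
  have -> : f k / INR k * (Dfac * INR n * INR k) = Dfac * f k * INR n by field; lra.
  by apply: Rmult_le_compat; nra.
rewrite /prob; apply: Rmin_glb; rewrite /pmin /kap; case: excluded_middle_informative => Hn.
- have F : f n / INR n <= Cf.
    apply: (Rmult_le_reg_r (INR n)) => //; rewrite /Rdiv Rmult_assoc Rinv_l; last lra.
    by rewrite Rmult_1_r; exact: fC.
  apply: (Rmult_le_reg_l (Dfac * Cf)); first nra.
  rewrite -Rmult_assoc Rinv_r; last nra.
  nra.
- have F : f n / INR n <= 1.
    apply: (Rmult_le_reg_r (INR n)) => //; rewrite /Rdiv Rmult_assoc Rinv_l; last lra.
    by rewrite Rmult_1_r Rmult_1_l; exact: H.
  apply: (Rmult_le_reg_l Dfac); first lra.
  rewrite -Rmult_assoc Rinv_r; last lra.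
  nra.
- apply: Rle_trans zk; rewrite /z; apply: Rmult_le_compat_r => //.
  by apply: Rinv_le_contravar; nra.
exact: zk.
Qed.

Lemma vr_large : eventually (fun n => 2 * INR (lg n) <= vr n).
Proof.
have [_ kp] := kap_bounds 0; set k0 := / (Dfac * Cf) in kp.
have Q4 := Q_ge.
have Qp : 0 < INR (8 * Q) by apply: lt_0_INR; lia.
pose M := 2 * INR (8 * Q) / k0.
have M0 : 0 < M by apply: Rdiv_lt_0_compat; lra.
have G1 := Gpos (ltn0Sn 0).
have [N HN] := ev_lg_pow h (M ^ h / G 1); exists (maxn 1 N) => n; rewrite geq_max => /andP [n0 /HN H].
have [kn _] := kap_bounds n; rewrite -/k0 in kn.
have fM : M * INR (lg n) <= f n.
  apply: (@pow_le_inv h) => //; first lia.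
  rewrite Rpow_mult_distr fh; apply: Rle_trans (_ : INR n * G 1 <= _).
    apply: (Rmult_le_reg_r (/ G 1)); first exact: Rinv_0_lt_compat.
    have -> : INR n * G 1 * / G 1 = INR n by field; lra.
    by apply: Rle_trans H; rewrite /Rdiv; right; ring.
  by apply: Rmult_le_compat_l; [exact: pos_INR | exact: Gmono].
apply: Rle_trans (_ : k0 * (M * INR (lg n)) / INR (8 * Q) <= _).
  by rewrite /M; right; field; lra.
apply: Rmult_le_compat_r; first by left; exact: Rinv_0_lt_compat.
by apply: Rmult_le_compat => //; [lra | apply: Rmult_le_pos; [lra | exact: pos_INR]].
Qed.

Lemma pmin_vr n : (0 < n)%N -> pmin n * vr n ^ (h - 1) = lower_const (kap n) * G n.
Proof.
move=> n0; have np : 0 < INR n by apply: lt_0_INR; lia.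
have Qp : 0 < INR (8 * Q) by apply: lt_0_INR; have := Q_ge; lia.
have P := pow_lt _ (h - 1) Qp.
rewrite /pmin /vr /lower_const -/B -/Q /Rdiv !Rpow_mult_distr pow_inv.
have Eh (x : R) : x * x ^ (h - 1) = x ^ h by rewrite -[LHS]/(x ^ (h - 1).+1); congr pow; lia.
have -> : kap n * (f n * / INR n) * (kap n ^ (h - 1) * f n ^ (h - 1) * / INR (8 * Q) ^ (h - 1)) =
  (kap n * kap n ^ (h - 1)) * (f n * f n ^ (h - 1)) * / INR n * / INR (8 * Q) ^ (h - 1) by ring.
by rewrite !Eh fh; field; lra.
Qed.

Lemma theta_ge n : (forall k, k \in flatten [seq residue_block Q b0 n s | s <- iota 0 b0] -> pmin n <= prob f k) ->
  (0 < n)%N -> (n <= 2 * Q * window_quot Q n)%N -> forall s, (s < b0)%N -> vr n <= theta b0 Q f n s.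
Proof.
move=> H n0 nQ s sb; have np : 0 < INR n by apply: lt_0_INR; lia.
have Qp : 0 < INR Q by apply: lt_0_INR; have := Q_ge; lia.
rewrite /theta; apply: Rle_trans (_ : (\rsum_(k <- residue_block Q b0 n s) pmin n) / 4 <= _).
  rewrite rsum_const size_map size_iota.
  have y1 : INR n / (2 * INR Q) <= INR (window_quot Q n).
    apply: (Rmult_le_reg_r (2 * INR Q)); first lra.
    have -> : INR n / (2 * INR Q) * (2 * INR Q) = INR n by field; lra.
    by apply: Rle_trans (leR_nat nQ) _; rewrite -multE !mult_INR /=; lra.
  have k0 : 0 <= kap n * f n by have [a b] := kap_bounds n; have := f0 n; nra.
  have -> : vr n = INR n / (2 * INR Q) * pmin n / 4.
    by rewrite /vr /pmin -multE mult_INR; have -> : INR 8 = 8 by [rewrite /=; ring]; field; lra.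
  apply: Rmult_le_compat_r; first lra.
  apply: Rmult_le_compat_r => //; rewrite /pmin -Rmult_assoc.
  by apply: Rdiv_ge0.
apply: Rmult_le_compat_r; first lra.
apply: rsum_le => k kb _; apply: H; apply/flatten_mapP; exists s => //.
by rewrite mem_iota.
Qed.

Lemma window_rep_le (A : nat -> bool) n k : (window_rep Q b0 bs n A k <= rep A bs (n - b0 * k))%N.
Proof. by rewrite /window_rep; case: ifP => // _; apply: rep_le_set => i /and3P []. Qed.

Lemma admissible_bs : admissible B bs.
Proof. by rewrite /admissible bsp /B leq_addl. Qed.

Lemma admissible_bl : admissible B (b0 :: bs).
Proof. by rewrite /admissible /= b00 bsp /B leqnn. Qed.

Lemma lower_const_mono x y : 0 < x -> x <= y -> lower_const x <= lower_const y.
Proof.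
move=> x0 xy; apply: Rmult_le_compat_r; last by apply: pow_incr; lra.
left; apply: Rinv_0_lt_compat; apply: pow_lt; apply: lt_0_INR.
by have := Q_ge; rewrite /Q /B; lia.
Qed.

Theorem core_theorem : exists (A : nat -> bool) (c C : R) N, 0 < c /\ forall n, (N <= n)%N ->
  c * G n <= INR (rep A (b0 :: bs) n) <= C * G n.
Proof.
have [A [N1 HA]] := @exists_typical_set h B b0 Q t0 bs G f h2 Gpos Gmono f0 fh (special_len h) Dl
  (fun n => vr n ^ (h - 1)) pmin b00.
have Ha n : (N1 <= n)%N -> forall c m, admissible B c -> (size c <= h)%N -> (0 < m <= n)%N ->
  INR (packings (sol c m) (3 * lg n) [::] A) < (2 * scale h B f c m) ^ (3 * lg n) by case/HA.
have Hb n : (N1 <= n)%N -> forall c, admissible B c -> (size c <= h)%N ->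
  scale h B f c n ^ t0 <= / INR n ^ 2 -> INR (packings (sol c n) t0 [::] A) < 1 by case/HA.
have Hc n : (N1 <= n)%N -> forall b, (0 < b <= B)%N ->
  (\rsum_(v <- near (special_len h) n b) prob f v) ^ t0 <= / INR n ^ 2 ->
  INR (packings [seq [:: v] | v <- near (special_len h) n b] t0 [::] A) < 1 by case/HA.
have sbl : size (b0 :: bs) = h by rewrite /= sbs; lia.
have Q4 := Q_ge.
have lowside : exists Kl N, 0 <= Kl /\ forall n, (N <= n)%N -> ~ high n ->
    [/\ INR (rep A (b0 :: bs) n) <= Kl * G n, forall k, INR (window_rep Q b0 bs n A k) <= Dl n
      & 8 * INR (lg n) * Dl n <= lower_const (kap n) * G n].
  case: regime => [Hh|[[C1 [C11 fC1]] Hstar]].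
    by exists 0, 1%N; split=> [|n n0 ln]; [lra | case: ln; exact: Hh].
  have KB := bounded_const_ge1 h t0 (h - 1).
  have kp : 0 < / Dfac by apply: Rinv_0_lt_compat; have := Dfac_ge1; lra.
  have ckp := lower_const_pos kp.
  have Cs0 : 0 < Cstar by apply: Rdiv_lt_0_compat => //; rewrite -/t0; lra.
  have [Kl [Nl [Kl0 HKl]]] := @low_upper h B t0 G f h2 Gpos Gmono f0 fh erefl C1 c0 Cstar C11 fC1 c00 Cs0 Hstar
    A N1 Ha Hb Hc (b0 :: bs) admissible_bl sbl.
  have [N2 [N12 BF]] := @bounded_forms h B t0 G f h2 Gpos Gmono f0 fh erefl C1 C11 fC1 A N1 Hb.
  have [N HN] := ev_and (ev_window N2) (ev_lg_pow (2 * h * h * (2 * h)) (INR (2 * Q))).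
  exists Kl, (maxn 1 (maxn N Nl)); split=> // n; rewrite !geq_max => /and3P [n0 /HN [[W1 W2 W3 W4 W5] E] nNl] ln.
  have DE : Dl n = bounded_const h t0 (h - 1) by rewrite /Dl; case: excluded_middle_informative.
  have kE : kap n = / Dfac by rewrite /kap; case: excluded_middle_informative.
  split; first exact: HKl.
    move=> k; rewrite DE; set m := (n - b0 * k)%N.
    case: (posnP (window_rep Q b0 bs n A k)) => [-> /=|]; first lra.
    rewrite /window_rep; case: ifP => // bk; rewrite -/m => rp.
    (* All window elements exceed [N2], so below [N2] only the empty form represents anything. Hence
       [kappa] can be 1, and the bound does not depend on [A] or [f]. *)
    have small c m' : admissible B c -> (size c <= h)%N -> (m' < N2)%N -> INR (rep (window Q b0 n A) c m') <= 1.
      case: c => [|a c] gc ch mN; first by rewrite rep_nil; case: (m' == 0)%N => /=; lra.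
      suff -> : rep (window Q b0 n A) (a :: c) m' = 0%N by rewrite /=; lra.
      have /andP [cp _] := gc.
      rewrite (@eq_rep _ (fun=> false)) //.
        by rewrite rep_cons big1 // => i _; rewrite mul0n.
      move=> i /andP [i0 im]; apply/negP => /and3P [H _ _]; nia.
    have [_ BT] := BF (window Q b0 n A) 1 (fun i (H : window Q b0 n A i) => proj2 (andP (proj2 (andP H)))) (Rle_refl 1) small.
    have := BT bs m admissible_bs; rewrite sbs Rmult_1_l; apply.
    - lia.
    (* A solution contains a window element, so [m] is at least of order n, beyond [special_len n],
       and therefore thin. *)
    right; have my : (window_quot Q n <= m)%N.
      case E1: (reps (window Q b0 n A) bs m) rp => [|t s] rp; first by rewrite /rep E1 in rp.
      have : t \in reps (window Q b0 n A) bs m by rewrite E1 mem_head.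
      rewrite mem_filter => /andP [tA tS].
      case: t tA tS {E1} => [|a t] /=; first by rewrite mem_sol // sbs => _ /andP [/eqP /=]; lia.
      move=> /andP [/and3P [a1 _ _] _] tS; have := mem_sol_le bsp tS (mem_head a t); nia.
    apply: (low_thin Gpos Gmono c00 n0 ln); last by rewrite /m; lia.
    apply: Rle_trans (leR_nat my).
    have Qp : 0 < INR (2 * Q) by apply: lt_0_INR; lia.
    apply: (Rmult_le_reg_l (INR (2 * Q))) => //; rewrite INR_expn; apply: Rle_trans E _.
    by rewrite -mult_INR multE; exact: leR_nat.
  rewrite DE kE; have := Hstar n n0; rewrite /Cstar -/t0 => H.
  have := Rmult_le_compat_l _ _ _ (Rlt_le _ _ ckp) H.
  have -> : lower_const (/ Dfac) * (8 * bounded_const h t0 (h - 1) / lower_const (/ Dfac) * INR (lg n)) = 8 * INR (lg n) * bounded_const h t0 (h - 1) by field; lra.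
  by [].
have [Kl [Nl [Kl0 HKl]]] := lowside.
have [Ku [Ku0 HKu]] := @high_upper h B G f h2 Gpos Gmono f0 fh A N1 Ha c0 Cf c00 Cf1 fC.
have h1 : (h - 1 < h)%N by lia.
have [K1 [K10 HK1]] := @high_levels h B G f h2 Gpos Gmono f0 fh A N1 Ha c0 Cf c00 Cf1 fC (h - 1) h1.
have E2 : (h - (h - 1) + 1 = 2)%N by lia.
rewrite E2 in HK1.
have [_ kp] := kap_bounds 0; set k0 := / (Dfac * Cf) in kp.
have ckp := lower_const_pos kp.
have [N HN] := ev_and (ev_window 1) (ev_and prob_ge_pmin (ev_and vr_large (ev_and (ev_lg (8 * K1 / lower_const k0)) (ev_ge (maxn 1 (maxn N1 Nl)))))).
exists A, (lower_const k0 / 4), (Kl + Ku), N; split; first lra.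
move=> n /HN [[W1 W2 W3 W4 W5] [Hpm [Hvr [Hlg]]]]; rewrite !geq_max => /and3P [n0 nN1 nNl].
have Gn := Gpos n0; have l1 := lg_ge1 n; have [kn _] := kap_bounds n; rewrite -/k0 in kn.
have knp : 0 < kap n by lra.
have ckn := lower_const_mono kp kn.
have upper : INR (rep A (b0 :: bs) n) <= (Kl + Ku) * G n.
  case: (classic (high n)) => Hn.
    by have := HKu n nN1 n0 Hn _ admissible_bl sbl; nra.
  by have [H _ _] := HKl n nNl Hn; nra.
split=> //.
have DlP : [/\ 0 < Dl n, forall k, INR (window_rep Q b0 bs n A k) <= Dl n & 8 * INR (lg n) * Dl n <= lower_const (kap n) * G n].
  case: (classic (high n)) => Hn; last first.
    have [_ H1 H2] := HKl n nNl Hn; split=> //.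
    rewrite /Dl; case: excluded_middle_informative => Hn'; first by case: Hn.
    by apply: Rlt_le_trans (bounded_const_ge1 _ _ _); lra.
  have DE : Dl n = lower_const (kap n) * G n / (8 * INR (lg n)) by rewrite /Dl; case: excluded_middle_informative.
  split.
  - by rewrite DE; apply: Rdiv_lt_0_compat; [apply: Rmult_lt_0_compat; lra | lra].
  - move=> k; apply: Rle_trans (leR_nat (window_rep_le A n k)) _.
    apply: Rle_trans (HK1 n nN1 n0 Hn _ _ admissible_bs sbs (leq_subr _ _)) _; rewrite DE.
    apply: (Rmult_le_reg_r (8 * INR (lg n) ^ 2)); first by nra.
    have -> : K1 * (G n / INR (lg n) ^ 2) * (8 * INR (lg n) ^ 2) = 8 * K1 * G n by field; lra.
    have -> : lower_const (kap n) * G n / (8 * INR (lg n)) * (8 * INR (lg n) ^ 2) = lower_const (kap n) * INR (lg n) * G n by field; lra.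
    apply: Rmult_le_compat_r; first lra.
    have := Rmult_le_compat_l _ _ _ (Rlt_le _ _ ckp) Hlg.
    have -> : lower_const k0 * (8 * K1 / lower_const k0) = 8 * K1 by field; lra.
    nra.
  by rewrite DE; right; field; lra.
have [D0 Dw Dlg] := DlP.
have [_ _ _ Hd He] := HA n nN1.
have range_pm k : k \in range b0 Q n -> pmin n <= prob f k.
  rewrite mem_iota => kr; apply: (Hpm (window_quot Q n)) => //; last lia.
  by rewrite W3 /=; apply: leq_trans (_ : (window_end Q b0 n <= _)%N); [rewrite /window_end; nia | lia].
have th s : (s < b0)%N -> vr n <= theta b0 Q f n s.
  apply: theta_ge => // k /flatten_mapP [s']; rewrite mem_iota => sb' kb.
  have sb'' : (s' < b0)%N by lia.
  have := mem_residue_block sb'' kb => kr; apply: (Hpm (window_quot Q n)) => //; last lia.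
  by rewrite W3 /=; nia.
have cnt s : (s < b0)%N -> vr n <= INR (count A (residue_block Q b0 n s)).
  move=> sb; apply: Rle_trans (th s sb) _; left; apply: Hd => //.
  by apply: exp_neg_le_inv_sq => //; exact: Rle_trans Hvr (th s sb).
have vr0 : 0 <= vr n by apply: Rle_trans Hvr; lra.
have [v [v1 v2]] := nat_ceil (vr n).
have [s [ss sb sM]] := residues_exist b00 gcd1 n.
(* The blocks are empty for s >= b0 because [window_mass] asks for uniqueness and range at every
   [s]. *)
have WM := @window_mass (window Q b0 n A) b0 (window_end Q b0 n) v (fun s => if (s < b0)%N then residue_block Q b0 n s else [::]) b00 _ _ _ _ bs s n bsp ss sb sM.
have typ : typical b0 Q bs Dl (fun n => vr n ^ (h - 1)) n A.
  split=> [k _|]; first exact: Dw.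
  apply: Rle_trans (_ : INR v ^ (h - 1) <= _); first by apply: pow_incr.
  rewrite -sbs; apply: Rle_trans (WM _ _ _ _ _) _.
  - by move=> i; case: ifP => // ib; exact: residue_block_uniq.
  - move=> i k; case: ifP => // ib /(mem_residue_block ib) kr; nia.
  - move=> i k ib; rewrite ib => /mapP [q _ ->]; by rewrite mulnC modnMDl modn_small.
  - move=> i ib; rewrite ib; apply: leq_trans (v2 _ (cnt i ib)) _.
    rewrite (@eq_in_count _ (window Q b0 n A) A) // => k /(mem_residue_block ib) /andP [k1 k2].
    by rewrite /window k1 k2.
  - exact: W2.
  right; rewrite big_mkcond; apply: eq_bigr => k _; rewrite /window_rep; by case: ifP.
have pv := pmin_vr n0.
have cond : window_cond b0 Q f Dl (fun n => vr n ^ (h - 1)) pmin n.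
  split=> //.
    by apply: Rmult_le_pos; [lra | apply: Rdiv_ge0 => //; apply: lt_0_INR; lia].
  apply: exp_neg_le_inv_sq => //; rewrite pv.
  apply: (Rmult_le_reg_r (4 * Dl n)); first lra.
  have -> : lower_const (kap n) * G n / (4 * Dl n) * (4 * Dl n) = lower_const (kap n) * G n by field; lra.
  lra.
have := He cond typ; rewrite pv => H.
apply: Rle_trans (rep_ge_window Q bs n A b00); nra.
Qed.

End CoreTheorem.

(** * Counting functions *)

Lemma rprod_indicator (A : nat -> bool) t : \rprod_(k <- t) INR (A k) = INR (all A t).
Proof.
elim: t => [|a t IH]; first by rewrite big_nil.
by rewrite big_cons IH /=; case: (A a) => /=; case: (all A t) => /=; lra.
Qed.

Lemma rep_pweight A c m : INR (rep A c m) = pweight (fun k => INR (A k)) c m.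
Proof.
rewrite /rep /reps size_filter count_sum INR_sum /pweight; apply: eq_bigr => t _.
by rewrite rprod_indicator.
Qed.

Section CountingFunction.
Variables (A : nat -> bool) (c : seq nat) (G : nat -> R) (D c1 C1 : R) (N0 : nat).
Hypothesis cp : all (ltn 0%N) c.
Hypothesis Gpos : forall n, (0 < n)%N -> 0 < G n.
Hypothesis Gmono : forall m n, (0 < m)%N -> (m <= n)%N -> G m <= G n.
Hypothesis D1 : 1 <= D.
Hypothesis Gdoub : forall n, (0 < n)%N -> G (2 * n)%N <= D * G n.
Hypothesis c10 : 0 < c1.
Hypothesis repG : forall n, (N0 <= n)%N -> c1 * G n <= INR (rep A c n) <= C1 * G n.

Let cnt n := count A (iota 1 n).

Lemma cnt_sum n : \rsum_(k <- iota 1 n) INR (A k) = INR (cnt n).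
Proof. by rewrite INR_count. Qed.

(** All representations of numbers up to n use elements of [A] in [1, n], so the power of the
    counting function dominates their total number. *)
Lemma cnt_lower : exists K N, 0 < K /\ forall n, (N <= n)%N -> INR n * G n <= K * INR (cnt n) ^ size c.
Proof.
exists (4 * D ^ 2 / c1), (4 * N0.+1)%N.
have D2 : 0 < D ^ 2 by apply: pow_lt; lra.
split; first by apply: Rdiv_lt_0_compat; lra.
move=> n nN; have n0 : (0 < n)%N by lia.
(* The interval from 2y to n contains at least n/4 integers, all beyond [N0], and n <= 8y bounds
   [G n] by two doublings of [G (2 * y)]. *)
pose y := (n %/ 4)%N.
have y1 : (y * 4 <= n)%N by exact: leq_trunc_div.
have y2 : (n < y.+1 * 4)%N by exact: ltn_ceil.
have Gn := Gpos n0; have Gy : 0 < G y by apply: Gpos; lia.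
have H : G n <= D ^ 2 * G (2 * y)%N.
  have y0 : (0 < 2 * y)%N by lia.
  apply: Rle_trans (_ : G (2 * (2 * (2 * y)))%N <= _); first by apply: Gmono => //; lia.
  apply: Rle_trans (Gdoub _) _; first lia.
  rewrite /= Rmult_1_r Rmult_assoc; apply: Rmult_le_compat_l; first lra.
  exact: Gdoub.
have G2y : 0 < G (2 * y)%N by apply: Gpos; lia.
have M : INR n * (c1 * G (2 * y)%N) <= 4 * INR (cnt n) ^ size c.
  rewrite -cnt_sum; have PM := @pweight_mass (fun k => INR (A k)) (fun k => pos_INR _) c n cp.
  apply: Rle_trans (_ : 4 * (\rsum_(i <- iota 0 n.+1) pweight (fun k => INR (A k)) c i) <= _); last first.
    by apply: Rmult_le_compat_l => //; lra.
  apply: Rle_trans (_ : 4 * (\rsum_(i <- iota (2 * y) (n.+1 - 2 * y)) (c1 * G (2 * y)%N)) <= _).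
    rewrite rsum_const size_iota -[X in _ <= X]Rmult_assoc; apply: Rmult_le_compat_r; first by nra.
    have -> : 4 = INR 4 by rewrite /=; ring.
    by rewrite -mult_INR multE; apply: leR_nat; lia.
  apply: Rmult_le_compat_l; first lra.
  apply: Rle_trans (_ : \rsum_(i <- iota (2 * y) (n.+1 - 2 * y)) INR (rep A c i) <= _).
    apply: rsum_le => i; rewrite mem_iota => /andP [i0 i1] _.
    have [Hr _] := repG (n := i) ltac:(lia); apply: Rle_trans Hr; apply: Rmult_le_compat_l; first lra.
    by apply: Gmono => //; lia.
  under eq_bigr => i _ do rewrite rep_pweight.
  apply: rsum_sub_uniq; first exact: iota_uniq.
    by move=> i; rewrite !mem_iota; lia.
  by move=> i _; rewrite -rep_pweight; exact: pos_INR.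
have np := pos_INR n.
apply: Rle_trans (_ : INR n * (D ^ 2 * G (2 * y)%N) <= _); first by apply: Rmult_le_compat_l.
have -> : INR n * (D ^ 2 * G (2 * y)%N) = D ^ 2 / c1 * (INR n * (c1 * G (2 * y)%N)) by field; lra.
have -> : 4 * D ^ 2 / c1 * INR (cnt n) ^ size c = D ^ 2 / c1 * (4 * INR (cnt n) ^ size c) by field; lra.
apply: Rmult_le_compat_l => //; apply: Rdiv_ge0; lra.
Qed.

Hypothesis c0 : (0 < size c)%N.

Lemma rep_global : exists C, 0 < C /\ forall n, (0 < n)%N -> INR (rep A c n) <= C * G n.
Proof.
have G1 := Gpos (ltn0Sn 0).
pose S := \rsum_(i <- iota 0 N0) INR (rep A c i).
have S0 : 0 <= S by apply: rsum_ge0 => *; exact: pos_INR.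
have [a0 a1] : 0 <= S / G 1 /\ Rmax C1 0 >= 0 by split; [exact: Rdiv_ge0 | apply: Rle_ge; exact: Rmax_r].
exists (Rmax C1 0 + S / G 1 + 1); split; first lra.
move=> n n0; have Gn := Gpos n0; have G1n := Gmono (ltn0Sn 0) n0.
case: (ltnP n N0) => nN.
  have nI : n \in iota 0 N0 by rewrite mem_iota.
  have := @term_le_rsum _ (iota 0 N0) predT (fun i => INR (rep A c i)) n nI isT (fun _ _ _ => pos_INR _).
  rewrite -/S => H; apply: Rle_trans H _.
  have E : S = S / G 1 * G 1 by field; lra.
  rewrite {1}E; apply: Rle_trans (Rmult_le_compat_l _ _ _ a0 G1n) _.
  by apply: Rmult_le_compat_r; lra.
have [_ H] := repG nN; apply: Rle_trans H _; apply: Rmult_le_compat_r; first lra.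
by have := Rmax_l C1 0; lra.
Qed.

(** Every tuple from A in [1, n] represents a number up to [sumn c * n], where [G] is still O(G(n))
    by doubling. *)
Lemma cnt_upper : exists K, 0 < K /\ forall n, (0 < n)%N -> INR (cnt n) ^ size c <= K * (INR n * G n).
Proof.
have [C [C0 HC]] := rep_global.
pose B := sumn c.
have Diter a n : (0 < n)%N -> G (2 ^ a * n)%N <= D ^ a * G n.
  move=> n0; elim: a => [|a IH]; first by rewrite mul1n /=; lra.
  rewrite expnS -mulnA; apply: Rle_trans (Gdoub _) _; first by rewrite muln_gt0 expn_gt0.
  by rewrite -[D ^ a.+1]/(D * D ^ a) Rmult_assoc; apply: Rmult_le_compat_l => //; lra.
have B0 : (0 < B)%N by rewrite /B; case: (c) cp c0 => //= a l /andP [a0 _] _; lia.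
have Bp : 0 < INR B by apply: lt_0_INR; lia.
have DB : 0 < D ^ B by apply: pow_lt; lra.
exists (INR B * (C * D ^ B)); split; first by apply: Rmult_lt_0_compat => //; apply: Rmult_lt_0_compat.
move=> n n0; rewrite -cnt_sum.
apply: Rle_trans (@pweight_mass_ge (fun k => INR (A k)) (fun k => pos_INR _) c n cp) _; rewrite -/B.
have -> : \rsum_(i <- iota 0 (B * n).+1) pweight (fun k => INR (A k)) c i =
    \rsum_(i <- iota 1 (B * n)) INR (rep A c i).
  rewrite /= big_cons -rep_pweight rep_m0 //= Rplus_0_l.
  by apply: eq_bigr => i _; rewrite rep_pweight.
apply: Rle_trans (_ : \rsum_(i <- iota 1 (B * n)) (C * (D ^ B * G n)) <= _).
  apply: rsum_le => i; rewrite mem_iota => /andP [i0 iB] _.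
  apply: Rle_trans (HC i i0) _; apply: Rmult_le_compat_l; first lra.
  apply: Rle_trans (Diter B n n0); apply: Gmono => //.
  have := ltn_expl B (isT : (1 < 2)%N); nia.
by rewrite rsum_const size_iota -multE mult_INR; right; ring.
Qed.

End CountingFunction.

(** * Agreement with the counting functions of the statement *)

Lemma dot_map (I : Type) (s : seq I) (g k : I -> nat) :
  dot [seq g i | i <- s] [seq k i | i <- s] = (\sum_(i <- s) g i * k i)%N.
Proof. by elim: s => [|a s IH] /=; rewrite ?big_nil // big_cons IH. Qed.

(** [r_A] admits zero entries and [rep] does not; the two agree once 0 is outside [A]. *)
Lemma r_A_rep (b : nat -> nat) (A : nat -> bool) h n :
  (forall i, (i < h)%N -> (0 < b i)%N) -> A 0%N = false ->
  r_A b A h n = rep A [seq b i | i <- iota 0 h] n.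
Proof.
move=> bp A0; set bl := [seq b i | i <- iota 0 h].
have blp : all (ltn 0%N) bl by apply/allP => x /mapP [i]; rewrite mem_iota => /andP [_ ih] ->; exact: bp.
have blE : bl = [seq b (val i) | i <- enum 'I_h] by rewrite /bl -val_enum_ord -map_comp.
have sbl : size bl = h by rewrite size_map size_iota.
pose g (k : {ffun 'I_h -> 'I_n.+1}) := [seq nat_of_ord (k i) | i <- enum 'I_h].
rewrite /r_A cardE /rep -(size_map g); apply: perm_size; apply: uniq_perm.
- rewrite map_inj_uniq ?enum_uniq // => k k' E; apply/ffunP => i; apply/val_inj.
  have := congr1 (fun s => nth 0%N s (index i (enum 'I_h))) E; rewrite /g /=.
  have iI : (index i (enum 'I_h) < size (enum 'I_h))%N by rewrite index_mem mem_enum.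
  by rewrite (nth_map i _ _ iI) (nth_map i _ _ iI) nth_index ?mem_enum.
- exact: reps_uniq.
move=> t; apply/mapP/idP => [[k]|].
  rewrite mem_enum inE => /andP [/forallP kA /eqP kn] ->.
  rewrite mem_reps // size_map size_enum_ord sbl eqxx /=.
  have -> : dot bl (g k) = n.
    by rewrite blE /g dot_map -[RHS]kn big_enum.
  rewrite eqxx andbT; apply/andP; split; apply/allP => x /mapP [i _ ->]; first exact: kA.
  by have := kA i; case: (nat_of_ord (k i)) => //; rewrite A0.
rewrite mem_reps // sbl => /and4P [tA /eqP ts tp /eqP td].
have tn i : (i < h)%N -> (nth 0%N t i <= n)%N.
  move=> ih; apply: (mem_sol_le (c := bl) (t := t)) => //; last by apply: mem_nth; rewrite ts.
  by rewrite mem_sol // ts sbl eqxx tp td eqxx.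
pose k := [ffun i : 'I_h => (inord (nth 0%N t i) : 'I_n.+1)].
have kE (i : 'I_h) : nat_of_ord (k i) = nth 0%N t i by rewrite ffunE inordK // ltnS tn.
have gk : g k = t.
  apply: (@eq_from_nth _ 0%N); first by rewrite size_map size_enum_ord.
  move=> i; rewrite size_map size_enum_ord => ih.
  by rewrite (nth_map (Ordinal ih)) ?size_enum_ord // kE nth_enum_ord.
exists k => //; rewrite mem_enum inE; apply/andP; split.
  by apply/forallP => i; rewrite kE; apply: (allP tA); apply: mem_nth; rewrite ts.
by apply/eqP; rewrite -[RHS]td -[X in dot _ X]gk blE /g dot_map big_enum.
Qed.

Lemma count_upto_count (A : nat -> bool) N : count_upto A N = count A (iota 1 N).
Proof.
rewrite /count_upto cardE -(size_map val) -size_filter; apply: perm_size; apply: uniq_perm.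
- by rewrite map_inj_uniq ?enum_uniq //; exact: val_inj.
- by rewrite filter_uniq ?iota_uniq.
move=> k; rewrite mem_filter mem_iota; apply/mapP/idP => [[i]|/andP [Ak /andP [k1 k2]]].
  by rewrite mem_enum inE => /andP [Ai i0] ->; rewrite Ai i0 add1n ltn_ord.
have kN : (k < N.+1)%N by lia.
by exists (Ordinal kN) => //; rewrite mem_enum inE Ak.
Qed.

(** * Real-variable form *)

Lemma Rpower_root x h : 0 < x -> (0 < h)%N -> Rpower x (/ INR h) ^ h = x.
Proof.
move=> x0 h0; have hp : 0 < INR h by apply: lt_0_INR; lia.
rewrite -Rpower_pow; last exact: exp_pos.
by rewrite Rpower_mult Rinv_l ?Rpower_1 //; lra.
Qed.

Lemma pow_pred x n : (0 < n)%N -> x ^ n = x * x ^ (n - 1).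
Proof. by case: n => // n _; rewrite subn1. Qed.

Lemma pow_ge_self x n : 1 <= x -> (0 < n)%N -> x <= x ^ n.
Proof. by move=> x1 n0; rewrite -{1}(pow_1 x); apply: pow_mono. Qed.

Section NaturalVersion.
Variables (h b0 : nat) (bs : seq nat) (F : nat -> R) (D : R).
Hypothesis h2 : (2 <= h)%N.
Hypothesis b00 : (0 < b0)%N.
Hypothesis bsp : all (ltn 0%N) bs.
Hypothesis sbs : size bs = (h - 1)%N.
Hypothesis gcd1 : foldr gcdn b0 bs = 1%N.
Hypothesis D1 : 1 <= D.
Hypothesis Fpos : forall n, (0 < n)%N -> 0 < F n.
Hypothesis Fmono : forall m n, (0 < m)%N -> (m <= n)%N -> F m <= F n.
Hypothesis Fdoub : forall n, (0 < n)%N -> F (2 * n)%N <= D * F n.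
Hypothesis growth :
  ((exists C, forall n, (0 < n)%N -> INR (lg n) <= C * F n) /\
   (exists C, forall n, (0 < n)%N -> F n ^ (h - 1) <= C * INR n)) \/
  ((exists C, forall n, (0 < n)%N -> INR (lg n) ^ (2 * h * h) <= C * F n) /\
   (exists C, forall n, (0 < n)%N -> F n <= C * INR n ^ (h - 1))).

Lemma exists_set_nat : exists (A : nat -> bool) (c C : R) N, 0 < c /\ forall n, (N <= n)%N ->
  c * F n <= INR (rep A (b0 :: bs) n) <= C * F n.
Proof.
suff [M [c0 [Cf [M1 [c00 [Cf1 H]]]]]] : exists M c0 Cf, 1 <= M /\ 0 < c0 <= 1 /\ 1 <= Cf /\
   forall f, (forall n, 0 <= f n) -> (forall n, f n ^ h = INR n * (M * F n)) ->
   (forall n, f n <= Cf * INR n) /\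
   ((forall n, (0 < n)%N -> high h (fun n => M * F n) c0 n) \/
    ((exists C1, 1 <= C1 /\ forall n, f n ^ (h - 1) <= C1 * INR n) /\
   (forall n, (0 < n)%N -> Cstar h b0 bs D * INR (lg n) <= M * F n))).
  pose f n := if n is 0%N then 0 else Rpower (INR n * (M * F n)) (/ INR h).
  have h0 : (0 < h)%N by lia.
  have f0 n : 0 <= f n by case: n => [|n] /=; [lra | left; exact: exp_pos].
  have fh n : f n ^ h = INR n * (M * F n).
    case: n => [|n]; first by rewrite /= Rmult_0_l pow_i //; lia.
    rewrite /f Rpower_root //; apply: Rmult_lt_0_compat; first by apply: lt_0_INR; lia.
    by apply: Rmult_lt_0_compat; [lra | exact: Fpos].
  have [fC reg] := H f f0 fh.
  have [|m n|n|A [c [C [N [cp HA]]]]] := @core_theorem h b0 bs D h2 b00 bsp sbs gcd1 D1 (fun n => M * F n) f _ _ f0 fh _ c0 Cf c00 Cf1 fC reg.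
  - by move=> n n0; apply: Rmult_lt_0_compat; [lra | exact: Fpos].
  - by move=> m0 mn; apply: Rmult_le_compat_l; [lra | exact: Fmono].
  - by move=> n0; have := Fdoub n0; nra.
  exists A, (c * M), (C * M), N; split; first by nra.
  by move=> n /HA; rewrite !Rmult_assoc.
have F1 := Fpos (ltn0Sn 0).
case: growth => [[[CL HL] [CU HU]]|[[CL HL] [CU HU]]].
- set Cs := Cstar h b0 bs D.
  (* The multiplier lifts F above Cs lg n. The choice is not circular: [M * F] has the same doubling
     constant [D] as F, so [Cs] does not change. *)
  pose M := Rmax 1 (Rmax Cs 0 * Rmax CL 0).
  have M1 : 1 <= M by exact: Rmax_l.
  have M2 : Rmax Cs 0 * Rmax CL 0 <= M by exact: Rmax_r.
  pose C1 := Rmax 1 (M ^ (h - 1) * CU).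
  have C11 : 1 <= C1 by exact: Rmax_l.
  exists M, 1, C1; split=> //; split; first lra; split=> // f f0 fh.
  have fC1 n : f n ^ (h - 1) <= C1 * INR n.
    case: (posnP n) => [->|n0].
      have -> : f 0%N = 0.
        case: (Rle_lt_or_eq_dec _ _ (f0 0%N)) => // E; have := pow_lt _ h E; rewrite fh /=; lra.
      by rewrite pow_i /=; [lra | lia].
    have np := pos_INR n; have M0 : 0 <= M ^ (h - 1) by apply: pow_le; lra.
    apply: (@pow_le_inv h) => //; [lia | apply: Rmult_le_pos; lra |].
    rewrite -pow_muln mulnC pow_muln fh !Rpow_mult_distr.
    apply: Rle_trans (_ : INR n ^ (h - 1) * (M ^ (h - 1) * (CU * INR n)) <= _).
      apply: Rmult_le_compat_l; first exact: pow_le.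
      by apply: Rmult_le_compat_l => //; exact: HU.
    have -> : INR n ^ (h - 1) * (M ^ (h - 1) * (CU * INR n)) = M ^ (h - 1) * CU * INR n ^ h.
      by rewrite (@pow_pred (INR n) h); [ring | lia].
    apply: Rmult_le_compat_r; first exact: pow_le.
    apply: Rle_trans (Rmax_r 1 _) _; apply: pow_ge_self => //; lia.
  split.
    move=> n; case: (posnP n) => [n0|n0].
      have := fC1 n; rewrite n0 /= Rmult_0_r => H.
      case: (Rle_lt_or_eq_dec _ _ (f0 0%N)) => [E|<-]; last lra.
      by have := pow_lt _ (h - 1) E; lra.
    have n1 : 1 <= INR n by exact: (@leR_nat 1).
    case: (Rle_dec 1 (f n)) => f1; last by nra.
    by apply: Rle_trans (fC1 n); apply: pow_ge_self => //; lia.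
  right; split; first by exists C1.
  move=> n n0; have Fn := Fpos n0; have l1 := lg_ge1 n.
  apply: Rle_trans (_ : Rmax Cs 0 * (Rmax CL 0 * F n) <= _).
    apply: Rle_trans (_ : Rmax Cs 0 * INR (lg n) <= _).
      by apply: Rmult_le_compat_r; [lra | exact: Rmax_l].
    apply: Rmult_le_compat_l; first exact: Rmax_r.
    apply: Rle_trans (HL n n0) _; apply: Rmult_le_compat_r; [lra | exact: Rmax_l].
  by rewrite -Rmult_assoc; apply: Rmult_le_compat_r; lra.
pose CL' := Rmax 1 CL.
have CL1 : 1 <= CL' by exact: Rmax_l.
pose Cf := Rmax 1 CU.
have Cf1 : 1 <= Cf by exact: Rmax_l.
exists 1, (/ CL'), Cf; split; first lra; split.
  split; first by apply: Rinv_0_lt_compat; lra.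
  by rewrite -Rinv_1; apply: Rinv_le_contravar; lra.
split=> // f f0 fh; split.
  move=> n; have np := pos_INR n; apply: (@pow_le_inv h); [lia | by apply: Rmult_le_pos; lra |].
  rewrite fh Rmult_1_l Rpow_mult_distr.
  case: (posnP n) => [->|n0].
    by rewrite [INR 0]/= Rmult_0_l; apply: Rmult_le_pos; apply: pow_le; lra.
  apply: Rle_trans (_ : INR n * (CU * INR n ^ (h - 1)) <= _).
    by apply: Rmult_le_compat_l => //; exact: HU.
  have -> : INR n * (CU * INR n ^ (h - 1)) = CU * INR n ^ h.
    by rewrite (@pow_pred (INR n) h); [ring | lia].
  apply: Rmult_le_compat_r; first exact: pow_le.
  by apply: Rle_trans (Rmax_r 1 _) _; apply: pow_ge_self => //; lia.
left=> n n0; rewrite /high Rmult_1_l.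
apply: (Rmult_le_reg_l CL'); first lra.
rewrite -Rmult_assoc Rinv_r ?Rmult_1_l; last lra.
apply: Rle_trans (HL n n0) _; apply: Rmult_le_compat_r; [left; exact: Fpos | exact: Rmax_r].
Qed.

End NaturalVersion.

Lemma lg_le_ln n : (0 < n)%N -> INR (lg n) <= 1 + 2 * ln (INR n).
Proof.
move=> n0; have np : 0 < INR n by apply: lt_0_INR; lia.
have H : 2 ^ (lg n).-1 <= INR n.
  by have := leR_nat (trunc_logP (isT : (1 < 2)%N) n0); rewrite INR_expn.
have l2 : / 2 <= ln 2 by have := ln_lt_2; lra.
have : ln (2 ^ (lg n).-1) <= ln (INR n).
  case: (Rle_lt_or_eq_dec _ _ H) => [H'|->]; last lra.
  by left; apply: ln_increasing => //; apply: pow_lt; lra.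
rewrite ln_pow; last lra.
have -> : INR (lg n) = INR (lg n).-1 + 1 by rewrite -S_INR.
have := pos_INR (lg n).-1; nra.
Qed.

Lemma nat_above (X : R) : exists N, (1 < N)%N /\ X <= INR N.
Proof.
have [k Hk] := INR_unbounded X; exists k.+2; split=> //.
by rewrite !S_INR; lra.
Qed.

(** Finitely many exceptional n are absorbed into the constant because [v] is bounded away from
    0. *)
Lemma globalize (u v : nat -> R) N C a : 0 < a -> (forall n, (0 < n)%N -> a <= v n) ->
  (forall n, (N <= n)%N -> (0 < n)%N -> u n <= C * v n) ->
  exists C', forall n, (0 < n)%N -> u n <= C' * v n.
Proof.
move=> a0 va H; pose S := \rsum_(i <- iota 0 N) Rabs (u i).
have S0 : 0 <= S by apply: rsum_ge0 => *; exact: Rabs_pos.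
exists (Rmax C 0 + S / a) => n n0; have vn := va n n0.
have Sa : 0 <= S / a by exact: Rdiv_ge0.
have m0 := Rmax_r C 0; have m1 := Rmax_l C 0.
case: (ltnP n N) => nN.
  have nI : n \in iota 0 N by rewrite mem_iota.
  have := @term_le_rsum _ (iota 0 N) predT (fun i => Rabs (u i)) n nI isT (fun _ _ _ => Rabs_pos _).
  rewrite -/S => H1; have := Rle_abs (u n) => H2.
  have E : S = S / a * a by field; lra.
  apply: Rle_trans (_ : S / a * v n <= _); first by rewrite E in H1; nra.
  by apply: Rmult_le_compat_r; lra.
by apply: Rle_trans (H n nN n0) _; apply: Rmult_le_compat_r; lra.
Qed.

Lemma nat_of_Int_part x : 0 <= x ->
  INR (Z.to_nat (Int_part x)) <= x < INR (Z.to_nat (Int_part x)) + 1.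
Proof.
move=> x0; have [H1 H2] := base_Int_part x.
have I0 : (0 <= Int_part x)%Z.
  suff : (-1 < Int_part x)%Z by lia.
  by apply: lt_IZR; rewrite /=; lra.
by rewrite INR_IZR_INZ Z2Nat.id //; lra.
Qed.

Lemma main_theorem (h : nat) (b : nat -> nat) (F : R -> R) :
  (2 <= h)%N -> (forall i, (i < h)%N -> (0 < b i)%N) -> gcd_coeffs h b = 1%N ->
  (forall x, 1 <= x -> 0 < F x) -> (forall x y, 1 <= x -> x <= y -> F x <= F y) ->
  bigO (fun x => F (2 * x)) F ->
  (bigO ln F /\ bigO F (fun x => Rpower x (/ INR (h - 1)))) \/
  (bigO (fun x => ln x ^ (2 * h * h)) F /\ bigO F (fun x => x ^ (h - 1))) ->
  exists A : nat -> bool,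
    asymp (fun x => INR (count_real A x)) (fun x => Rpower (x * F x) (/ INR h)) /\
    asymp_nat (fun n => INR (r_A b A h n)) (fun n => F (INR n)).
Proof.
move=> h2 bp gcd1 Fpos Fmono [Cd [Cd0 [Xd Hd]]] growth.
pose Fn n := F (INR n).
have n1 n : (0 < n)%N -> 1 <= INR n by move=> n0; exact: (@leR_nat 1).
have F1 : 0 < F 1 by apply: Fpos; lra.
have FF1 x : 1 <= x -> F 1 <= F x by move=> x1; apply: Fmono; lra.
have absF x : 1 <= x -> Rabs (F x) = F x by move=> x1; apply: Rabs_pos_eq; left; exact: Fpos.
(* Monotonicity extends the doubling bound to all x >= 1: below [X], F(2x) is at most F(2X), and
   F(x) is at least F(1). *)
have [D [D1 HD]] : exists D, 1 <= D /\ forall x, 1 <= x -> F (2 * x) <= D * F x.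
  pose X := Rmax 1 Xd; have X1 : 1 <= X by exact: Rmax_l.
  have FX : 0 < F (2 * X) by apply: Fpos; lra.
  have q0 : 0 < F (2 * X) / F 1 by exact: Rdiv_lt_0_compat.
  exists (1 + Cd + F (2 * X) / F 1); split; first lra.
  move=> x x1; have Fx := Fpos x x1.
  case: (Rle_dec Xd x) => Hx.
    have := Hd x Hx; rewrite absF; last lra.
    by move=> H; apply: Rle_trans H _; apply: Rmult_le_compat_r; lra.
  apply: Rle_trans (_ : F (2 * X) <= _); first by apply: Fmono; have := Rmax_r 1 Xd; rewrite -/X; lra.
  apply: Rle_trans (_ : F (2 * X) / F 1 * F x <= _); last by apply: Rmult_le_compat_r; lra.
  have {1}-> : F (2 * X) = F (2 * X) / F 1 * F 1 by field; lra.
  by apply: Rmult_le_compat_l; [lra | exact: FF1].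
have Fnpos n : (0 < n)%N -> 0 < Fn n by move=> n0; apply: Fpos; exact: n1.
have Fnmono m n : (0 < m)%N -> (m <= n)%N -> Fn m <= Fn n.
  by move=> m0 mn; apply: Fmono; [exact: n1 | exact: leR_nat].
have Fndoub n : (0 < n)%N -> Fn (2 * n)%N <= D * Fn n.
  by move=> n0; rewrite /Fn -multE mult_INR; apply: HD; exact: n1.
have Fn1 n : (0 < n)%N -> F 1 <= Fn n by move=> n0; apply: FF1; exact: n1.
have growth' : ((exists C, forall n, (0 < n)%N -> INR (lg n) <= C * Fn n) /\
   (exists C, forall n, (0 < n)%N -> Fn n ^ (h - 1) <= C * INR n)) \/
  ((exists C, forall n, (0 < n)%N -> INR (lg n) ^ (2 * h * h) <= C * Fn n) /\
   (exists C, forall n, (0 < n)%N -> Fn n <= C * INR n ^ (h - 1))).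
  case: growth => [[[CL [CL0 [XL HL]]] [CU [CU0 [XU HU]]]]|[[CL [CL0 [XL HL]]] [CU [CU0 [XU HU]]]]]; [left|right].
  - have [NL [NL1 NLX]] := nat_above XL; have [NU [NU1 NUX]] := nat_above XU.
    split.
      apply: (@globalize _ _ NL (/ F 1 + 2 * CL) (F 1)) => // n nN n0.
      have := HL (INR n) (Rle_trans _ _ _ NLX (leR_nat nN)); have := Rle_abs (ln (INR n)).
      have := lg_le_ln n0; have := Fn1 n n0; rewrite -/(Fn n) => a1 a2 a3 a4.
      have : 1 <= / F 1 * Fn n.
        apply: (Rmult_le_reg_l (F 1)) => //.
        by rewrite -Rmult_assoc Rinv_r; lra.
      by lra.
    apply: (@globalize _ _ NU (CU ^ (h - 1)) 1) => [|n n0|n nN n0]; [lra | exact: n1 |].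
    have np : 0 < INR n by have := n1 n n0; lra.
    have := HU (INR n) (Rle_trans _ _ _ NUX (leR_nat nN)); rewrite absF; last exact: n1.
    move=> H; apply: Rle_trans (pow_incr _ _ (h - 1) (conj (Rlt_le _ _ (Fnpos n n0)) H)) _.
    by rewrite Rpow_mult_distr Rpower_root //; [lra | lia].
  - have [NL [NL1 NLX]] := nat_above XL; have [NU [NU1 NUX]] := nat_above XU.
    split.
      apply: (@globalize _ _ NL (4 ^ (2 * h * h) * CL) (F 1)) => // n nN n0.
      have := HL (INR n) (Rle_trans _ _ _ NLX (leR_nat nN)).
      have l2 : / 2 <= ln (INR n).
        apply: Rle_trans (_ : ln 2 <= _); first by have := ln_lt_2; lra.
        have : 2 <= INR n by apply: (@leR_nat 2); lia.
        case/Rle_lt_or_eq_dec => [H|<-]; last lra.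
        by left; apply: ln_increasing; lra.
      have l4 : INR (lg n) <= 4 * ln (INR n) by have := lg_le_ln n0; lra.
      move=> H; apply: Rle_trans (pow_incr _ _ (2 * h * h) (conj (pos_INR _) l4)) _.
      rewrite Rpow_mult_distr Rmult_assoc; apply: Rmult_le_compat_l; first by apply: pow_le; lra.
      exact: Rle_trans (Rle_abs _) H.
    apply: (@globalize _ _ NU CU 1) => [|n n0|n nN n0]; [lra | apply: pow_ge1; exact: n1 |].
    have := HU (INR n) (Rle_trans _ _ _ NUX (leR_nat nN)); rewrite absF; last exact: n1.
    by [].
pose bs := [seq b i | i <- iota 1 (h - 1)].
have blE : [seq b i | i <- iota 0 h] = b 0%N :: bs by rewrite /bs; case: (h) h2 => // h' _; rewrite subn1.
have b00 : (0 < b 0%N)%N by apply: bp; lia.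
have bsp : all (ltn 0%N) bs.
  by apply/allP => x /mapP [i]; rewrite mem_iota => ih ->; apply: bp; lia.
have sbs : size bs = (h - 1)%N by rewrite size_map size_iota.
have gcdbs : foldr gcdn (b 0%N) bs = 1%N.
  have dv x : x \in b 0%N :: bs -> (foldr gcdn (b 0%N) bs %| x)%N.
    elim: (bs) x => [|a l IH] x /=; first by rewrite inE => /eqP ->.
    rewrite !inE => /or3P [/eqP ->|/eqP ->|xl].
    - by apply: dvdn_trans (dvdn_gcdr _ _) _; apply: IH; rewrite inE eqxx.
    - exact: dvdn_gcdl.
    by apply: dvdn_trans (dvdn_gcdr _ _) _; apply: IH; rewrite inE xl orbT.
  apply/eqP; rewrite -dvdn1 -gcd1 /gcd_coeffs.
  elim/big_rec: _ => [|i x _ IH]; first exact: dvdn0.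
  rewrite dvdn_gcd IH andbT; apply: dv; rewrite -blE; apply/mapP; exists (nat_of_ord i) => //.
  by rewrite mem_iota /= add0n.
have [A0 [c [C [N [cp HA]]]]] := @exists_set_nat h (b 0%N) bs Fn D h2 b00 bsp sbs gcdbs D1 Fnpos Fnmono Fndoub growth'.
(* Removing 0 leaves [rep] unchanged, since its entries are positive, and makes [r_A] agree with
   it. *)
pose A k := (0 < k)%N && A0 k.
have blp : all (ltn 0%N) (b 0%N :: bs) by rewrite /= b00.
have repE n : rep A (b 0%N :: bs) n = rep A0 (b 0%N :: bs) n.
  by apply: eq_rep => // k /andP [k0 _]; rewrite /A k0.
have sbl : size (b 0%N :: bs) = h by rewrite /= sbs; lia.
have HA' n : (N <= n)%N -> c * Fn n <= INR (rep A (b 0%N :: bs) n) <= C * Fn n by rewrite repE; exact: HA.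
have rE n : r_A b A h n = rep A (b 0%N :: bs) n by rewrite r_A_rep // blE.
exists A; split; last first.
  split.
    exists (Rmax C 1); split; first by have := Rmax_r C 1; lra.
    exists (maxn 1 N) => n nN; rewrite Rabs_pos_eq; last exact: pos_INR.
    have [n0 nN'] : (0 < n)%N /\ (N <= n)%N by move/leP: nN; lia.
    rewrite rE; have [_ H] := HA' n nN'; apply: Rle_trans H _.
    by apply: Rmult_le_compat_r; [left; exact: Fnpos | exact: Rmax_l].
  exists (/ c); split; first exact: Rinv_0_lt_compat.
  exists (maxn 1 N) => n nN.
  have [n0 nN'] : (0 < n)%N /\ (N <= n)%N by move/leP: nN; lia.
  rewrite absF; last exact: n1.
  rewrite rE; have [H _] := HA' n nN'.
  apply: (Rmult_le_reg_l c) => //; rewrite -Rmult_assoc Rinv_r; last lra.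
  by rewrite Rmult_1_l.
have szl : (0 < size (b 0%N :: bs))%N by [].
have [K1 [K10 HK1]] := @cnt_upper A (b 0%N :: bs) Fn D c C N blp Fnpos Fnmono D1 Fndoub HA' szl.
have [K2 [N2 [K20 HK2]]] := @cnt_lower A (b 0%N :: bs) Fn D c C N blp Fnpos Fnmono D1 Fndoub cp HA'.
rewrite sbl in HK1 HK2.
have h0 : (0 < h)%N by lia.
have hR : 0 < INR h by apply: lt_0_INR; lia.
pose fl x := Z.to_nat (Int_part x).
have cntE x : count_real A x = count A (iota 1 (fl x)) by rewrite /count_real count_upto_count.
have big x : INR N2 + 2 <= x -> [/\ 1 <= x, (0 < fl x)%N, (N2 <= fl x)%N, INR (fl x) <= x & x <= 2 * INR (fl x)].
  move=> xN; have N20 := pos_INR N2; have x0 : 0 <= x by lra.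
  have [f1 f2] := nat_of_Int_part x0; rewrite -/(fl x) in f1 f2.
  have : (N2.+1 <= fl x)%N by apply/leP; apply: INR_le; rewrite S_INR; lra.
  move=> H; have : 1 <= INR (fl x) by apply: (@leR_nat 1); lia.
  by move=> H1; split; lra || lia.
(* Passing from x to its integer part costs a factor 2 in x and one doubling of F. *)
have sandwich x : INR N2 + 2 <= x ->
    0 < x * F x /\ INR (fl x) * Fn (fl x) <= x * F x /\ x * F x <= 2 * D * (INR (fl x) * Fn (fl x)).
  move=> /big [x1 f0 _ f1 f2]; have Fx := Fpos x x1; have Ff := Fnpos _ f0; have fp := pos_INR (fl x).
  have g1 := n1 _ f0; split; first by nra.
  have m1 : Fn (fl x) <= F x by apply: Fmono.
  split; first by apply: Rmult_le_compat; lra.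
  have m2 : F x <= D * Fn (fl x) by apply: Rle_trans (HD _ g1); apply: Fmono; lra.
  have -> : 2 * D * (INR (fl x) * Fn (fl x)) = (2 * INR (fl x)) * (D * Fn (fl x)) by ring.
  by apply: Rmult_le_compat; lra.
split.
  exists (Rmax 1 K1); split; first by have := Rmax_l 1 K1; lra.
  exists (INR N2 + 2) => x xN; have [x1 f0 fN f1 f2] := big x xN; have [P [S1 S2]] := sandwich x xN.
  have m1 := Rmax_l 1 K1.
  rewrite Rabs_pos_eq; last exact: pos_INR.
  apply: (@pow_le_inv h) => //; first by apply: Rmult_le_pos; [lra | left; exact: exp_pos].
  rewrite Rpow_mult_distr Rpower_root // cntE.
  apply: Rle_trans (HK1 _ f0) _.
  have q0 : 0 <= INR (fl x) * Fn (fl x) by apply: Rmult_le_pos; [exact: pos_INR | left; exact: Fnpos].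
  apply: Rmult_le_compat => //; first lra.
  by apply: Rle_trans (Rmax_r 1 K1) _; exact: pow_ge_self.
pose K := Rmax 1 (2 * D * K2); have m1 : 1 <= K by exact: Rmax_l.
exists K; split; first lra.
exists (INR N2 + 2) => x xN; have [x1 f0 fN f1 f2] := big x xN; have [P [S1 S2]] := sandwich x xN.
rewrite Rabs_pos_eq; last by left; exact: exp_pos.
apply: (@pow_le_inv h) => //; first by apply: Rmult_le_pos; [lra | exact: pos_INR].
rewrite Rpow_mult_distr Rpower_root // cntE.
apply: Rle_trans S2 _.
apply: Rle_trans (_ : 2 * D * (K2 * INR (count A (iota 1 (fl x))) ^ h) <= _).
  by apply: Rmult_le_compat_l; [lra | exact: HK2].
rewrite -Rmult_assoc; apply: Rmult_le_compat_r; first by apply: pow_le; exact: pos_INR.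
by apply: Rle_trans (Rmax_r 1 _) _; exact: pow_ge_self.
Qed.

End RandomSets.

From Coquelicot Require Import Coquelicot.
Open Scope R_scope.

Theorem theorem3 (h : nat) (b : nat -> nat)
  (Hh : (2 <= h)%nat)
  (Hb : forall i, (i < h)%nat -> (0 < b i)%nat)
  (Hgcd : gcd_coeffs h b = 1%nat)
  (F : R -> R)
  (Fpos : forall x, 1 <= x -> 0 < F x)
  (Fincr : forall x y, 1 <= x -> x <= y -> F x <= F y)
  (Fint : forall a c, 1 <= a -> a <= c -> ex_RInt F a c)
  (Fdoub : bigO (fun x => F (2 * x)) F)
  (Fgrowth :
     (bigO ln F /\ bigO F (fun x => Rpower x (/ INR (h - 1))))
     \/ (bigO (fun x => (ln x) ^ (2 * h * h)) F /\ bigO F (fun x => x ^ (h - 1)))) :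
  exists A : nat -> bool,
    asymp (fun x => INR (count_real A x)) (fun x => Rpower (x * F x) (/ INR h))
    /\ asymp_nat (fun n => INR (r_A b A h n)) (fun n => F (INR n)).
Proof.
refine (RandomSets.main_theorem _ _ Hgcd Fpos Fincr Fdoub Fgrowth).
- exact (ssrbool.introT ssrnat.leP Hh).
- intros i hi; apply (ssrbool.introT ssrnat.ltP), Hb; exact (ssrbool.elimT ssrnat.ltP hi).
Qed.
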